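(* Let $d\ge2$, let $u_1,\dots,u_d\in(0,1)$ be fixed, and let $\mathcal{C}=U\big(\prod_{j=1}^d(0,u_j)\big)$, viewed as a subset of $\mathbb{T}^d$. Assume that the triple $(U,x,v)\in \mathrm{SL}_d(\mathbb{R})\times\mathbb{T}^d\times\mathbb{R}^d$ is distributed according to a smooth density of compact support and that $\|U-\mathrm{Id}\|\le\eta$ where $\eta$ is sufficiently small. Then, as $T\to\infty$, $$\mathbf{D}(v,x,\mathcal{C},T)=\int_0^T\mathbf{1}_{\mathcal{C}}(x+vt)\,dt-T\,\mathrm{Vol}(\mathcal{C})$$ converges in distribution.
   Context: $\mathbb{T}^d=\mathbb{R}^d/\mathbb{Z}^d$; $x+vt$ is taken modulo $\mathbb{Z}^d$. ''Converges in distribution'' means there is a probability distribution on $\mathbb{R}$ to which the law of $\mathbf{D}(v,x,\mathcal{C},T)$ converges weakly, without any normalization. *)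

(* Defs.v *)
From HB Require Import structures.
From mathcomp Require Import all_boot all_order all_algebra.
From mathcomp Require Import all_classical all_reals all_analysis.
From mathcomp Require Import measurable_realfun.

Set Implicit Arguments.
Unset Strict Implicit.
Unset Printing Implicit Defensive.
Import Order.TTheory GRing.Theory Num.Theory.
Import numFieldNormedType.Exports.

Local Open Scope classical_set_scope.
Local Open Scope ring_scope.

Definition measure_matrix_display : measure_display.
Proof. exact: default_measure_display. Qed.

Section measurable_matrix.
Context (R : realType) (m n : nat).

Definition mx_entry (ij : 'I_m * 'I_n) (M : 'M[R]_(m, n)) : R := M ij.1 ij.2.

Definition mx_cylinder : set (set 'M[R]_(m, n)) :=
  [set X | exists ij (Y : set R), measurable Y /\ X = mx_entry ij @^-1` Y].

Let mx_set0 : <<s mx_cylinder >> set0.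
Proof. exact: sigma_algebra0. Qed.

Let mx_setC A : <<s mx_cylinder >> A -> <<s mx_cylinder >> (~` A).
Proof. exact: sigma_algebraC. Qed.

Let mx_bigcup (F : _^nat) : (forall i, <<s mx_cylinder >> (F i)) ->
  <<s mx_cylinder >> (\bigcup_i (F i)).
Proof. exact: sigma_algebra_bigcup. Qed.

HB.instance Definition _ := @isMeasurable.Build measure_matrix_display
  'M[R]_(m, n) <<s mx_cylinder >> mx_set0 mx_setC mx_bigcup.

End measurable_matrix.

Lemma measurable_mx_entry (R : realType) m n i j :
  measurable_fun [set: 'M[R]_(m, n)] (fun M => M i j).
Proof.
move=> _ Y mY; rewrite setTI; apply: sub_sigma_algebra.
by exists (i, j), Y.
Qed.

Lemma measurable_fun_mx (R : realType) m n d (T : measurableType d)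
    (f : T -> 'M[R]_(m, n)) :
  (forall i j, measurable_fun setT (fun t => f t i j)) -> measurable_fun setT f.
Proof.
move=> mf; apply: (@measurability _ _ _ _ _ _ (@mx_cylinder R m n)) => //.
move=> _ [_ [[i j] [Y [mY ->]]] <-].
exact: mf.
Qed.

Local Notation pushforward_measure :=
  measure_function_pushforward__canonical__measure_function_Measure.

Lemma sigma_finite_product_measure d1 d2 (T1 : measurableType d1)
    (T2 : measurableType d2) (R : realType)
    (mu : {sigma_finite_measure set T1 -> \bar R})
    (nu : {sigma_finite_measure set T2 -> \bar R}) :
  sigma_finite setT (mu \x nu)%E.
Proof.
have /sigma_finiteP[F [TF ndF Foo]] := sigma_finiteT mu.
have /sigma_finiteP[G [TG ndG Goo]] := sigma_finiteT nu.
exists (fun n => F n `*` G n).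
  rewrite -setXTT TF TG predeqE => -[x y]; split.
    move=> [/= [n _ Fnx] [k _ Gky]]; exists (maxn n k) => //; split.
    - by move: x Fnx; exact/subsetPset/ndF/leq_maxl.
    - by move: y Gky; exact/subsetPset/ndG/leq_maxr.
  by move=> [n _ []/= ? ?]; split; exists n.
move=> k; have [? ?] := Foo k; have [? ?] := Goo k.
split; first exact: measurableX.
by rewrite product_measure1E// lte_mul_pinfty// ge0_fin_numE.
Qed.

Section transport.
Context d1 d2 (T1 : measurableType d1) (T2 : measurableType d2) (R : realType).
Variables (mu : {measure set T1 -> \bar R}).
Hypothesis sf_mu : sigma_finite setT mu.
Variables (f : T1 -> T2) (g : T2 -> T1).
Hypothesis mg : measurable_fun setT g.
Hypothesis fK : cancel f g.

Lemma sigma_finite_pushforward : sigma_finite setT (pushforward mu f).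
Proof.
have [F FT Ff] := sf_mu.
exists (fun k => g @^-1` F k).
  by rewrite -preimage_bigcup -FT preimage_setT.
move=> k; split; first by rewrite -[X in measurable X]setTI; apply: mg => //; case: (Ff k).
rewrite /pushforward -comp_preimage (_ : g \o f = id); last exact/funext.
by rewrite preimage_id; case: (Ff k).
Qed.

End transport.

Section lebesgue_tuple.
Context (R : realType).

Definition tcons n (p : measurableTypeR R * n.-tuple R) : n.+1.-tuple R := [tuple of p.1 :: p.2].
Definition tuncons n (t : n.+1.-tuple R) : R * n.-tuple R :=
  (thead t, [tuple of behead t]).

Lemma measurable_tcons n : measurable_fun setT (@tcons n).
Proof. exact: (measurable_cons measurable_fst measurable_snd). Qed.

Lemma measurable_tuncons n : measurable_fun setT (@tuncons n).
Proof.
apply: measurable_fun_pair; first exact: measurable_tnth.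
exact: measurable_behead.
Qed.

Lemma tconsK n : cancel (@tcons n) (@tuncons n).
Proof. by move=> [x t]; rewrite /tuncons /tcons theadE; congr pair; apply/val_inj. Qed.

End lebesgue_tuple.

Section lebesgue_tuple_step.
Context (R : realType) (n : nat).
Variable mu : {sigma_finite_measure set (n.-tuple R) -> \bar R}.

Let lambda : {sigma_finite_measure set (measurableTypeR R) -> \bar R} :=
  lebesgue_measure.

Let nu : {measure set (measurableTypeR R * n.-tuple R)%type -> \bar R} :=
  (lambda \x mu)%E.

Definition lebesgue_tuple_step : set (n.+1.-tuple R) -> \bar R :=
  pushforward (lebesgue_measure \x mu)%E (@tcons R n).

HB.instance Definition _ := Measure.copy lebesgue_tuple_step
  (pushforward_measure nu (@measurable_tcons R n)).

HB.instance Definition _ := Measure_isSigmaFinite.Build _ _ _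
  lebesgue_tuple_step
  (sigma_finite_pushforward (mu := nu)
    (sigma_finite_product_measure lambda mu)
    (@measurable_tuncons R n) (@tconsK R n)).

End lebesgue_tuple_step.

Fixpoint lebesgue_tuple (R : realType) (n : nat) :
    {sigma_finite_measure set (n.-tuple R) -> \bar R} :=
  if n is n'.+1 then lebesgue_tuple_step (lebesgue_tuple R n')
  else dirac ([tuple] : 0.-tuple R).

Section lebesgue_mx.
Context (R : realType) (m n : nat).

Definition mx_of_tuple (t : (m * n).-tuple R) : 'M[R]_(m, n) :=
  \matrix_(i, j) tnth t (mxvec_index i j).

Definition tuple_of_mx (M : 'M[R]_(m, n)) : (m * n).-tuple R :=
  [tuple mxvec M 0 k | k < m * n].

Lemma measurable_mx_of_tuple : measurable_fun setT mx_of_tuple.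
Proof.
apply: measurable_fun_mx => i j.
under eq_fun do rewrite mxE.
exact: measurable_tnth.
Qed.

Lemma measurable_tuple_of_mx : measurable_fun setT tuple_of_mx.
Proof.
apply/measurable_fun_tnthP => k.
rewrite (_ : _ \o _ = fun M => mxvec M 0 k); last first.
  by apply/funext => M /=; rewrite tnth_mktuple.
case/mxvec_indexP: k => i j.
under eq_fun do rewrite mxvecE.
exact: measurable_mx_entry.
Qed.

Lemma mx_of_tupleK : cancel mx_of_tuple tuple_of_mx.
Proof.
move=> t; apply: eq_from_tnth => k; rewrite tnth_mktuple.
by case/mxvec_indexP: k => i j; rewrite mxvecE mxE.
Qed.

Definition lebesgue_mx : set 'M[R]_(m, n) -> \bar R :=
  pushforward (lebesgue_tuple R (m * n)) mx_of_tuple.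

HB.instance Definition _ := Measure.copy lebesgue_mx
  (pushforward_measure (lebesgue_tuple R (m * n)) measurable_mx_of_tuple).

HB.instance Definition _ := Measure_isSigmaFinite.Build _ _ _ lebesgue_mx
  (sigma_finite_pushforward (sigma_finiteT (lebesgue_tuple R (m * n)))
    measurable_tuple_of_mx mx_of_tupleK).

End lebesgue_mx.

Section haar_SL.
Context (R : realType) (d : nat).

Lemma measurable_det : measurable_fun [set: 'M[R]_d] (fun M => \det M).
Proof.
apply: measurable_sum => s; apply: measurable_funM => //.
by apply: measurable_prod => i _; exact: measurable_mx_entry.
Qed.

Lemma measurable_cone_det :
  measurable [set M : 'M[R]_d | 0 < \det M <= 1].
Proof.
rewrite (_ : mkset _ = (fun M : 'M[R]_d => \det M) @^-1` `]0, 1]%classic); last first.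
  by apply/seteqP; split => M /=; rewrite in_itv.
by rewrite -[X in measurable X]setTI; apply: measurable_det.
Qed.

(* The radial projection { det > 0 } -> SL_d(R). *)
Definition SL_proj (M : 'M[R]_d) : 'M[R]_d := (\det M `^ (- d%:R^-1)) *: M.

Lemma measurable_SL_proj : measurable_fun setT SL_proj.
Proof.
apply: measurable_fun_mx => i j; under eq_fun do rewrite mxE.
apply: measurable_funM; last exact: measurable_mx_entry.
by apply: (measurableT_comp (measurable_powR _)) => //; exact: measurable_det.
Qed.

(* Haar measure on SL_d(R), carried by the matrix space: the mass of B is the
   Lebesgue volume of the cone { t U | U in B, 0 < t <= 1 }, that is of
   { M | 0 < det M <= 1, (det M)^(-1/d) M in B }.  Multiplication by an element
   of SL_d(R) preserves Lebesgue measure on matrices and commutes with scaling,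
   so this measure is left and right invariant. *)
Definition haar_SL : set 'M[R]_d -> \bar R :=
  pushforward (mrestr (@lebesgue_mx R d d) measurable_cone_det) SL_proj.

HB.instance Definition _ := Measure.copy haar_SL
  (pushforward_measure (mrestr (@lebesgue_mx R d d) measurable_cone_det)
    measurable_SL_proj).

End haar_SL.

(* The torus R^d / Z^d: its points are represented in unit_cube = [0,1)^d, its
   subsets by Z^d-periodic subsets of R^d, and its functions by Z^d-periodic
   functions on R^d.  torus_set A is the preimage in R^d of the projection of A
   to the torus, and torus_vol A is the volume of that projection. *)
Section torus.
Context (R : realType) (d : nat).
Implicit Types (A : set 'cV[R]_d) (y : 'cV[R]_d).

Definition unit_cube : set 'cV[R]_d := [set y | forall i, 0 <= y i 0 < 1].

Definition torus_set A : set 'cV[R]_d :=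
  [set y | exists k : 'cV[int]_d, A (y + map_mx intr k)].

Definition torus_vol A : R :=
  fine (lebesgue_mx (torus_set A `&` unit_cube)).

Definition box (u : 'I_d -> R) : set 'cV[R]_d :=
  [set y | forall i, 0 < y i 0 < u i].

Definition mx_box (u : 'I_d -> R) (U : 'M[R]_d) : set 'cV[R]_d :=
  [set U *m y | y in box u].

Definition discrepancy (v x : 'cV[R]_d) A (T : R) : R :=
  \int[lebesgue_measure]_(t in `[0, T]) (\1_(torus_set A) (x + t *: v)) -
  T * torus_vol A.

End torus.

(* On the finite-dimensional spaces used here, f is of class C^(k+1) iff all its
   directional derivatives exist everywhere and are of class C^k. *)
Fixpoint Ck (R : realType) (V : normedModType R) (k : nat) (f : V -> R^o) :
    Prop :=
  if k is k'.+1 then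
    forall v, (forall x, derivable f x v) /\ Ck k' (fun x => 'D_v f x)
  else continuous f.

Definition smooth (R : realType) (V : normedModType R) (f : V -> R^o) : Prop :=
  forall k, Ck k f.

Section smooth_density.
Context (R : realType) (d : nat).

Definition sample_space : Type := ('M[R]_d * 'cV[R]_d * 'cV[R]_d)%type.
HB.instance Definition _ := Measurable.on sample_space.
HB.instance Definition _ := NormedModule.on sample_space.

(* SL_d(R) x T^d x R^d inside the ambient space M_d(R) x R^d x R^d. *)
Definition SL_T_R : set sample_space :=
  [set w | \det w.1.1 = 1 /\ unit_cube w.1.2].

(* SL_d(R) is a closed submanifold of M_d(R), so the smooth functions on
   SL_d(R) x T^d x R^d are the restrictions of the smooth functions on
   M_d(R) x R^d x R^d that are Z^d-periodic in x; the values of rho where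
   det U <> 1 play no role.  As T^d is compact, the support is compact iff its
   projection to SL_d(R) x R^d has compact closure. *)
Definition smooth_compact_density (rho : sample_space -> R) : Prop :=
  [/\ smooth (rho : _ -> R^o),
      forall U x v (k : 'cV[int]_d),
        rho (U, x + map_mx intr k, v) = rho (U, x, v),
      forall U x v, \det U = 1 -> 0 <= rho (U, x, v) &
      compact (closure [set w : 'M[R]_d * 'cV[R]_d | \det w.1 = 1 /\
        exists x, rho (w.1, x, w.2) != 0])].

Definition has_density dO (Omega : measurableType dO) (P : probability Omega R)
    (W : Omega -> sample_space) (rho : sample_space -> R) : Prop :=
  forall A, measurable A ->
    P (W @^-1` A) =
    (\int[(@haar_SL R d \x @lebesgue_mx R d 1) \x @lebesgue_mx R d 1]_(w in
        A `&` SL_T_R) (rho w)%:E)%E.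

End smooth_density.

Section convergence_in_distribution.
Local Open Scope ereal_scope.
Context dO (Omega : measurableType dO) (R : realType) (P : probability Omega R).

(* The first conjunct says that the X T are random variables, so that
   pushforward P (X T) is their law. *)
Definition cvg_in_distribution (X : R -> Omega -> R) : Prop :=
  (forall T, measurable_fun [set: Omega] (X T)) /\
  exists nu : probability R R, forall f : R -> R, continuous f ->
    (exists M : R, forall y, (`|f y| <= M)%R) ->
    \int[pushforward P (X T)]_y (f y)%:E @[T --> +oo%R] -->
    \int[nu]_y (f y)%:E.

End convergence_in_distribution.

(* Main.v *)
Require Import Defs.
From HB Require Import structures.
From mathcomp Require Import all_boot all_order all_algebra.
From mathcomp Require Import all_classical all_reals all_analysis.
From mathcomp Require Import measurable_realfun.
From mathcomp Require Import ring lra zify.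

(** For almost every (U, v) the discrepancy of the box is bounded: it is the
    increment, along the orbit of x, of a continuous function on the torus.

    Write e(s) = exp (2 pi i s). The Fourier coefficients c_k(U) of the indicator
    of U(box) are O(prod_j 1 / |(U^T k)_j|). Integrating the Fourier series along
    t |-> x + t v gives formally D(T) = A(x + T v) - A(x), where
    A(y) = sum_(k <> 0) c_k(U) e(k . y) / (2 pi i (k . v)).
    This series converges absolutely for almost every (U, v). Raise its terms to
    the power q = (d + 1/2) / (d + 1). As q < 1, each of the d + 1 factors is
    locally integrable, and for |k| ~ 2^n the integral of the term over a bounded
    set of (U, v) is O(2^(- n q (d + 1))) = O(2^(- n (d + 1/2))). As there are
    O(2^(n d)) such k, the sum of the q-th powers is finite almost everywhere
    (integral_partial_sum, ae_partial_sum), and a series whose terms have summable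
    q-th powers is summable (partial_sum_bcoef).

    The formula for D(T) is obtained from the Fejer means of the indicator. They
    converge to it off the faces of the box, which an orbit with generic v meets
    at countably many times, and their integrals along the orbit are partial sums
    of A(x + T v) - A(x) with Fejer weights (discrepancy_corr).

    It remains to find the limit law of A(x + T v) - A(x). As the law of (U, x, v)
    has a density, the Riemann-Lebesgue lemma shows that e(k . (x + T v)), k <> 0,
    tends to 0 in mean against every bounded function of (U, x, v)
    (riemann_lebesgue_dominated). Approximation by Fejer means extends this to
    functions H((U, x, v), y) that are continuous in y (equidistribution): in the
    limit, x + T v is uniform on the torus and independent of (U, x, v). So the
    discrepancy converges in distribution to A(y) - A(x), with y uniform and
    independent of (U, x, v).

    Closeness of U to the identity makes the box embed in the torus and gives an
    elementary change of variables for the linear map U. *)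

Set Implicit Arguments.
Unset Strict Implicit.
Unset Printing Implicit Defensive.
Import Order.TTheory GRing.Theory Num.Theory.
Import numFieldNormedType.Exports.

Local Open Scope classical_set_scope.
Local Open Scope ring_scope.

(** * Lebesgue measure on columns, one coordinate at a time *)

Lemma mxvec_index_col n (i : 'I_n) : mxvec_index i (ord0 : 'I_1) = i :> nat.
Proof.
have e : enum {: 'I_n * 'I_1} = [seq (j, ord0) | j <- enum 'I_n].
  rewrite enumT unlock /= /prod_enum.
  rewrite (_ : enum 'I_1 = [:: ord0]); first by elim: (enum 'I_n) => //= a l ->.
  by apply: (inj_map val_inj); rewrite val_enum_ord.
rewrite /mxvec_index /=.
have := nth_enum_rank (i, ord0) (i, (ord0 : 'I_1)).
rewrite e (nth_map i); last first.
  rewrite size_enum_ord; case: (enum_rank _) => /= m; by rewrite card_prod !card_ord muln1.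
case=> h; rewrite -[in RHS]h nth_enum_ord//.
by case: (enum_rank _) => /= m; rewrite card_prod !card_ord muln1.
Qed.

Section column_lebesgue.
Context (R : realType).

(** The coordinates of a column are peeled off one by one: Lebesgue measure
    on columns is an iterated product, and every integral below is computed
    by induction on the dimension through this constructor. *)
Definition ccons n (s : R) (y : 'cV[R]_n) : 'cV[R]_n.+1 :=
  \col_i oapp (fun j => y j 0) s (unlift ord0 i).

Lemma ccons0 n s (y : 'cV[R]_n) : ccons s y ord0 0 = s.
Proof. by rewrite mxE unlift_none. Qed.

Lemma cconsS n s (y : 'cV[R]_n) i : ccons s y (lift ord0 i) 0 = y i 0.
Proof. by rewrite mxE liftK. Qed.

Lemma measurable_fun_ccons d (T : measurableType d) n (f : T -> R)
    (g : T -> 'cV[R]_n) :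
  measurable_fun setT f -> measurable_fun setT g ->
  measurable_fun setT (fun t => ccons (f t) (g t)).
Proof.
move=> mf mg; apply: measurable_fun_mx => i j; under eq_fun do rewrite mxE.
case: (unliftP ord0 i) => [k _|_] //=.
exact: (measurableT_comp (measurable_mx_entry k 0) mg).
Qed.

Lemma measurable_ccons n :
  measurable_fun setT (fun p : measurableTypeR R * 'cV[R]_n => ccons p.1 p.2).
Proof. by apply: measurable_fun_ccons; [exact: measurable_fst|exact: measurable_snd]. Qed.

Definition col_of_tuple n (t : n.-tuple R) : 'cV[R]_n := \col_i tnth t i.

Lemma lebesgue_colE n (A : set 'cV[R]_n) :
  lebesgue_mx A = lebesgue_tuple R n (@col_of_tuple n @^-1` A).
Proof.
rewrite /lebesgue_mx /pushforward.
have gen N (e : n = N) : lebesgue_tuple R N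
    ((fun t : N.-tuple R => \col_i tnth t (cast_ord e i)) @^-1` A) =
    lebesgue_tuple R n (@col_of_tuple n @^-1` A).
  case: _ / e; congr (lebesgue_tuple R n _); apply/funext => t /=.
  by congr (A _); apply/colP => i; rewrite !mxE cast_ord_id.
rewrite -(gen _ (esym (muln1 n))); congr (lebesgue_tuple R _ _).
apply/funext => t /=; congr (A _); apply/matrixP => i j; rewrite !mxE ord1.
by congr (tnth t _); apply/val_inj; exact: mxvec_index_col.
Qed.

Local Notation lam := (@lebesgue_measure R).
Local Notation leb n := (@lebesgue_mx R n 1).

Lemma lebesgue_colS n (A : set 'cV[R]_n.+1) : measurable A ->
  leb n.+1 A = pushforward (lam \x leb n)%E (fun p => ccons p.1 p.2) A.
Proof.
move=> mA; rewrite lebesgue_colE /= /pushforward /product_measure1 /=.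
apply: eq_integral => s _ /=.
rewrite lebesgue_colE; congr (lebesgue_tuple R n _); apply/funext => t /=.

rewrite /xsection /= !inE; congr (A _); apply/colP => i; rewrite !mxE.
case: (unliftP ord0 i) => [j ->|->] /=; last by rewrite tnth0.
by rewrite tnthS mxE.
Qed.


Lemma ge0_integral_colS n (f : 'cV[R]_n.+1 -> \bar R) :
  measurable_fun setT f -> (forall y, 0 <= f y)%E ->
  (\int[leb n.+1]_y f y = \int[(lam \x leb n)%E]_p f (ccons p.1 p.2))%E.
Proof.
move=> mf f0.
rewrite (eq_measure_integral (pushforward (lam \x leb n)%E
  (fun p : measurableTypeR R * 'cV[R]_n => ccons p.1 p.2))).
- exact: measurable_ccons.
- by move=> mc; rewrite ge0_integral_pushforward.
- by move=> ? A mA _; exact: lebesgue_colS.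
Qed.

Lemma ge0_integral_colS1 n (f : 'cV[R]_n.+1 -> \bar R) :
  measurable_fun setT f -> (forall y, 0 <= f y)%E ->
  (\int[leb n.+1]_y f y = \int[lam]_s \int[leb n]_y f (ccons s y))%E.
Proof.
move=> mf f0; rewrite ge0_integral_colS//.
rewrite (fubini_tonelli1 (fun p : measurableTypeR R * 'cV[R]_n => f (ccons p.1 p.2)))//.
exact: (measurableT_comp mf (@measurable_ccons n)).
Qed.

Lemma ge0_integral_colS2 n (f : 'cV[R]_n.+1 -> \bar R) :
  measurable_fun setT f -> (forall y, 0 <= f y)%E ->
  (\int[leb n.+1]_y f y = \int[leb n]_y \int[lam]_s f (ccons s y))%E.
Proof.
move=> mf f0; rewrite ge0_integral_colS//.
rewrite (fubini_tonelli2 (fun p : measurableTypeR R * 'cV[R]_n => f (ccons p.1 p.2)))//.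
exact: (measurableT_comp mf (@measurable_ccons n)).
Qed.

Lemma integrable_colS n (f : 'cV[R]_n.+1 -> \bar R) :
  (leb n.+1).-integrable setT f ->
  (lam \x leb n)%E.-integrable setT (fun p : measurableTypeR R * 'cV[R]_n => f (ccons p.1 p.2)).
Proof.
move=> /integrableP[mf foo]; apply/integrableP; split.
  exact: (measurableT_comp mf (@measurable_ccons n)).
by rewrite -(@ge0_integral_colS n (fun y => `|f y|%E))//; exact: measurableT_comp.
Qed.

Lemma integral_colS n (f : 'cV[R]_n.+1 -> \bar R) :
  (leb n.+1).-integrable setT f ->
  (\int[leb n.+1]_y f y = \int[(lam \x leb n)%E]_p f (ccons p.1 p.2))%E.
Proof.
move=> intf; have /integrableP[mf _] := intf.
rewrite [LHS]integralE [RHS]integralE; congr (_ - _)%E; rewrite ge0_integral_colS//.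
- by apply: eq_integral => p _; rewrite !funeposE.
- exact: measurable_funepos.
- by apply: eq_integral => p _; rewrite !funenegE.
- exact: measurable_funeneg.
Qed.

Lemma integral_colS1 n (f : 'cV[R]_n.+1 -> \bar R) :
  (leb n.+1).-integrable setT f ->
  (\int[leb n.+1]_y f y = \int[lam]_s \int[leb n]_y f (ccons s y))%E.
Proof.
move=> intf; rewrite integral_colS//.
by rewrite -(integral12_prod_meas1 (integrable_colS intf)).
Qed.

Lemma integral_colS2 n (f : 'cV[R]_n.+1 -> \bar R) :
  (leb n.+1).-integrable setT f ->
  (\int[leb n.+1]_y f y = \int[leb n]_y \int[lam]_s f (ccons s y))%E.
Proof.
move=> intf; rewrite integral_colS//.
by rewrite -(integral21_prod_meas1 (integrable_colS intf)).
Qed.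

Lemma ge0_integral_col0 (f : 'cV[R]_0 -> \bar R) :
  measurable_fun setT f -> (forall y, 0 <= f y)%E -> (\int[leb 0]_y f y = f 0%R)%E.
Proof.
move=> mf f0.
have mc : measurable_fun setT (@col_of_tuple 0) by apply: measurable_fun_mx => -[].
rewrite (eq_measure_integral (pushforward (lebesgue_tuple R 0) (@col_of_tuple 0))); last first.
  by move=> A mA _; exact: lebesgue_colE.
rewrite ge0_integral_pushforward//= integral_dirac//=.
  by rewrite diracT mul1e; congr f; apply/colP => -[].
all: rewrite ?preimage_setT//.
exact: (measurableT_comp mf mc).
Qed.

End column_lebesgue.

(** * Affine changes of variables near the identity *)

Section affine.
Context (R : realType).
Local Notation lam := (@lebesgue_measure R).
Local Notation leb n := (@lebesgue_mx R n 1).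

Lemma ge0_integral_affine1 (a b : R) (f : R -> \bar R) : 0 < a ->
  measurable_fun setT f -> (forall s, 0 <= f s)%E ->
  (\int[lam]_s f s = a%:E * \int[lam]_s f (a * s + b)%R)%E.
Proof.
move=> a0 mf f0.
pose aff : R -> measurableTypeR R := fun s => a * s + b.
have maff : measurable_fun setT aff.
  by apply: measurable_funD => //; apply: measurable_funM.
rewrite (eq_measure_integral (mscale (NngNum (ltW a0)) (pushforward lam aff))).
- by rewrite ge0_integral_mscale//= ge0_integral_pushforward.
- move=> A mA _; apply: lebesgue_measure_unique => //= _ [[x y]] _ <-.
  rewrite /mscale /= /pushforward /=.
  rewrite (_ : aff @^-1` _ = `](x - b) / a, (y - b) / a]%classic); last first.
    apply/seteqP; split => s /=; rewrite !in_itv /= /aff ltr_pdivrMr// ler_pdivlMr//;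
    by rewrite ltrBlDr lerBrDr (mulrC s).
  rewrite !lebesgue_measure_itv/= !lte_fin ltr_pM2r ?invr_gt0// ltrD2r.
  case: ifPn => xy; last by rewrite mule0.
  by rewrite -!EFinB -EFinM; congr EFin; field; rewrite gt_eqF.
Qed.

Lemma measurable_mulmx_col n m (A : 'M[R]_(m, n)) :
  measurable_fun setT (fun y : 'cV[R]_n => A *m y).
Proof.
apply: measurable_fun_mx => i j; under eq_fun do rewrite mxE.
apply: measurable_sum => k; apply: measurable_funM => //.
exact: measurable_mx_entry.
Qed.

Lemma measurable_addmx d (T : measurableType d) m n (f g : T -> 'M[R]_(m, n)) :
  measurable_fun setT f -> measurable_fun setT g ->
  measurable_fun setT (fun t => f t + g t).
Proof.
move=> mf mg; apply: measurable_fun_mx => i j; under eq_fun do rewrite mxE.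
apply: measurable_funD.
  exact: (measurableT_comp (measurable_mx_entry i j) mf).
exact: (measurableT_comp (measurable_mx_entry i j) mg).
Qed.

Definition near1 n (A : 'M[R]_n) (e : R) :=
  forall i j, `|A i j - (i == j)%:R| <= e.

(** Schur complement of the top left entry: solving for the first coordinate
    turns the remaining equations into a system with this matrix. *)
Definition schur n (A : 'M[R]_n.+1) : 'M[R]_n :=
  \matrix_(i, j) (A (lift ord0 i) (lift ord0 j) -
     A (lift ord0 i) ord0 * A ord0 (lift ord0 j) / A ord0 ord0).

(** Each elimination step at most doubles the distance to the identity, which
    is why the tolerance in dimension n is of the order of 2^-n. *)
Lemma near1_schur n (A : 'M[R]_n.+1) e :
  e <= 2^-1 -> near1 A e -> near1 (schur A) (2 * e).
Proof.
move=> e2 nA i j; rewrite mxE.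
have e0 : 0 <= e by apply: le_trans (nA ord0 ord0).
have := nA ord0 ord0; rewrite eqxx /= ler_distl => /andP[a1 _].
have a0 : 2^-1 <= A ord0 ord0 by lra.
have := nA (lift ord0 i) ord0; rewrite eq_sym (negbTE (neq_lift _ _)) subr0 => h1.
have := nA ord0 (lift ord0 j); rewrite (negbTE (neq_lift _ _)) subr0 => h2.
have := nA (lift ord0 i) (lift ord0 j); rewrite (inj_eq lift_inj) => h3.
rewrite addrAC; apply: le_trans (ler_normB _ _) _.
rewrite [2 * e]mulr_natl mulr2n lerD// normrM normrM normfV.
rewrite (ger0_norm (_ : 0 <= A ord0 ord0)); last by lra.
rewrite ler_pdivrMr; last by lra.
apply: (@le_trans _ _ (e * e)); first by apply: ler_pM.
by apply: ler_pM => //; lra.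
Qed.

Lemma mulmx_ccons n (A : 'M[R]_n.+1) (b : 'cV[R]_n.+1) s (z : 'cV[R]_n) :
  A ord0 ord0 != 0 ->
  A *m ccons s z + b =
  let w := A ord0 ord0 * s + ((\sum_j A ord0 (lift ord0 j) * z j 0) + b ord0 0) in
  ccons w (schur A *m z +
    \col_i (b (lift ord0 i) 0 + A (lift ord0 i) ord0 / A ord0 ord0 * (w - b ord0 0))).
Proof.
move=> a0 /=; set w := A ord0 ord0 * s + _.
apply/colP => i; rewrite mxE [in LHS]mxE big_ord_recl ccons0.
under eq_bigr do rewrite cconsS.
case: (unliftP ord0 i) => [j ->|->]; last by rewrite ccons0 /w addrA.
rewrite cconsS [in RHS]mxE [X in _ = X + _]mxE [X in _ = _ + X]mxE /w.
under [X in _ = X + _]eq_bigr do rewrite mxE mulrBl.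
rewrite sumrB.
have -> : \sum_(k < n) A (lift ord0 j) ord0 * A ord0 (lift ord0 k) / A ord0 ord0 * z k 0
   = A (lift ord0 j) ord0 / A ord0 ord0 * \sum_(k < n) A ord0 (lift ord0 k) * z k 0.
  by rewrite mulr_sumr; apply: eq_bigr => k _; field.
by field.
Qed.

(** Gaussian elimination as iterated integration: the first coordinate is
    changed by a one-dimensional affine substitution, the others by the Schur
    complement. Closeness to the identity keeps all pivots away from 0. The
    constant c, the absolute value of the determinant, only enters through
    its upper bound. *)
Lemma ge0_integral_affine n (A : 'M[R]_n) :
  near1 A (2^-1 ^+ n / 2) ->
  exists2 c : R, 0 < c <= 2 ^+ n &
  forall (b : 'cV[R]_n) (f : 'cV[R]_n -> \bar R),
    measurable_fun setT f -> (forall y, 0 <= f y)%E ->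
    (\int[leb n]_y f y = c%:E * \int[leb n]_z f (A *m z + b)%R)%E.
Proof.
elim: n A => [|n IH] A nA.
  exists 1; first by rewrite expr0 ltr01 lexx.
  move=> b f mf f0; rewrite mul1e; apply: eq_integral => y _; congr f.
  by apply/colP => -[].
have h2 : 2^-1 ^+ n <= 1 :> R by rewrite exprn_ile1// ?invr_ge0// invf_le1// ler1n.
have h20 : 0 <= 2^-1 ^+ n :> R by rewrite exprn_ge0// invr_ge0.
have e2 : 2^-1 ^+ n.+1 / 2 <= 2^-1 :> R by rewrite exprS; lra.
have nS := near1_schur e2 nA.
have {}nS : near1 (schur A) (2^-1 ^+ n / 2).
  by move: nS; rewrite (_ : 2 * _ = 2^-1 ^+ n / 2)// exprS; field.
have := nA ord0 ord0; rewrite eqxx /= ler_distl => /andP[a1 a2].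
have a0 : 0 < A ord0 ord0 by lra.
have a0' : A ord0 ord0 != 0 by rewrite gt_eqF.
have [c /andP[c0 c2] cE] := IH (schur A) nS.
exists (A ord0 ord0 * c).
  apply/andP; split; first exact: mulr_gt0.
  by rewrite exprS; apply: ler_pM => //; [exact: ltW|exact: ltW|lra].
move=> b f mf f0.
pose sh w : 'cV[R]_n :=
  \col_i (b (lift ord0 i) 0 + A (lift ord0 i) ord0 / A ord0 ord0 * (w - b ord0 0)).
have msh : measurable_fun setT sh.
  apply: measurable_fun_mx => i j; under eq_fun do rewrite mxE.
  apply: measurable_funD => //; apply: measurable_funM => //.
  exact: measurable_funB.
pose g (p : measurableTypeR R * 'cV[R]_n) := ccons p.1 (schur A *m p.2 + sh p.1).
have mg : measurable_fun setT g.
  apply: measurable_fun_ccons; first exact: measurable_fst.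
  apply: measurable_addmx.
    exact: (measurableT_comp (measurable_mulmx_col (schur A)) measurable_snd).
  exact: (measurableT_comp msh measurable_fst).
have maff : measurable_fun setT (fun z : 'cV[R]_n.+1 => A *m z + b).
  by apply: measurable_addmx => //; exact: measurable_mulmx_col.
rewrite ge0_integral_colS1// [in RHS]ge0_integral_colS2//; last first.
  exact: (measurableT_comp mf maff).
transitivity (c%:E * \int[lam]_w \int[leb n]_z f (g (w, z)))%E.
  rewrite -ge0_integralZl ?lee_fin ?(ltW c0)//; last 2 first.
    - by apply: (measurable_fun_fubini_tonelli_F (fun p => f (g p))) => //; exact: measurableT_comp.
    - by move=> w _; apply: integral_ge0.
  apply: eq_integral => w _; rewrite (cE (sh w))//.
  by apply: (measurableT_comp mf); apply: measurable_fun_ccons.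
rewrite (fubini_tonelli (fun p : measurableTypeR R * 'cV[R]_n => f (g p)))//; last first.
  exact: measurableT_comp.
rewrite mulrC EFinM -muleA; congr (_ * _)%E.
rewrite -ge0_integralZl ?lee_fin ?(ltW a0)//; last 2 first.
  - apply: (measurable_fun_fubini_tonelli_G
     (fun p : measurableTypeR R * 'cV[R]_n => f (A *m (ccons p.1 p.2) + b))) => //.
    apply: (measurableT_comp mf); apply: (measurableT_comp maff).
    exact: measurable_ccons.
  - by move=> z _; apply: integral_ge0.
apply: eq_integral => z _.
rewrite (ge0_integral_affine1 (f := fun s => f (g (s, z)))
   ((\sum_j A ord0 (lift ord0 j) * z j 0) + b ord0 0) a0)//; last first.
  apply: (measurableT_comp mf); apply: measurable_fun_ccons => //=.
  by apply: measurable_addmx.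
congr (_ * _)%E; apply: eq_integral => s _.
by rewrite mulmx_ccons.
Qed.

Lemma integral_affine n (A : 'M[R]_n) (b : 'cV[R]_n) (c : R) :
  0 < c ->
  (forall (f : 'cV[R]_n -> \bar R),
    measurable_fun setT f -> (forall y, 0 <= f y)%E ->
    (\int[leb n]_y f y = c%:E * \int[leb n]_z f (A *m z + b)%R)%E) ->
  forall f : 'cV[R]_n -> \bar R, (leb n).-integrable setT f ->
    (\int[leb n]_y f y = c%:E * \int[leb n]_z f (A *m z + b)%R)%E.
Proof.
move=> c0 cE f /integrableP[mf foo].
have maff : measurable_fun setT (fun z : 'cV[R]_n => A *m z + b).
  by apply: measurable_addmx => //; exact: measurable_mulmx_col.
have intA : (leb n).-integrable setT (fun z => f (A *m z + b)).
  apply/integrableP; split; first exact: (measurableT_comp mf maff).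
  move: foo; rewrite (cE (fun y => `|f y|%E))//; last exact: measurableT_comp.
  case: (\int[leb n]_z _)%E => [r||]; rewrite ?ltry//.
  by rewrite gt0_muley// lte_fin.
rewrite [LHS]integralE [in RHS]integralE muleBr//; last first.
  by apply: fin_num_adde_defr; exact: integrable_pos_fin_num.
congr (_ - _)%E; rewrite cE//.
- by congr (_ * _)%E; apply: eq_integral => z _; rewrite !funeposE.
- exact: measurable_funepos.
- by congr (_ * _)%E; apply: eq_integral => z _; rewrite !funenegE.
- exact: measurable_funeneg.
Qed.

End affine.

(** * Oscillatory integrals over boxes *)

Lemma bounded_integrable d (T : measurableType d) (R : realType)
    (mu : {measure set T -> \bar R}) (A : set T) (f : T -> R) (M : R) :
  measurable A -> (mu A < +oo)%E -> measurable_fun setT f ->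
  (forall t, `|f t| <= M) -> mu.-integrable A (EFin \o f).
Proof.
move=> mA Aoo mf fM; apply: measurable_bounded_integrable => //.
  exact: measurable_funTS.
exists M; split; first exact: num_real.
by move=> y My x _; apply: le_trans (fM x) (ltW My).
Qed.

Section real_integrable.
Context d (T : measurableType d) (R : realType) (mu : {measure set T -> \bar R}).
Variables (D : set T) (mD : measurable D).

Lemma integrable_scale (f : T -> R) c : mu.-integrable D (EFin \o f) ->
  mu.-integrable D (EFin \o (fun z => c * f z)).
Proof.
move=> intf; rewrite (_ : _ \o _ = fun z => c%:E * (EFin \o f) z)%E//.
exact: integrableZl.
Qed.

Lemma integrable_add (f g : T -> R) : mu.-integrable D (EFin \o f) ->
  mu.-integrable D (EFin \o g) -> mu.-integrable D (EFin \o (fun z => f z + g z)).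
Proof.
move=> intf intg.
rewrite (_ : _ \o _ = fun z => (EFin \o f) z + (EFin \o g) z)%E//.
exact: integrableD.
Qed.

Lemma integrable_sum_seq (I : Type) (s : seq I) (f : I -> T -> R) :
  (forall i, mu.-integrable D (EFin \o f i)) ->
  mu.-integrable D (EFin \o (fun z => \sum_(i <- s) f i z)).
Proof.
move=> intf.
rewrite (_ : _ \o _ = fun z => \sum_(i <- s) (EFin \o f i) z)%E.
  by apply: integrable_sum => // i _.
by apply/funext => z; rewrite /= sumEFin.
Qed.

Lemma Rintegral_sum_seq (I : Type) (s : seq I) (f : I -> T -> R) :
  (forall i, mu.-integrable D (EFin \o f i)) ->
  \int[mu]_(x in D) (\sum_(i <- s) f i x) = \sum_(i <- s) \int[mu]_(x in D) f i x.
Proof.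
move=> intf; rewrite /Rintegral.
under eq_integral do rewrite -sumEFin.
rewrite integral_sum// (eq_bigr (fun i => (fine (\int[mu]_(x in D) (f i x)%:E))%:E)%E).
  by rewrite sumEFin.
by move=> i _; rewrite fineK//; apply: integrable_fin_num => //; exact: intf.
Qed.

End real_integrable.

Section boxes.
Context (R : realType).
Local Notation lam := (@lebesgue_measure R).
Local Notation leb n := (@lebesgue_mx R n 1).

Lemma integral_cos_affine (a b al xi : R) : a <= b -> xi != 0 ->
  (\int[lam]_(s in `[a, b]) (cos (al + xi * s))%:E =
   ((sin (al + xi * b) - sin (al + xi * a)) / xi)%:E)%E.
Proof.
rewrite le_eqVlt => /predU1P[->|ab] xi0.
  by rewrite set_itv1 integral_set1 subrr mul0r.
pose F s := sin (al + xi * s) / xi.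
have dF (s : R) : is_derive s (1:R) F (cos (al + xi * s)).
  have -> : cos (al + xi * s) = xi^-1 *: (cos (al + xi * s) * xi).
    by rewrite -[RHS]/(xi^-1 * (cos (al + xi * s) * xi)); field.
  have -> : F = xi^-1 *: (fun s => sin (al + xi * s)).
    by apply/funext => t; rewrite /F mulrC.
  apply: is_deriveZ; apply: is_derive1_comp.
  rewrite -[X in is_derive _ _ _ X]add0r; apply: is_deriveD.
  rewrite -[X in is_derive _ _ _ X]mulr1; exact: is_deriveZ.
have cF : continuous F.
  move=> s; apply: differentiable_continuous; apply/derivable1_diffP.
  exact: ex_derive.
rewrite (@continuous_FTC2 _ _ F)//.
- by rewrite -EFinB /F mulrBl.
- apply: continuous_subspaceT => s.
  apply: (@continuous_comp _ _ _ (fun s : R => al + xi * s) cos).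
    apply: cvgD; first exact: cvg_cst.
    by apply: cvgM; [exact: cvg_cst|exact: cvg_id].
  exact: continuous_cos.
- split => [s _||].
  + exact: ex_derive.
  + exact: (cvg_at_right_filter (cF a)).
  + exact: (cvg_at_left_filter (cF b)).
- by move=> s _; rewrite derive1E; exact: derive_val.
Qed.

Lemma measurable_box n (u : 'I_n -> R) : measurable (box u).
Proof.
rewrite (_ : box u = \bigcap_(i in [set: 'I_n]) ((fun y : 'cV[R]_n => y i 0) @^-1` `]0, u i[)).
  apply: fin_bigcap_measurable => // i _.
  by rewrite -[X in measurable X]setTI; exact: measurable_mx_entry.
apply/seteqP; split => y /=; first by move=> h i _ /=; rewrite in_itv/=.
by move=> h i; have := h i I; rewrite /= in_itv.
Qed.

Lemma measurable_prodE n (phi : 'I_n -> R -> R) :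
  (forall i, measurable_fun setT (phi i)) ->
  measurable_fun setT (fun y : 'cV[R]_n => \prod_i phi i (y i 0)).
Proof.
move=> mphi; apply: measurable_prod => i _.
exact: (measurableT_comp (mphi i) (measurable_mx_entry i 0)).
Qed.

Lemma integral_prod_col n (phi : 'I_n -> R -> R) :
  (forall i, measurable_fun setT (phi i)) -> (forall i s, 0 <= phi i s) ->
  (\int[leb n]_y (\prod_i phi i (y i 0))%:E =
   \prod_i \int[lam]_s (phi i s)%:E)%E.
Proof.
elim: n phi => [|n IH] phi mphi phi0.
  rewrite ge0_integral_col0 ?big_ord0//.
  - by apply/measurable_EFinP; exact: measurable_prodE.
  - by move=> y; rewrite lee_fin prodr_ge0.
rewrite ge0_integral_colS2; last 2 first.
- by apply/measurable_EFinP; exact: measurable_prodE.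
- by move=> y; rewrite lee_fin prodr_ge0.
rewrite big_ord_recl -(IH (fun i => phi (lift ord0 i)))//.
rewrite muleC -ge0_integralZr//; last 3 first.
- by apply/measurable_EFinP; exact: (@measurable_prodE n (fun i => phi (lift ord0 i))).
- by move=> y _; rewrite lee_fin prodr_ge0.
- by apply: integral_ge0 => s _; rewrite lee_fin.
apply: eq_integral => z _.
rewrite -ge0_integralZl//; last 3 first.
- by apply/measurable_EFinP; exact: mphi.
- by move=> s _; rewrite lee_fin.
- by rewrite lee_fin prodr_ge0.
apply: eq_integral => s _; rewrite big_ord_recl ccons0 mulrC EFinM.
by congr (_ * _)%E; congr EFin; apply: eq_bigr => i _; rewrite cconsS.
Qed.

Lemma measurable_prod_itv n (J : 'I_n -> interval R) :
  measurable [set y : 'cV[R]_n | forall i, y i 0 \in J i].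
Proof.
rewrite (_ : mkset _ =
    \bigcap_(i in [set: 'I_n]) ((fun y : 'cV[R]_n => y i 0) @^-1` [set` J i])).
  apply: fin_bigcap_measurable => // i _.
  by rewrite -[X in measurable X]setTI; exact: measurable_mx_entry.
by apply/seteqP; split => y /= h i => [_|]; [exact: h|exact: (h i I)].
Qed.

Lemma lebesgue_prod_itv n (J : 'I_n -> interval R) :
  leb n [set y | forall i, y i 0 \in J i] = (\prod_i lam [set` J i])%E.
Proof.
have mJ := measurable_prod_itv J.
rewrite -[LHS]mul1e -integral_cst//= integral_mkcond.
rewrite (eq_integral (fun y : 'cV[R]_n => (\prod_i \1_([set` J i]) (y i 0))%:E)).
  rewrite (integral_prod_col (phi := fun i s => \1_([set` J i]) s))//.
    by apply: eq_bigr => i _; rewrite integral_indic// setIT.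
  by move=> i; exact: measurable_indic.
move=> y _; rewrite patchE; case: (boolP (y \in _)) => [/set_mem yu|yu].
  by rewrite big1// => i _; rewrite indicE mem_set//=; exact: yu.
have [/existsP[i ni]|] := boolP [exists i, y i 0 \notin J i].
  by rewrite (bigD1 i)//= indicE memNset ?mul0r//=; exact/negP.
rewrite negb_exists => /forallP h; case/negP: yu; apply/mem_set => i.
by have := h i; rewrite negbK.
Qed.

Definition ibox n (M : R) : set 'cV[R]_n := [set y | forall i, y i 0 \in `[- M, M]].

Lemma measurable_ibox n M : measurable (@ibox n M).
Proof. exact: measurable_prod_itv. Qed.

Lemma lebesgue_ibox_lty n M : (leb n (@ibox n M) < +oo)%E.
Proof.
rewrite lebesgue_prod_itv.
have [a ->] : exists a : R, lam [set` `[- M, M]] = a%:E.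
  rewrite lebesgue_measure_itv /=; case: ifP => _; last by exists 0.
  by exists (M - - M); rewrite EFinB.
have [b ->] : exists b : R, (\prod_(i < n) a%:E)%E = b%:E; last exact: ltry.
elim/big_ind : _ => [|x y [b ->] [c ->]|i _]; [by exists 1| |by exists a].
by exists (b * c).
Qed.

Lemma lebesgue_box_lty n (u : 'I_n -> R) : (leb n (box u) < +oo)%E.
Proof.
pose M := \sum_i `|u i|.
apply: le_lt_trans (lebesgue_ibox_lty n M); apply: le_measure; rewrite ?inE.
- exact: measurable_box.
- exact: measurable_ibox.
move=> y yu i; have /andP[y0 yui] := yu i; rewrite in_itv /=.
have uM : `|u i| <= M by rewrite /M (bigD1 i)//= lerDl; exact: sumr_ge0.
have uu := ler_norm (u i); apply/andP; split; lra.
Qed.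

(** Value of the integral of cos (th + xi . z) over the box with sides u:
    integrating cos in one variable shifts the phase by - pi / 2 and divides
    by the frequency. The recursion keeps a single cosine, so that the bound
    is immediate. *)
Fixpoint cos_box n : ('I_n -> R) -> ('I_n -> R) -> R -> R :=
  if n is n'.+1 then fun u xi th =>
    (cos_box (fun i => u (lift ord0 i)) (fun i => xi (lift ord0 i))
       (th + xi ord0 * u ord0 - pi / 2) -
     cos_box (fun i => u (lift ord0 i)) (fun i => xi (lift ord0 i)) (th - pi / 2))
    / xi ord0
  else fun _ _ th => cos th.

Lemma cos_box_le n (u xi : 'I_n -> R) th :
  `|cos_box u xi th| <= \prod_i (2 / `|xi i|).
Proof.
elim: n u xi th => [|n IH] u xi th; first by rewrite big_ord0 cos_max.
rewrite big_ord_recl /= normrM normfV mulrAC ler_wpM2r ?invr_ge0//.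
apply: le_trans (ler_normB _ _) _.
by rewrite mulr_natl mulr2n lerD.
Qed.

Lemma measurable_cos_affine n (xi : 'I_n -> R) th :
  measurable_fun setT (fun z : 'cV[R]_n => cos (th + \sum_i xi i * z i 0)).
Proof.
apply: (measurableT_comp (continuous_measurable_fun (@continuous_cos R))).
apply: measurable_funD => //; apply: measurable_sum => i.
by apply: measurable_funM => //; exact: measurable_mx_entry.
Qed.

Lemma integrable_cos_box n (u xi : 'I_n -> R) th :
  (leb n).-integrable (box u) (fun z => (cos (th + \sum_i xi i * z i 0))%:E).
Proof.
apply: (@bounded_integrable _ _ _ _ _ _ 1) => //.
- exact: measurable_box.
- exact: lebesgue_box_lty.
- exact: measurable_cos_affine.
- by move=> z; exact: cos_max.
Qed.

Lemma integral_cos_box n (u xi : 'I_n -> R) th :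
  (forall i, 0 <= u i) -> (forall i, xi i != 0) ->
  (\int[leb n]_(z in box u) (cos (th + \sum_i xi i * z i 0))%:E =
   (cos_box u xi th)%:E)%E.
Proof.
elim: n u xi th => [|n IH] u xi th u0 xi0.
  rewrite integral_mkcond /=.
  rewrite (eq_integral (fun _ : 'cV[R]_0 => (cos th)%:E)).
    rewrite integral_cst//= -[leb 0 _]mul1e -integral_cst// ge0_integral_col0//.
    by rewrite mule1.
  move=> z _; rewrite patchE big_ord0 addr0 mem_set//.
  by case.
rewrite integral_mkcond integral_colS2; last first.
  by apply/integrable_restrict => //; [exact: measurable_box|rewrite setTI; exact: integrable_cos_box].
pose u' i := u (lift ord0 i); pose xi' i := xi (lift ord0 i).
rewrite (eq_integral (fun z : 'cV[R]_n => ((fun z : 'cV[R]_n =>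
  ((cos ((th + xi ord0 * u ord0 - pi / 2) + \sum_i xi' i * z i 0))%:E -
  (cos ((th - pi / 2) + \sum_i xi' i * z i 0))%:E) * ((xi ord0)^-1)%:E)
     \_ (box u')) z))%E.
  rewrite -integral_mkcond integralZr//; last 2 first.
    exact: measurable_box.
    by apply: integrableB; [exact: measurable_box|exact: integrable_cos_box..].
  rewrite integralB//; last 3 first.
    exact: measurable_box.
    exact: integrable_cos_box.
    exact: integrable_cos_box.
  by rewrite !IH// => i; [exact: u0|exact: xi0|exact: u0|exact: xi0].
move=> z _; rewrite patchE; case: (boolP (z \in _)) => zu; last first.
  apply: integral0_eq => s _; rewrite patchE memNset//.
  move=> h; case/negP : zu; apply/mem_set => i.
  by have := h (lift ord0 i); rewrite cconsS.
transitivity (\int[lam]_(s in `]0%R, u ord0[)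
   (cos ((th + \sum_i xi' i * z i 0) + xi ord0 * s))%:E)%E.
  rewrite [RHS]integral_mkcond; apply: eq_integral.
  move=> s _; rewrite !patchE.
  have -> : (ccons s z \in box u) = (s \in `]0, u ord0[%classic).
    apply/idP/idP => /set_mem h; apply/mem_set.
      by have := h ord0; rewrite ccons0 /= in_itv.
    move=> i; case: (unliftP ord0 i) => [j ->|->].
      by rewrite cconsS; move/set_mem: zu => /(_ j).
    by rewrite ccons0; move: h; rewrite /= in_itv.
  case: ifP => // _; rewrite big_ord_recl ccons0.
  under eq_bigr do rewrite cconsS.
  by rewrite addrA addrAC.
have mcos : measurable_fun setT (fun s => (cos (th + \sum_(i < n) xi' i * z i 0 + xi ord0 * s))%:E).
  apply/measurable_EFinP; apply: (measurableT_comp (continuous_measurable_fun (@continuous_cos R))).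
  by apply: measurable_funD => //; exact: measurable_funM.
rewrite integral_itv_obnd_cbnd; last exact: measurable_funTS.
rewrite integral_itv_bndo_bndc; last exact: measurable_funTS.
rewrite integral_cos_affine// mulr0 addr0 -EFinB -EFinM.
congr (_ / _)%:E.
have cospi2 (a : R) : cos (a - pi / 2) = sin a.
  by rewrite cosB cos_pihalf sin_pihalf mulr0 add0r mulr1.
rewrite -!cospi2; congr (cos _ - cos _); ring.
Qed.

End boxes.

(** * Fejer kernels and Fejer means on the torus *)

Section fejer1.
Context (R : realType).
Local Notation lam := (@lebesgue_measure R).

(** The half-open range [-N, N): its last Fejer weight vanishes at -N, so
    that the sums are the symmetric ones. *)
Definition irange N : seq int := [seq i%:Z - N%:Z | i <- iota 0 (N + N)].

(** Weights of the Cesaro means of a Fourier series. *)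
Definition fw N (j : int) : R := (N%:R - `|j|%:~R) / N%:R.

Definition fker N (t : R) : R := \sum_(j <- irange N) fw N j * cos (2 * pi * j%:~R * t).

Lemma normz_natr (m : nat) : `|m%:Z|%:~R = m%:R :> R.
Proof. by rewrite ger0_norm. Qed.

Lemma big_irange n (g : int -> R) :
  \sum_(j <- irange n.+1) (n.+1%:R - `|j|%:~R) * g j =
  n.+1%:R * g 0 + \sum_(i < n) (n%:R - i%:R) * (g i.+1%:Z + g (- i.+1%:Z)).
Proof.
have eiota m : iota 0 m = index_iota 0 m by rewrite /index_iota subn0.
rewrite /irange big_map eiota big_mkord big_split_ord /=.
rewrite addrC [X in X + _]big_ord_recl [X in _ + X](reindex_inj rev_ord_inj) /=.
rewrite [X in _ + X]big_ord_recr /=.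
rewrite addn0 subrr normr0 subr0 subnn sub0r normrN [X in _ + (_ + X)](_ : _ = 0); last first.
  by rewrite normz_natr subrr mul0r.
rewrite addr0 -addrA -big_split /=; congr (_ + _); apply: eq_bigr => i _.
rewrite mulrDr; congr (_ * _ + _ * _).
- rewrite /bump/= add1n (_ : _ - _ = i.+1%:Z); last by lia.
  by rewrite normz_natr -!natr1; ring.
- by congr g; rewrite /bump leq0n add1n; lia.
- rewrite (_ : (_ - _)%:Z - _ = - i.+1%:Z); last by have := ltn_ord i; lia.
  by rewrite normrN normz_natr -!natr1; ring.
- by congr g; have := ltn_ord i; lia.
Qed.

Lemma sin_dirichlet n (x : R) :
  sin x * (1 + 2 * \sum_(i < n) cos (2 * i.+1%:R * x)) = sin ((2 * n%:R + 1) * x).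
Proof.
elim: n => [|n IH]; first by rewrite big_ord0 mulr0n !mulr0 addr0 mulr1 add0r mul1r.
rewrite big_ord_recr/= [2 * (_ + _)]mulrDr addrA [sin x * _]mulrDr IH.
have -> : (2 * n%:R + 1) * x = 2 * n.+1%:R * x - x by rewrite -natr1; ring.
have -> : (2 * n.+1%:R + 1) * x = 2 * n.+1%:R * x + x by ring.
by rewrite sinB sinD; ring.
Qed.

(** Closed form sin^2(x) * N * F_N = sin^2(N x) of the Fejer kernel, from
    which follow its positivity and its concentration at the integers. *)
Lemma sin2_fejer n (x : R) :
  sin x ^+ 2 * (n.+1%:R + 2 * \sum_(i < n) (n%:R - i%:R) * cos (2 * i.+1%:R * x)) =
  sin (n.+1%:R * x) ^+ 2.
Proof.
elim: n => [|n IH]; first by rewrite big_ord0 mulr0 addr0 mulr1 mul1r.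
rewrite (_ : n.+2%:R + _ = (n.+1%:R + 2 * \sum_(i < n) (n%:R - i%:R) * cos (2 * i.+1%:R * x))
  + (1 + 2 * \sum_(i < n.+1) cos (2 * i.+1%:R * x))); last first.
  rewrite !big_ord_recr /=.
  rewrite (_ : \sum_(i < n) (n.+1%:R - i%:R) * cos (2 * i.+1%:R * x) =
     \sum_(i < n) (n%:R - i%:R) * cos (2 * i.+1%:R * x) + \sum_(i < n) cos (2 * i.+1%:R * x)).
    by rewrite -[n.+2%:R]natr1 -[n.+1%:R]natr1; ring.
  rewrite -big_split; apply: eq_bigr => i _ /=; rewrite -[n.+1%:R]natr1; ring.
rewrite mulrDr IH expr2 -(mulrA (sin x)) sin_dirichlet.
have -> : (2 * n.+1%:R + 1) * x = n.+2%:R * x + n.+1%:R * x by rewrite -[n.+2%:R]natr1; ring.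
have -> : sin x = sin (n.+2%:R * x - n.+1%:R * x).
  by congr sin; rewrite -[n.+2%:R]natr1; ring.
rewrite sinB sinD.
set a := n.+2%:R * x; set b := n.+1%:R * x.
have ha := cos2Dsin2 a; have hb := cos2Dsin2 b.
have -> : sin b ^+ 2 + (sin a * cos b - cos a * sin b) * (sin a * cos b + cos a * sin b)
  = sin b ^+ 2 + sin a ^+ 2 * cos b ^+ 2 - cos a ^+ 2 * sin b ^+ 2 by ring.
have -> : cos b ^+ 2 = 1 - sin b ^+ 2 by lra.
have -> : cos a ^+ 2 = 1 - sin a ^+ 2 by lra.
ring.
Qed.

Lemma fkerE n (t : R) : fker n.+1 t =
  (n.+1%:R + 2 * \sum_(i < n) (n%:R - i%:R) * cos (2 * i.+1%:R * (pi * t))) / n.+1%:R.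
Proof.
rewrite /fker.
under eq_bigr do rewrite /fw mulrAC.
rewrite -mulr_suml (big_irange n (fun j => cos (2 * pi * j%:~R * t))).
rewrite mulr0 mul0r cos0 mulr1; congr ((_ + _) / _).
rewrite mulr_sumr; apply: eq_bigr => i _.
rewrite intrN mulrN mulNr cosN -pmulrn.
by rewrite (_ : 2 * pi * i.+1%:R * t = 2 * i.+1%:R * (pi * t)); ring.
Qed.

(** Quantitative concentration: against the weight sin^2(pi t), which
    measures the distance of t to the integers, the kernel has size 1/N. *)
Lemma fker_sin2 n (t : R) : fker n.+1 t * sin (pi * t) ^+ 2 <= n.+1%:R^-1.
Proof.
rewrite fkerE mulrAC [X in X / _]mulrC sin2_fejer -[leRHS]mul1r ler_wpM2r ?invr_ge0//.
Qed.

Lemma fker_ge0 n (t : R) : 0 <= fker n.+1 t.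
Proof.
have [s0|s0] := eqVneq (sin (pi * t)) 0; last first.
  have h : 0 < sin (pi * t) ^+ 2 by rewrite lt_def sqrf_eq0 s0 sqr_ge0.
  by rewrite -(pmulr_rge0 _ h) fkerE mulrA sin2_fejer divr_ge0// sqr_ge0.
have sm m : sin (m%:R * (pi * t)) = 0.
  elim: m => [|m IH]; first by rewrite mul0r sin0.
  by rewrite -[m.+1%:R]natr1 mulrDl mul1r sinD IH s0 mul0r mulr0 addr0.
rewrite fkerE divr_ge0// addr_ge0// mulr_ge0//; apply: sumr_ge0 => i _.
rewrite mulr_ge0//; first by rewrite subr_ge0 ler_nat ltnW.
have -> : 2 * i.+1%:R * (pi * t) = (i.+1%:R * (pi * t)) *+ 2 by rewrite mulr2n; ring.
by rewrite cos_mulr2n cos2sin2 sm expr0n /= subr0 mulr2n addrK.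
Qed.

Lemma sum_fw_sin n (t : R) : \sum_(j <- irange n.+1) fw n.+1 j * sin (2 * pi * j%:~R * t) = 0.
Proof.
under eq_bigr do rewrite /fw mulrAC.
rewrite -mulr_suml (big_irange n (fun j => sin (2 * pi * j%:~R * t))).
rewrite mulr0 mul0r sin0 mulr0 add0r big1 ?mul0r// => i _.
by rewrite intrN mulrN mulNr sinN subrr mulr0.
Qed.

Lemma sum_fw_cos n (th t : R) :
  \sum_(j <- irange n.+1) fw n.+1 j * cos (th + 2 * pi * j%:~R * t) = cos th * fker n.+1 t.
Proof.
under eq_bigr do rewrite cosD mulrBr.
rewrite sumrB [X in _ - X](_ : _ = sin th * \sum_(j <- irange n.+1) fw n.+1 j * sin (2 * pi * j%:~R * t)).
  by rewrite sum_fw_sin mulr0 subr0 mulr_sumr; apply: eq_bigr => i _; rewrite mulrCA.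
by rewrite mulr_sumr; apply: eq_bigr => i _; rewrite mulrCA.
Qed.

Lemma sin2pi_int (j : int) (a : R) : sin (a + 2 * pi * j%:~R) = sin a.
Proof.
have nat_case (m : nat) (b : R) : sin (b + 2 * pi * m%:R) = sin b.
  elim: m b => [|m IH] b; first by rewrite mulr0 addr0.
  rewrite -[m.+1%:R]natr1 mulrDr mulr1 addrA.
  by rewrite [X in _ + X](_ : _ = pi *+ 2) ?mulr_natl// sinD2pi -mulr_natl IH.
case: j => m; first exact: nat_case.
rewrite NegzE intrN mulrN -pmulrn.
by rewrite -[in RHS](subrK (2 * pi * m.+1%:R) a) nat_case.
Qed.

Lemma cos2pi_int (j : int) (a : R) : cos (a + 2 * pi * j%:~R) = cos a.
Proof.
have cospi2 (b : R) : sin (b + pi / 2) = cos b.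
  by rewrite sinD cos_pihalf sin_pihalf mulr0 add0r mulr1.
by rewrite -!cospi2 addrAC sin2pi_int.
Qed.

Lemma integral_cos_period (j : int) (th : R) :
  (\int[lam]_(s in `[0%R, 1%R]) (cos (th + 2 * pi * j%:~R * s))%:E =
   (if j == 0 then cos th else 0)%:E)%E.
Proof.
have [->|j0] := eqVneq j 0.
  rewrite (eq_integral (fun=> (cos th)%:E)); last by move=> s _; rewrite mulr0 mul0r addr0.
  by rewrite integral_cst//= lebesgue_measure_itv/= lte_fin ltr01 -EFinB subr0 mule1.
rewrite integral_cos_affine// ?mulr1 ?mulr0 ?addr0 ?sin2pi_int ?subrr ?mul0r//.
by rewrite !mulf_neq0 ?intr_eq0// gt_eqF// pi_gt0.
Qed.

Lemma measurable_fker N : measurable_fun setT (fker N).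
Proof.
apply: measurable_sum => j; apply: measurable_funM => //.
apply: (measurableT_comp (continuous_measurable_fun (@continuous_cos R))).
exact: measurable_funM.
Qed.

Lemma integral_fker n (t : R) :
  (\int[lam]_(s in `[0%R, 1%R[) (fker n.+1 (t - s))%:E = 1)%E.
Proof.
rewrite integral_itv_bndo_bndc; last first.
  apply/measurable_EFinP/measurable_funTS.
  by apply: (measurableT_comp (measurable_fker _)); exact: measurable_funB.
transitivity (\int[lam]_(s in `[0%R, 1%R]) (\sum_(j <- irange n.+1)
  ((fw n.+1 j)%:E * (cos (- (2 * pi * j%:~R * t) + 2 * pi * j%:~R * s))%:E)))%E.
  apply: eq_integral => s _; rewrite sumEFin; congr EFin.
  rewrite /fker; apply: eq_bigr => j _; rewrite -cosN; congr (_ * cos _); ring.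
have ic j : lam.-integrable `[0, 1] (fun s => (cos (- (2 * pi * j%:~R * t) + 2 * pi * j%:~R * s))%:E).
  apply: (@bounded_integrable _ _ _ _ _ _ 1) => //.
  - by rewrite /= lebesgue_measure_itv /= lte_fin ltr01 ltry.
  - apply: (measurableT_comp (continuous_measurable_fun (@continuous_cos R))).
    by apply: measurable_funD => //; exact: measurable_funM.
  - by move=> s; exact: cos_max.
rewrite integral_sum//; last by move=> j; exact: integrableZl.
rewrite (eq_bigr (fun j => (fw n.+1 j * (if j == 0 then 1 else 0))%:E)); last first.
  move=> j _; rewrite integralZl// integral_cos_period -EFinM; congr (_ * _)%:E.
  by case: eqVneq => // ->; rewrite mulr0 mul0r oppr0 cos0.
rewrite sumEFin; congr EFin.
under eq_bigr do rewrite /fw mulrAC.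
rewrite -mulr_suml (big_irange n (fun j => if j == 0 then 1 else 0)) eqxx mulr1.
rewrite big1 ?addr0 ?divff// => i _.
by rewrite oppr_eq0 /= addr0 mulr0.
Qed.

End fejer1.

Section fejerd.
Context (R : realType).
Local Notation lam := (@lebesgue_measure R).
Local Notation leb n := (@lebesgue_mx R n 1).
Local Notation cube d := (@unit_cube R d).

(** Frequencies are summed over finite cubes, given as duplicate-free
    sequences so that a cube is a product of ranges by construction. *)
Fixpoint Zbox (d N : nat) : seq (d.-tuple int) :=
  if d is d'.+1 then [seq cons_tuple j k | j <- irange N, k <- Zbox d' N]
  else [:: nil_tuple int].

Lemma ZboxS d N :
  Zbox d.+1 N = [seq cons_tuple j k | j <- irange N, k <- Zbox d N].
Proof. by []. Qed.

Definition fwt d N (k : d.-tuple int) : R := \prod_i fw R N (tnth k i).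

Definition zdot d (k : d.-tuple int) (y : 'cV[R]_d) : R :=
  \sum_i (tnth k i)%:~R * y i 0.

Lemma sum_Zbox_cos d n th (t : 'I_d -> R) :
  \sum_(k <- Zbox d n.+1) fwt n.+1 k *
     cos (th + 2 * pi * \sum_i (tnth k i)%:~R * t i) =
  cos th * \prod_i fker n.+1 (t i).
Proof.
elim: d th t => [|d IH] th t.
  by rewrite big_seq1 /fwt !big_ord0 mulr0 addr0 mulrC.
rewrite ZboxS big_allpairs_dep big_ord_recl mulrA -sum_fw_cos mulr_suml.
apply: eq_bigr => j _.
rewrite -mulrA -IH mulr_sumr; apply: eq_bigr => k _.
rewrite /fwt !big_ord_recl tnth0 -mulrA; congr (_ * (_ * _)).
  by apply: eq_bigr => i _; rewrite tnthS.
under eq_bigr do rewrite tnthS.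
by congr cos; ring.
Qed.

Definition kerd d N (y z : 'cV[R]_d) : R := \prod_i fker N (y i 0 - z i 0).

Lemma measurable_cube d : measurable (cube d).
Proof.
rewrite (_ : cube d = \bigcap_(i in [set: 'I_d]) ((fun y : 'cV[R]_d => y i 0) @^-1` `[0, 1[)).
  apply: fin_bigcap_measurable => // i _.
  by rewrite -[X in measurable X]setTI; exact: measurable_mx_entry.
apply/seteqP; split => y /=; first by move=> h i _ /=; rewrite in_itv/=.
by move=> h i; have := h i I; rewrite /= in_itv.
Qed.

Lemma lebesgue_cube d : leb d (cube d) = 1%E.
Proof.
have -> : cube d = [set y | forall i, y i 0 \in `[0, 1[].
  by apply/seteqP; split => y /= h i; have := h i; rewrite in_itv.
rewrite lebesgue_prod_itv big1// => i _.
by rewrite lebesgue_measure_itv /= lte_fin ltr01 -EFinB subr0.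
Qed.

Lemma cube_integrable d (f : 'cV[R]_d -> R) (M : R) :
  measurable_fun setT f -> (forall z, `|f z| <= M) ->
  (leb d).-integrable (cube d) (EFin \o f).
Proof.
move=> mf fM; apply: (bounded_integrable _ _ mf fM); first exact: measurable_cube.
by rewrite /= lebesgue_cube ltry.
Qed.

Lemma indic_cube d (y : 'cV[R]_d) :
  \1_(cube d) y = \prod_i \1_(`[0, 1[%classic) (y i 0) :> R.
Proof.
rewrite indicE; case: (boolP (y \in cube d)) => [/set_mem yu|yu].
  rewrite big1// => i _; rewrite indicE mem_set//=.
  by have := yu i; rewrite in_itv.
have [/existsP[i ni]|] := boolP [exists i, ~~ (0 <= y i 0 < 1)].
  rewrite (bigD1 i)//= indicE memNset ?mul0r//= in_itv/=.
  exact/negP.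
rewrite negb_exists => /forallP h; case/negP: yu; apply/mem_set => i.
by have := h i; rewrite negbK.
Qed.

Lemma integral_cube_prod d (phi : 'I_d -> R -> R) :
  (forall i, measurable_fun setT (phi i)) -> (forall i s, 0 <= phi i s) ->
  (\int[leb d]_(y in cube d) (\prod_i phi i (y i 0))%:E =
   \prod_i \int[lam]_(s in `[0%R, 1%R[) (phi i s)%:E)%E.
Proof.
move=> mphi phi0; rewrite integral_mkcond.
transitivity (\int[leb d]_y (\prod_i (\1_(`[0, 1[%classic) (y i 0) * phi i (y i 0))%R)%:E)%E.
  apply: eq_integral => y _; rewrite big_split /= -indic_cube patchE indicE.
  by case: ifP => _; rewrite ?mul1r ?mul0r.
rewrite (integral_prod_col (phi := fun i s => \1_(`[0, 1[%classic) s * phi i s)).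
- apply: eq_bigr => i _; rewrite [RHS]integral_mkcond; apply: eq_integral => s _.
  by rewrite patchE indicE; case: ifP => _; rewrite ?mul1r ?mul0r.
- by move=> i; apply: measurable_funM => //; exact: measurable_indic.
- by move=> i s; rewrite mulr_ge0.
Qed.

Lemma fker_bound N : exists C, forall t, `|fker N t| <= C :> R.
Proof.
exists (\sum_(j <- irange N) `|fw R N j|) => t.
apply: le_trans (ler_norm_sum _ _ _) _; apply: ler_sum => j _.
by rewrite normrM ler_piMr// cos_max.
Qed.

Lemma kerd_bound d N : exists C, forall y z : 'cV[R]_d, `|kerd N y z| <= C.
Proof.
have [C hC] := fker_bound N.
exists (\prod_(i < d) C) => y z; rewrite normr_prod; apply: ler_prod => i _.
by rewrite normr_ge0 hC.
Qed.

Lemma kerd_ge0 d n (y z : 'cV[R]_d) : 0 <= kerd n.+1 y z.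
Proof. by apply: prodr_ge0 => i _; exact: fker_ge0. Qed.

Lemma measurable_kerd d N (y : 'cV[R]_d) : measurable_fun setT (kerd N y).
Proof.
apply: (@measurable_prodE _ _ (fun i s => fker N (y i 0 - s))) => i.
by apply: (measurableT_comp (@measurable_fker R N)); exact: measurable_funB.
Qed.

Lemma integral_kerd d n (y : 'cV[R]_d) :
  (\int[leb d]_(z in cube d) (kerd n.+1 y z)%:E = 1)%E.
Proof.
rewrite (integral_cube_prod (phi := fun i s => fker n.+1 (y i 0 - s))).
- by rewrite big1// => i _; rewrite integral_fker.
- move=> i; apply: (measurableT_comp (@measurable_fker R _)).
  exact: measurable_funB.
- by move=> i s; exact: fker_ge0.
Qed.

(** The sum of sin2 (y_i - z_i) over the coordinates is the measure of
    distance on the torus used throughout: it is periodic and compatible with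
    the Fejer kernel. *)
Definition sin2 (s : R) := sin (pi * s) ^+ 2.

Lemma measurable_sin2 : measurable_fun setT sin2.
Proof.
apply: measurable_funX.
apply: (measurableT_comp (continuous_measurable_fun (@continuous_sin R))).
exact: measurable_funM.
Qed.

Lemma sin2_ge0 s : 0 <= sin2 s. Proof. exact: sqr_ge0. Qed.

Lemma sin2_le1 s : sin2 s <= 1.
Proof. by rewrite /sin2 -real_normK ?num_real// expr_le1// sin_max. Qed.

Lemma integral_kerd_sin2 d n (y : 'cV[R]_d) i :
  (\int[leb d]_(z in cube d) (kerd n.+1 y z * sin2 (y i 0 - z i 0))%:E <=
   (n.+1%:R^-1)%:E)%E.
Proof.
pose phi j s := fker n.+1 (y j 0 - s) * (if j == i then sin2 (y i 0 - s) else 1).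
have mphi j : measurable_fun setT (phi j).
  apply: measurable_funM.
    apply: (measurableT_comp (@measurable_fker R _)); exact: measurable_funB.
  case: eqP => // _; apply: (measurableT_comp measurable_sin2); exact: measurable_funB.
have phi0 j s : 0 <= phi j s.
  by rewrite mulr_ge0 ?fker_ge0//; case: ifP => // _; exact: sin2_ge0.
rewrite (eq_integral (fun z : 'cV[R]_d => (\prod_j phi j (z j 0))%:E)); last first.
  move=> z _; congr EFin; rewrite /phi big_split /=; congr (_ * _).
  rewrite (bigD1 i)//= eqxx big1 ?mulr1// => j ji; by rewrite (negbTE ji).
rewrite integral_cube_prod// (bigD1 i)//= big1 ?mule1.
  rewrite (_ : (n.+1%:R^-1)%:E = \int[lam]_(s in `[0%R, 1%R[) (n.+1%:R^-1)%:E)%E.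
    apply: ge0_le_integral => //.
    - by move=> s _; rewrite lee_fin.
    - by apply/measurable_EFinP; apply: measurable_funTS; exact: mphi.
    - by move=> s _; rewrite lee_fin /phi eqxx fker_sin2.
  by rewrite integral_cst//= lebesgue_measure_itv/= lte_fin ltr01 -EFinB subr0 mule1.
move=> j ji; rewrite /phi (negbTE ji) /=.
rewrite -(@integral_fker R n (y j 0)); apply: eq_integral => s _.
by rewrite mulr1.
Qed.

(** Fourier coefficients are kept in real form: fcos and fsin are the cosine
    and sine coefficients of a function on the torus. *)
Definition fcos d (k : d.-tuple int) (g : 'cV[R]_d -> R) : R :=
  \int[leb d]_(z in cube d) (cos (2 * pi * zdot k z) * g z).

Definition fsin d (k : d.-tuple int) (g : 'cV[R]_d -> R) : R :=
  \int[leb d]_(z in cube d) (sin (2 * pi * zdot k z) * g z).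

Definition fejer d N (g : 'cV[R]_d -> R) (y : 'cV[R]_d) : R :=
  \sum_(k <- Zbox d N) fwt N k *
    (cos (2 * pi * zdot k y) * fcos k g + sin (2 * pi * zdot k y) * fsin k g).

Lemma measurable_zdot d (k : d.-tuple int) : measurable_fun setT (zdot k).
Proof.
apply: measurable_sum => i; apply: measurable_funM => //; exact: measurable_mx_entry.
Qed.

Lemma measurable_cos_zdot d (k : d.-tuple int) :
  measurable_fun setT (fun z => cos (2 * pi * zdot k z)).
Proof.
apply: (measurableT_comp (continuous_measurable_fun (@continuous_cos R))).
by apply: measurable_funM => //; exact: measurable_zdot.
Qed.

Lemma measurable_sin_zdot d (k : d.-tuple int) :
  measurable_fun setT (fun z => sin (2 * pi * zdot k z)).
Proof.
apply: (measurableT_comp (continuous_measurable_fun (@continuous_sin R))).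
by apply: measurable_funM => //; exact: measurable_zdot.
Qed.

Lemma fejerE d n (g : 'cV[R]_d -> R) (M : R) y : measurable_fun setT g ->
  (forall z, `|g z| <= M) ->
  fejer n.+1 g y = \int[leb d]_(z in cube d) (kerd n.+1 y z * g z).
Proof.
move=> mg gM.
have ic k : (leb d).-integrable (cube d) (EFin \o (fun z => cos (2 * pi * zdot k z) * g z)).
  apply: (cube_integrable (M := M)).
    by apply: measurable_funM => //; exact: measurable_cos_zdot.
  by move=> z; rewrite normrM (le_trans _ (gM z))// ler_piMl// cos_max.
have is_ k : (leb d).-integrable (cube d) (EFin \o (fun z => sin (2 * pi * zdot k z) * g z)).
  apply: (cube_integrable (M := M)).
    by apply: measurable_funM => //; exact: measurable_sin_zdot.
  by move=> z; rewrite normrM (le_trans _ (gM z))// ler_piMl// sin_max.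
have mC := @measurable_cube d.
rewrite [RHS](_ : _ = \int[leb d]_(z in cube d) (\sum_(k <- Zbox d n.+1)
   fwt n.+1 k * (cos (2 * pi * zdot k y) * (cos (2 * pi * zdot k z) * g z) +
                 sin (2 * pi * zdot k y) * (sin (2 * pi * zdot k z) * g z)))); last first.
  apply: eq_Rintegral => z _.
  have := @sum_Zbox_cos d n 0 (fun i => y i 0 - z i 0).
  rewrite cos0 mul1r -/(kerd n.+1 y z) => <-.
  rewrite mulr_suml; apply: eq_bigr => k _; rewrite -mulrA; congr (_ * _).
  rewrite !mulrA -mulrDl; congr (_ * _); rewrite add0r -cosB; congr cos.
  rewrite -mulrBr; congr (_ * _); rewrite /zdot -sumrB.
  by apply: eq_bigr => i _; rewrite mulrBr.
have i3 k c c' : (leb d).-integrable (cube d) (EFin \o (fun z => c * (cos (2 * pi * zdot k z) * g z) +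
     c' * (sin (2 * pi * zdot k z) * g z))).
  apply: integrable_add => //.
    by apply: (integrable_scale mC c (ic k)).
  by apply: (integrable_scale mC c' (is_ k)).
rewrite Rintegral_sum_seq//; last first.
  by move=> k; apply: integrable_scale => //; exact: i3.
apply: eq_bigr => k _.
rewrite [RHS](RintegralZl _ mC (i3 k _ _)); congr (_ * _).
rewrite [RHS](RintegralD mC (integrable_scale mC _ (ic k)) (integrable_scale mC _ (is_ k))).
by rewrite (RintegralZl _ mC (ic k)) (RintegralZl _ mC (is_ k)).
Qed.

(** Fejer means are averages against a probability kernel, so they differ
    from g y by at most the oscillation e of g near y plus the mass of the
    kernel away from y, where |g z - g y| <= 2 M <= 2 M / del * sum sin2 and
    fker_sin2 applies. *)
Lemma fejer_approx d n (g : 'cV[R]_d -> R) (M : R) (y : 'cV[R]_d) (e del : R) :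
  measurable_fun setT g -> (forall z, `|g z| <= M) -> 0 <= e -> 0 < del ->
  (forall z : 'cV[R]_d, \sum_i sin2 (y i 0 - z i 0) < del -> `|g z - g y| <= e) ->
  `|fejer n.+1 g y - g y| <= e + 2 * M * d%:R / (del * n.+1%:R).
Proof.
move=> mg gM e0 del0 gy.
have M0 : 0 <= M by apply: le_trans (gM y).
have mC := @measurable_cube d.
have [C kC] := kerd_bound d n.+1.
have ik : (leb d).-integrable (cube d) (EFin \o kerd n.+1 y).
  by apply: (cube_integrable (M := C)) => //; exact: measurable_kerd.
have ikh (h : 'cV[R]_d -> R) B : measurable_fun setT h -> (forall z, `|h z| <= B) ->
    (leb d).-integrable (cube d) (EFin \o (fun z => kerd n.+1 y z * h z)).
  move=> mh hB; apply: (cube_integrable (M := C * B)).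
    by apply: measurable_funM => //; exact: measurable_kerd.
  by move=> z; rewrite normrM ler_pM.
have k1 : \int[leb d]_(z in cube d) kerd n.+1 y z = 1.
  by rewrite /Rintegral integral_kerd.
have -> : fejer n.+1 g y - g y =
    \int[leb d]_(z in cube d) (kerd n.+1 y z * (g z - g y)).
  rewrite (fejerE _ _ mg gM) -[X in _ - X]mul1r -k1 -RintegralZr//.
  rewrite -RintegralB//; last 2 first.
    exact: (ikh _ M).
    by apply: (ikh (fun=> g y) M) => //.
  by apply: eq_Rintegral => z _; rewrite mulrBr.
have mB : measurable_fun setT (fun z => g z - g y) by exact: measurable_funB.
have B2 z : `|g z - g y| <= 2 * M.
  by rewrite mulr_natl mulr2n (le_trans (ler_normB _ _))// lerD.
have msin i : measurable_fun setT (fun z : 'cV[R]_d => sin2 (y i 0 - z i 0)).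
  apply: (measurableT_comp measurable_sin2); apply: measurable_funB => //.
  exact: measurable_mx_entry.
have s1 i (z : 'cV[R]_d) : `|sin2 (y i 0 - z i 0)| <= 1.
  by rewrite ger0_norm ?sin2_ge0// sin2_le1.
apply: le_trans (le_normr_Rintegral mC (ikh _ _ mB B2)) _.
pose F z := kerd n.+1 y z * e +
  (2 * M / del) * \sum_(i < d) kerd n.+1 y z * sin2 (y i 0 - z i 0).
have iF1 : (leb d).-integrable (cube d) (EFin \o (fun z => kerd n.+1 y z * e)).
  by apply: (ikh (fun=> e) `|e|).
have iF2 : (leb d).-integrable (cube d) (EFin \o (fun z =>
    \sum_(i < d) kerd n.+1 y z * sin2 (y i 0 - z i 0))).
  by apply: integrable_sum_seq => // i; exact: (ikh _ 1).
have iF2' : (leb d).-integrable (cube d) (EFin \o (fun z => (2 * M / del) *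
    \sum_(i < d) kerd n.+1 y z * sin2 (y i 0 - z i 0))).
  exact: integrable_scale.
apply: (@le_trans _ _ (\int[leb d]_(z in cube d) F z)).
  apply: le_Rintegral => //.
  - have := integrable_norm (ikh _ _ mB B2); exact.
  - exact: integrable_add.
  - move=> z _; rewrite normrM (ger0_norm (kerd_ge0 _ _ _)) /F -mulr_sumr mulrCA -mulrDr.
    apply: ler_wpM2l; first exact: kerd_ge0.
    have S0 : 0 <= \sum_(i < d) sin2 (y i 0 - z i 0) by apply: sumr_ge0 => i _; exact: sin2_ge0.
    have [lt|ge] := ltP (\sum_(i < d) sin2 (y i 0 - z i 0)) del.
      by rewrite (le_trans (gy _ lt))// lerDl mulr_ge0// divr_ge0// ?mulr_ge0// ltW.
    rewrite (le_trans (B2 z))// -[leLHS]add0r lerD// -(mulrA (2 * M)) ler_peMr ?mulr_ge0//.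
    by rewrite mulrC ler_pdivlMr// mul1r.
rewrite RintegralD// RintegralZr// k1 mul1r lerD2l RintegralZl//.
rewrite Rintegral_sum_seq//; last by move=> i; exact: (ikh _ 1).
rewrite (_ : 2 * M * d%:R / _ = (2 * M / del) * (d%:R * n.+1%:R^-1)); last first.
  by rewrite invfM; ring.
apply: ler_wpM2l; first by rewrite divr_ge0// ?mulr_ge0// ltW.
rewrite mulr_natl -[X in _ *+ X](card_ord d) -sumr_const; apply: ler_sum => i _.
rewrite -lee_fin /Rintegral fineK; first exact: integral_kerd_sin2.
by apply: integrable_fin_num => //; exact: (ikh _ 1).
Qed.

End fejerd.

(** * The periodized box and its Fourier coefficients *)

Section lattice.
Context (R : realType).
Local Notation lam := (@lebesgue_measure R).
Local Notation leb n := (@lebesgue_mx R n 1).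
Local Notation cube d := (@unit_cube R d).

Lemma mem_irange N (j : int) : (j \in irange N) = (- N%:Z <= j) && (j < N%:Z).
Proof.
apply/mapP/andP => [[i]|[h1 h2]].
  by rewrite mem_iota => /andP[_ h] ->; split; lia.
exists (absz (j + N%:Z)); last by lia.
by rewrite mem_iota; lia.
Qed.

Lemma irange_uniq N : uniq (irange N).
Proof. by rewrite map_inj_uniq ?iota_uniq// => i j; lia. Qed.

Lemma mem_Zbox d N (k : d.-tuple int) :
  reflect (forall i, tnth k i \in irange N) (k \in Zbox d N).
Proof.
elim: d k => [|d IH] k.
  have -> : k \in Zbox 0 N by rewrite inE; apply/eqP; rewrite (tuple0 k); exact: val_inj.
  by constructor => -[].
rewrite ZboxS; apply: (iffP allpairsPdep) => [[j [k' [hj hk ->]]] i|h].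
  case: (unliftP ord0 i) => [i' ->|->]; last by rewrite tnth0.
  by rewrite tnthS; move/IH: hk.
exists (thead k), (behead_tuple k); split; first exact: h.
  apply/IH => i; have := h (lift ord0 i).
  by rewrite [in X in X -> _](tuple_eta k) tnthS.
by rewrite {1}(tuple_eta k).
Qed.

Lemma Zbox_uniq d N : uniq (Zbox d N).
Proof.
elim: d => [//|d IH]; rewrite ZboxS; apply: allpairs_uniq => //.
  exact: irange_uniq.
by move=> [a b] [a' b'] _ _ /= [-> /val_inj ->].
Qed.

Lemma size_Zbox d N : size (Zbox d N) = ((N + N) ^ d)%N.
Proof.
elim: d => [//|d IH].
by rewrite ZboxS size_allpairs IH size_map size_iota expnS.
Qed.

Lemma big_Zbox_prod d N (phi : 'I_d -> int -> R) :
  \sum_(k <- Zbox d N) \prod_i phi i (tnth k i) =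
  \prod_i \sum_(j <- irange N) phi i j.
Proof.
elim: d phi => [|d IH] phi; first by rewrite big_seq1 !big_ord0.
rewrite ZboxS big_allpairs_dep big_ord_recl mulr_suml; apply: eq_bigr => j _.
rewrite -(IH (fun i => phi (lift ord0 i))) mulr_sumr; apply: eq_bigr => k _.
rewrite big_ord_recl tnth0; congr (_ * _); apply: eq_bigr => i _.
by rewrite tnthS.
Qed.

Definition zvec d (k : d.-tuple int) : 'cV[R]_d := \col_i (tnth k i)%:~R.

Lemma sum_indic_irange (s : R) : -2 <= s < 2 ->
  \sum_(j <- irange 2) \1_(`[0, 1[%classic) (s - j%:~R) = 1 :> R.
Proof.
move=> /andP[s1 s2].
have -> : irange 2 = [:: -2; -1; 0; 1] by [].
rewrite !big_cons big_nil !indicE !mem_setE !in_itv /=.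
have [h1|h1] := ltP s (-1); have [h2|h2] := ltP s 0; have [h3|h3] := ltP s 1;
repeat match goal with |- context [?a <= ?b] => 
  first [have -> : (a <= b) = true by apply/idP; lra | have -> : (a <= b) = false by apply/negbTE; rewrite -ltNge; lra] end;
repeat match goal with |- context [?a < ?b] => 
  first [have -> : (a < b) = true by apply/idP; lra | have -> : (a < b) = false by apply/negbTE; rewrite -leNgt; lra] end;
rewrite /= ?addr0 ?add0r//; lra.
Qed.

Lemma integral_shift n (b : 'cV[R]_n) (f : 'cV[R]_n -> \bar R) :
  (leb n).-integrable setT f ->
  (\int[leb n]_y f y = \int[leb n]_z f (z + b)%R)%E.
Proof.
move=> intf.
have [|c /andP[c0 _] cE] := @ge0_integral_affine R n 1%:M.
  move=> i j; rewrite mxE subrr normr0 divr_ge0// exprn_ge0// invr_ge0//.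
have c1 : c = 1.
  have := cE 0 (fun y => (\1_(cube n) y)%:E).
  rewrite (_ : (\int[leb n]_z (\1_(cube n) (1%:M *m z + 0)%R)%:E) =
     (\int[leb n]_z (\1_(cube n) z)%:E))%E; last first.
    by apply: eq_integral => z _; rewrite mul1mx addr0.
  rewrite integral_indic//; last exact: measurable_cube.
  rewrite setIT /= lebesgue_cube mule1 => h; apply/esym/EFin_inj/h.
    by apply/measurable_EFinP; apply: measurable_indic; exact: measurable_cube.
  by move=> y; rewrite lee_fin.
rewrite (integral_affine (b := b) c0 (cE b) intf) c1 mul1e.
by apply: eq_integral => z _; rewrite mul1mx.
Qed.

Lemma measurable_shift n (b : 'cV[R]_n) : measurable_fun setT (fun z : 'cV[R]_n => z + b).
Proof. exact: measurable_addmx. Qed.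

(** A function supported in [-2, 2)^d is integrated over the torus by summing
    its integer translates. *)
Lemma integral_tiling d (G : 'cV[R]_d -> R) (M : R) :
  measurable_fun setT G -> (forall y, `|G y| <= M) ->
  (leb d).-integrable setT (EFin \o G) ->
  (forall y, G y != 0 -> forall i, -2 <= y i 0 < 2) ->
  \int[leb d]_y G y = \int[leb d]_(z in cube d) \sum_(m <- Zbox d 2) G (z + zvec m).
Proof.
move=> mG GM intG suppG.
have mC := @measurable_cube R d.
have intGm m : (leb d).-integrable (cube d) (EFin \o (fun z => G (z + zvec m))).
  apply: (cube_integrable (M := M)) => //.
  exact: (measurableT_comp mG (measurable_shift _)).
rewrite Rintegral_sum_seq//.
pose H (m : d.-tuple int) y := \1_(cube d) (y - zvec m) * G y.
have mH m : measurable_fun setT (H m).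
  apply: measurable_funM => //.
  have m1 : measurable_fun setT (\1_(cube d) : 'cV[R]_d -> R) by exact: measurable_indic.
  exact: (measurableT_comp m1 (measurable_shift (- zvec m))).
have intH m : (leb d).-integrable setT (EFin \o H m).
  apply: le_integrable intG => //; first exact/measurable_EFinP.
  move=> y _ /=; rewrite lee_fin normrM ler_piMl// indicE; by case: (_ \in _); rewrite ?normr1 ?normr0.
transitivity (\sum_(m <- Zbox d 2) \int[leb d]_y H m y).
  rewrite -Rintegral_sum_seq//; apply: eq_Rintegral => y _.
  have [Gy0|Gy0] := eqVneq (G y) 0.
    by rewrite Gy0 big1// => m _; rewrite /H Gy0 mulr0.
  rewrite /H -mulr_suml.
  rewrite (eq_bigr (fun m : d.-tuple int => \prod_i \1_(`[0, 1[%classic) (y i 0 - (tnth m i)%:~R))).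
    rewrite (big_Zbox_prod 2 (fun i j => \1_(`[0, 1[%classic) (y i 0 - j%:~R))).
    by rewrite big1 ?mul1r// => i _; rewrite sum_indic_irange//; exact: suppG.
  by move=> m _; rewrite indic_cube; apply: eq_bigr => i _; rewrite !mxE.
apply: eq_bigr => m _; rewrite /Rintegral; congr fine.
rewrite (@integral_shift d (zvec m) (EFin \o H m))// [RHS]integral_mkcond.
apply: eq_integral => z _; rewrite patchE /H /= addrK indicE.
by case: ifP => _; rewrite ?mul1r ?mul0r.
Qed.

End lattice.

Section tbox.
Context (R : realType) (d : nat).
Local Notation lam := (@lebesgue_measure R).
Local Notation leb n := (@lebesgue_mx R n 1).
Local Notation cube d := (@unit_cube R d).
Variable u : 'I_d -> R.

(** The periodization of U(box), written with the adjugate, which is the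
    inverse when det U = 1: its entries are polynomials in U, so the set is
    jointly measurable in (U, z). *)
Definition tbox (U : 'M[R]_d) : set 'cV[R]_d :=
  [set z | exists m : d.-tuple int, box u (\adj U *m (z + zvec R m))].

Lemma mx_boxE (U : 'M[R]_d) y : \det U = 1 ->
  mx_box u U y <-> box u (\adj U *m y).
Proof.
move=> dU; split => [[w wu <-]|h].
  by rewrite mulmxA mul_adj_mx dU mul1mx.
by exists (\adj U *m y) => //; rewrite mulmxA mul_mx_adj dU mul1mx.
Qed.

Lemma tboxE (U : 'M[R]_d) : \det U = 1 -> torus_set (mx_box u U) = tbox U.
Proof.
move=> dU; apply/seteqP; split => z /=.
  move=> [k /(mx_boxE _ dU) h]; exists [tuple k i 0 | i < d].
  rewrite (_ : zvec R _ = map_mx intr k)//.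
  by apply/colP => i; rewrite !mxE tnth_mktuple.
move=> [m h]; exists (\col_i tnth m i); apply/(mx_boxE _ dU).
rewrite (_ : map_mx intr _ = zvec R m)//.
by apply/colP => i; rewrite !mxE.
Qed.

Lemma zdotD (k : d.-tuple int) (y z : 'cV[R]_d) : zdot k (y + z) = zdot k y + zdot k z.
Proof.
by rewrite /zdot -big_split; apply: eq_bigr => i _; rewrite mxE mulrDr.
Qed.

Lemma zdotZ (k : d.-tuple int) c (z : 'cV[R]_d) : zdot k (c *: z) = c * zdot k z.
Proof.
by rewrite /zdot mulr_sumr; apply: eq_bigr => i _; rewrite mxE mulrCA.
Qed.

Lemma zdot_zvec (k m : d.-tuple int) :
  zdot k (zvec R m) = (\sum_i tnth k i * tnth m i)%:~R.
Proof.
by rewrite /zdot (rmorph_sum intr); apply: eq_bigr => i _ /=; rewrite mxE intrM.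
Qed.

Lemma cos_zdot_period (k m : d.-tuple int) th (z : 'cV[R]_d) :
  cos (th + 2 * pi * zdot k (z + zvec R m)) = cos (th + 2 * pi * zdot k z).
Proof. by rewrite zdotD zdot_zvec mulrDr addrA cos2pi_int. Qed.

(** The j-th coordinate of U^T k. *)
Definition zrow (k : d.-tuple int) (U : 'M[R]_d) (j : 'I_d) : R :=
  \sum_i (tnth k i)%:~R * U i j.

Lemma zdot_mulmx k U (z : 'cV[R]_d) : zdot k (U *m z) = \sum_j zrow k U j * z j 0.
Proof.
rewrite /zdot; under eq_bigr do rewrite mxE mulr_sumr.
rewrite exchange_big; apply: eq_bigr => j _; rewrite /zrow mulr_suml.
by apply: eq_bigr => i _; rewrite mulrA.
Qed.

Section near_identity.
Variables (U : 'M[R]_d) (e : R).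
Hypothesis u01 : forall j, 0 < u j < 1.
Hypothesis dU : \det U = 1.
Hypothesis nU : near1 U e.
Hypothesis e0 : 0 <= e.
Hypothesis e2 : e <= 2^-1 ^+ d / 2.
Hypothesis ue : forall j, u j + d%:R * e <= 1.

Lemma near1_dist (w : 'cV[R]_d) : (forall j, `|w j 0| <= 1) ->
  forall i, `|(U *m w) i 0 - w i 0| <= d%:R * e.
Proof.
move=> w1 i; rewrite mxE.
have -> : w i 0 = \sum_j (i == j)%:R * w j 0.
  by rewrite (bigD1 i)//= eqxx mul1r big1 ?addr0// => j ji; rewrite eq_sym (negbTE ji) mul0r.
rewrite -sumrB (le_trans (ler_norm_sum _ _ _))//.
rewrite mulr_natl -[X in _ *+ X](card_ord d) -sumr_const; apply: ler_sum => j _.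
by rewrite -mulrBl normrM -[leRHS]mulr1 ler_pM.
Qed.

Lemma mx_box_bound y : mx_box u U y -> forall i, -1 < y i 0 < 1.
Proof.
move=> [w wu <-] i.
have /(_ i) : forall j, `|w j 0| <= 1.
  move=> j; have /andP[a b] := wu j; have /andP[_ c] := u01 j.
  by rewrite ger0_norm; lra.
have := near1_dist (w := w).
have h : forall j, `|w j 0| <= 1.
  move=> j; have /andP[a b] := wu j; have /andP[_ c] := u01 j.
  by rewrite ger0_norm; lra.
move=> /(_ h i); rewrite ler_distl => /andP[h1 h2] _.
have /andP[a b] := wu i; have /andP[c c'] := u01 i; have := ue i.
by move: h1 h2; set de := d%:R * e => *; apply/andP; split; lra.
Qed.

(** The projection to the torus is injective on U(box): two points of the box
    differ by less than u_j in each coordinate, and U moves such a difference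
    by at most d e, so an integer difference has absolute value less than u_j
    + d e <= 1. *)
Lemma mx_box_inj z (m m' : d.-tuple int) :
  mx_box u U (z + zvec R m) -> mx_box u U (z + zvec R m') -> m = m'.
Proof.
move=> [w wu wE] [w' wu' wE'].
have h : forall j, `|(w - w') j 0| < u j.
  move=> j; rewrite !mxE.
  have /andP[a b] := wu j; have /andP[a' b'] := wu' j.
  by rewrite ltr_norml; apply/andP; split; lra.
have h1 j : `|(w - w') j 0| <= 1.
  by rewrite (le_trans (ltW (h j)))// ltW//; have /andP[] := u01 j.
apply: eq_from_tnth => i.
have := near1_dist h1 i; rewrite mulmxBr wE wE'.
have -> : (z + zvec R m - (z + zvec R m')) i 0 = (tnth m i - tnth m' i)%:~R.
  by rewrite !mxE intrB; ring.
move=> hd.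
have : `|(tnth m i - tnth m' i)%:~R : R| < 1.
  have -> : (tnth m i - tnth m' i)%:~R = ((tnth m i - tnth m' i)%:~R - (w - w') i 0) + (w - w') i 0 :> R by ring.
  rewrite (le_lt_trans (ler_normD _ _))//.
  have := h i; have := ue i; move: hd; set de := d%:R * e => *; lra.
rewrite -intr_norm -[1]/(1%:~R) ltr_int; lia.
Qed.

(** Since the translates of U(box) are disjoint, the indicator of the
    periodization is the sum of the indicators of the translates, and those
    meeting the unit cube come from finitely many translations. *)
Lemma tbox_sum z : cube d z ->
  \1_(tbox U) z = \sum_(m <- Zbox d 2) \1_(mx_box u U) (z + zvec R m) :> R.
Proof.
move=> z01; rewrite indicE; case: (boolP (z \in tbox U)) => [/set_mem[m zm]|zU].
  have zm' : mx_box u U (z + zvec R m) by apply/(mx_boxE _ dU).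
  have mZ : m \in Zbox d 2.
    apply/mem_Zbox => i; rewrite mem_irange.
    have := mx_box_bound zm' i; rewrite !mxE => /andP[a b]; have /andP[c c'] := z01 i.
    have hl : (-2 < (tnth m i)%:~R :> R) by lra.
    have hr : ((tnth m i)%:~R < 1 :> R) by lra.
    move: hl hr; rewrite -[1]/(1%:~R) ltr_int -[-2]/((-2)%:~R) ltr_int; lia.
  rewrite (bigD1_seq m)//=; last exact: Zbox_uniq.
  rewrite indicE mem_set// big1 ?addr0// => m' m'm; rewrite indicE memNset// => h.
  by move/eqP : m'm; apply; apply: mx_box_inj h zm'.
rewrite big1// => m _; rewrite indicE memNset// => /(mx_boxE _ dU) h.
by case/negP : zU; apply/mem_set; exists m.
Qed.

Lemma measurable_mx_box : measurable (mx_box u U).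
Proof.
rewrite (_ : mx_box u U = (fun y => \adj U *m y) @^-1` box u); last first.
  by apply/seteqP; split => y /= /(mx_boxE _ dU).
rewrite -[X in measurable X]setTI.
by apply: measurable_mulmx_col => //; exact: measurable_box.
Qed.

(** Unfold the sum over translates, then substitute y = U z: the character k
    becomes U^T k and the integral is the explicit one over a box. *)
Lemma fourier_tbox : exists2 c : R, 0 < c <= 2 ^+ d & forall (k : d.-tuple int) th,
  (forall j, zrow k U j != 0) ->
  \int[leb d]_(z in cube d) (cos (th + 2 * pi * zdot k z) * \1_(tbox U) z) =
  c * cos_box u (fun j => 2 * pi * zrow k U j) th.
Proof.
have [|c c02 cE] := @ge0_integral_affine R d U.
  by move=> i j; rewrite (le_trans (nU i j)).
exists c => // k th k0.
pose G y := cos (th + 2 * pi * zdot k y) * \1_(mx_box u U) y.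
have mcos : measurable_fun setT (fun y : 'cV[R]_d => cos (th + 2 * pi * zdot k y)).
  apply: (measurableT_comp (continuous_measurable_fun (@continuous_cos R))).
  apply: measurable_funD => //; apply: measurable_funM => //; exact: measurable_zdot.
have mG : measurable_fun setT G.
  apply: measurable_funM => //; apply: measurable_indic; exact: measurable_mx_box.
have G1 y : `|G y| <= 1.
  rewrite normrM indicE; case: (_ \in _); rewrite ?normr1 ?normr0 ?mulr1 ?mulr0//.
  exact: cos_max.
have suppG y : G y != 0 -> mx_box u U y.
  rewrite /G indicE; case: (boolP (y \in mx_box u U)) => [/set_mem//|_].
  by rewrite mulr0 eqxx.
pose J := @ibox R d 1.
have mJ : measurable J := @measurable_ibox R d 1.
have intG : (leb d).-integrable setT (EFin \o G).
  have := bounded_integrable mJ (lebesgue_ibox_lty d 1) mG G1.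
  move=> /(integrable_mkcond _ mJ).
  rewrite (_ : (EFin \o G) \_ _ = EFin \o G)//.
  apply/funext => y; rewrite patchE; case: (boolP (y \in _)) => // /negP yJ.
  have [Gy|/suppG Gy] := eqVneq (G y) 0; first by rewrite /= Gy.
  by case: yJ; apply/mem_set => i /=; rewrite in_itv /=; have /andP[/ltW-> /ltW->] := mx_box_bound Gy i.
transitivity (\int[leb d]_y G y).
  rewrite (integral_tiling mG G1 intG); last first.
    by move=> y /suppG Gy i; have := mx_box_bound Gy i => /andP[a b]; apply/andP; split; lra.
  apply: eq_Rintegral => z /set_mem z01; rewrite tbox_sum// mulr_sumr.
  by apply: eq_bigr => m _; rewrite /G cos_zdot_period.
have c0 : 0 < c by case/andP: c02.
have -> : \int[leb d]_y G y = fine (c%:E * \int[leb d]_z (G (U *m z + 0))%:E)%E.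
  rewrite /Rintegral; congr fine.
  exact: (integral_affine (f := EFin \o G) c0 (cE 0) intG).
rewrite (_ : \int[leb d]_z (G (U *m z + 0))%:E =
    (cos_box u (fun j => 2 * pi * zrow k U j) th)%:E)%E; first by rewrite -EFinM.
rewrite -integral_cos_box; last 2 first.
- by move=> i; have /andP[/ltW] := u01 i.
- by move=> i; rewrite !mulf_neq0// gt_eqF// pi_gt0.
rewrite [RHS]integral_mkcond; apply: eq_integral => z _; rewrite addr0 /G patchE indicE.
have -> : (U *m z \in mx_box u U) = (z \in box u).
  apply/idP/idP => /set_mem h; apply/mem_set; last by exists z.
  by move/(mx_boxE _ dU): h; rewrite mulmxA mul_adj_mx dU mul1mx.
case: ifP => _; rewrite ?mulr1 ?mulr0//; congr (EFin (cos (_ + _))).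
by rewrite zdot_mulmx mulr_sumr; apply: eq_bigr => j _; rewrite mulrA.
Qed.

Lemma fourier_tbox_le (k : d.-tuple int) : (forall j, zrow k U j != 0) ->
  `|fcos k \1_(tbox U)| <= 2 ^+ d * \prod_j `|zrow k U j|^-1 /\
  `|fsin k \1_(tbox U)| <= 2 ^+ d * \prod_j `|zrow k U j|^-1.
Proof.
move=> k0; have [c /andP[c0 c2] cE] := fourier_tbox.
have bnd th : `|c * cos_box u (fun j => 2 * pi * zrow k U j) th| <=
    2 ^+ d * \prod_j `|zrow k U j|^-1.
  rewrite normrM gtr0_norm// ler_pM ?(ltW c0)// (le_trans (cos_box_le _ _ _))//.
  apply: ler_prod => j _; rewrite divr_ge0//= normrM invfM mulrA.
  rewrite ler_piMl ?invr_ge0// gtr0_norm ?mulr_gt0 ?pi_gt0//.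
  by rewrite ler_pdivrMr ?mul1r ?mulr_gt0 ?pi_gt0// ler_peMr// (le_trans _ (pi_ge2 R))// ler1n.
split.
  rewrite /fcos (_ : Rintegral _ _ _ = \int[leb d]_(z in cube d) (cos (0 + 2 * pi * zdot k z) * \1_(tbox U) z)).
    by rewrite cE.
  by apply: eq_Rintegral => z _; rewrite add0r.
rewrite /fsin (_ : Rintegral _ _ _ = \int[leb d]_(z in cube d) (cos (- (pi / 2) + 2 * pi * zdot k z) * \1_(tbox U) z)).
  by rewrite cE.
apply: eq_Rintegral => z _; congr (_ * _).
by rewrite addrC cosB cos_pihalf sin_pihalf mulr0 add0r mulr1.
Qed.

End near_identity.

End tbox.

(** * Integrals of fractional powers of small denominators *)

Section singular.
Context (R : realType).
Local Notation lam := (@lebesgue_measure R).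
Local Notation leb n := (@lebesgue_mx R n 1).
Variable q : R.
Hypothesis q01 : 0 < q < 1.

Let q0 : 0 < q. Proof. by case/andP: q01. Qed.
Let q1 : q < 1. Proof. by case/andP: q01. Qed.

(** The value at 0 is +oo, not the default 0 of the power function: almost
    everywhere finiteness of sums of these terms then also shows that no
    denominator vanishes. *)
Definition sing (s : R) : \bar R := if s == 0 then +oo%E else (`|s| `^ (- q))%:E.

Lemma sing_gt0 s : (0 < sing s)%E.
Proof.
rewrite /sing; case: eqP => [_|/eqP s0]; first exact: ltry.
by rewrite lte_fin powR_gt0// normr_gt0.
Qed.

Lemma sing_ge0 s : (0 <= sing s)%E. Proof. exact/ltW/sing_gt0. Qed.

Lemma measurable_sing : measurable_fun setT sing.
Proof.
apply: measurable_fun_ifT => //; first exact: measurable_fun_eqr.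
apply/measurable_EFinP; exact: (measurableT_comp (measurable_powR (- q)) (@normr_measurable R setT)).
Qed.

Lemma le_sing s t : `|s| <= `|t| -> (sing t <= sing s)%E.
Proof.
move=> st; rewrite /sing; have [_|s0] := eqVneq s 0; first exact: leey.
have s0' : 0 < `|s| by rewrite normr_gt0.
have t0' : 0 < `|t| by apply: lt_le_trans st.
have -> : (t == 0) = false by apply/negbTE; rewrite -normr_gt0.
rewrite lee_fin !powRN lef_pV2 ?posrE ?powR_gt0//.
by apply: ge0_ler_powR; rewrite ?nnegrE// ltW.
Qed.

Lemma singN s : sing (- s) = sing s.
Proof. by rewrite /sing oppr_eq0 normrN. Qed.

Lemma singM k x : k != 0 -> sing (k * x) = ((`|k| `^ (- q))%:E * sing x)%E.
Proof.
move=> k0; rewrite /sing mulf_eq0 (negbTE k0) /=; case: ifP => x0.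
  by rewrite gt0_muley// lte_fin powR_gt0// normr_gt0.
by rewrite normrM powRM// -EFinM.
Qed.

Lemma ge0_integralN (f : R -> \bar R) : measurable_fun setT f ->
  (forall s, 0 <= f s)%E -> (\int[lam]_s f s = \int[lam]_s f (- s)%R)%E.
Proof.
move=> mf f0.
have mN : measurable_fun setT (-%R : R -> measurableTypeR R) by exact: oppr_measurable.
rewrite (eq_measure_integral (pushforward lam (-%R : R -> measurableTypeR R))).
  by rewrite ge0_integral_pushforward.
by move=> A mA _; exact: (esym (lebesgue_measureN mA)).
Qed.

Lemma integral_sing01 : (\int[lam]_(s in `[0%R, 1%R]) sing s <= ((1 - q)^-1)%:E)%E.
Proof.
have ms A : measurable_fun A sing by apply: measurable_funTS; exact: measurable_sing.
rewrite -integral_itv_obnd_cbnd//.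
pose F (n : nat) : set R := `[n.+1%:R^-1, 1]%classic.
have -> : `]0, 1]%classic = \bigcup_n F n.
  apply/seteqP; split => s /=.
    rewrite in_itv /= => /andP[s0 s1].
    exists (Num.truncn s^-1) => //; rewrite /F /= in_itv /= s1 andbT.
    rewrite -[leRHS]invrK lef_pV2 ?posrE ?invr_gt0//.
    by apply: ltW; exact: truncnS_gt.
  move=> [n _]; rewrite /F /= !in_itv /= => /andP[a ->]; rewrite andbT.
  by apply: lt_le_trans a; rewrite invr_gt0.
have cv : (\int[lam]_(x in F i) sing x)%E @[i --> \oo] --> (\int[lam]_(x in \bigcup_i F i) sing x)%E.
  apply: ge0_nondecreasing_set_cvg_integral.
  - move=> m n mn; rewrite subsetEset => s; rewrite /F /= !in_itv /= => /andP[a ->].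
    by rewrite andbT (le_trans _ a)// lef_pV2 ?posrE// ler_nat.
  - by move=> i; exact: measurable_itv.
  - by move=> i; exact: ms.
  - by move=> i x _; exact: sing_ge0.
rewrite -(cvg_lim _ cv)//; apply: lime_le; first by apply/cvg_ex; eexists; exact: cv.
near=> n.
have n0 : (0 < n)%N by near: n; exact: nbhs_infty_gt.
have a0 : 0 < n.+1%:R^-1 :> R by rewrite invr_gt0.
have a1 : n.+1%:R^-1 < 1 :> R by rewrite invf_lt1// ltr1n.
have -> : (\int[lam]_(x in F n) sing x = \int[lam]_(x in F n) (x `^ (- q))%:E)%E.
  apply: eq_integral => s /set_mem; rewrite /F /= in_itv /= => /andP[sa _].
  have s0 := lt_le_trans a0 sa.
  by rewrite /sing gt_eqF// gtr0_norm.
pose G (s : R) := s `^ (1 - q) / (1 - q).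
have dG (s : R) : 0 < s -> is_derive s (1 : R) G (s `^ (- q)).
  move=> s0; have := is_derive1_powR (1 - q) s0 => d.
  have -> : s `^ (- q) = (1 - q)^-1 *: ((1 - q) * s `^ ((1 - q) - 1)).
    rewrite -[RHS]/((1 - q)^-1 * ((1 - q) * s `^ ((1 - q) - 1))) mulKf ?gt_eqF ?subr_gt0//.
    by congr (_ `^ _); ring.
  have -> : G = (1 - q)^-1 *: (fun x : R => x `^ (1 - q)).
    by apply/funext => t; rewrite /G mulrC.
  exact: is_deriveZ.
have cG (s : R) : 0 < s -> {for s, continuous G}.
  move=> s0; apply: differentiable_continuous; apply/derivable1_diffP.
  by have := dG _ s0 => -[].
rewrite (@continuous_FTC2 _ _ G)//.
- rewrite -EFinB lee_fin /G powR1 -mulrBl -[leRHS]mul1r ler_wpM2r ?invr_ge0 ?subr_ge0 ?ltW//.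
- apply: continuous_in_subspaceT => s /set_mem /=; rewrite in_itv /= => /andP[sa _].
  apply: differentiable_continuous; apply/derivable1_diffP.
  by apply: derivable_powR; rewrite in_itv /= (lt_le_trans a0 sa).
- split => [s||].
  + by rewrite in_itv /= => /andP[sa _]; have [] := dG _ (lt_trans a0 sa).
  + by apply: cvg_at_right_filter; exact: cG.
  + by apply: cvg_at_left_filter; exact: cG.
- move=> s; rewrite in_itv /= => /andP[sa _]; rewrite derive1E.
  by have [_ ->] := dG _ (lt_trans a0 sa).
Unshelve. all: by end_near. Qed.

Definition Csing (M : R) : R := 2 * M + 2 / (1 - q).

Lemma Csing_ge0 (M : R) : 0 <= M -> 0 <= Csing M.
Proof.
move=> M0; have h : 0 <= (1 - q)^-1 by rewrite invr_ge0 subr_ge0 ltW.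
by rewrite addr_ge0// mulr_ge0.
Qed.

(** The slope comes out by homogeneity. Within distance 1 of the singularity
    the integral is at most 2 / (1 - q), and at larger distance the integrand
    is at most 1: this is independent of the position of the singularity,
    hence of s. *)
Lemma integral_sing_affine (M K k s : R) : 0 <= M -> 0 < K -> K <= `|k| ->
  (\int[lam]_(t in `[(- M)%R, M]) sing (s + k * t)%R <= (K `^ (- q) * Csing M)%:E)%E.
Proof.
move=> M0 K0 Kk.
have k0' : 0 < `|k| by apply: lt_le_trans Kk.
have k0 : k != 0 by rewrite -normr_gt0.
pose psi s := (sing s * (\1_(`[(-1), 1]%classic) s)%:E)%E.
have mpsi : measurable_fun setT psi.
  apply: emeasurable_funM; first exact: measurable_sing.
  by apply/measurable_EFinP; exact: measurable_indic.
have psi0 t : (0 <= psi t)%E by rewrite mule_ge0// ?sing_ge0// lee_fin.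
have ipsi : (\int[lam]_t psi t <= (2 / (1 - q))%:E)%E.
  pose h t := (sing t * (\1_(`[0%R, 1]%classic) t)%:E)%E.
  have mh : measurable_fun setT h.
    apply: emeasurable_funM; first exact: measurable_sing.
    by apply/measurable_EFinP; exact: measurable_indic.
  have h0 t : (0 <= h t)%E by rewrite mule_ge0// ?sing_ge0// lee_fin.
  have ih : (\int[lam]_t h t <= ((1 - q)^-1)%:E)%E.
    rewrite (_ : \int[lam]_t h t = \int[lam]_(s in `[0%R, 1%R]) sing s)%E; first exact: integral_sing01.
    rewrite [RHS]integral_mkcond; apply: eq_integral => t _.
    by rewrite /h patchE indicE; case: ifP => _; rewrite ?mule1 ?mule0.
  apply: (@le_trans _ _ (\int[lam]_t (h t + h (- t)%R))%E).
    apply: ge0_le_integral => //.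
    - by apply: emeasurable_funD => //; apply: (measurableT_comp mh); exact: oppr_measurable.
    - move=> t _; rewrite /psi /h singN !indicE.
      case: (boolP (t \in _)) => [/set_mem|_]; last first.
        by rewrite mule0 adde_ge0 ?mule_ge0 ?sing_ge0// lee_fin.
      rewrite /= in_itv /= => /andP[t1 t2]; rewrite mule1.
      have [t0|t0] := leP 0 t.
        rewrite (mem_set (_ : `[0, 1]%classic t)); last by rewrite /= in_itv /= t0.
        by rewrite mule1 leeDl// mule_ge0 ?sing_ge0// lee_fin.
      rewrite (mem_set (_ : `[0, 1]%classic (- t))); last by rewrite /= in_itv /=; apply/andP; split; lra.
      by rewrite mule1 leeDr// mule_ge0 ?sing_ge0// lee_fin.
  rewrite ge0_integralD//; last by apply: (measurableT_comp mh); exact: oppr_measurable.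
  rewrite -(ge0_integralN mh h0) (_ : 2 / (1 - q) = (1 - q)^-1 + (1 - q)^-1); last by rewrite mulr_natl mulr2n.
  by rewrite EFinD leeD.
have maff (a b : R) : measurable_fun setT (fun t : R => a + b * t).
  by apply: measurable_funD => //; exact: measurable_funM.
have -> : (\int[lam]_(t in `[(- M)%R, M]) sing (s + k * t)%R =
    \int[lam]_(t in `[(- M)%R, M]) ((`|k| `^ (- q))%:E * sing (s / k + t)%R))%E.
  by apply: eq_integral => t _; rewrite -singM//; congr sing; field.
have msa : measurable_fun setT (fun t => sing (s / k + t)).
  by apply: (measurableT_comp measurable_sing); exact: measurable_funD.
rewrite ge0_integralZl_EFin//; last 2 first.
- by move=> t _; exact: sing_ge0.
- exact: measurable_funTS.
rewrite EFinM; apply: lee_pmul => //.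
- by apply: integral_ge0 => t _; exact: sing_ge0.
- rewrite lee_fin !powRN lef_pV2 ?posrE ?powR_gt0//.
  by apply: ge0_ler_powR; rewrite ?nnegrE// ltW.
have mpa : measurable_fun setT (fun t : R => psi (1 * t + s / k)).
  by apply: (measurableT_comp mpsi); apply: measurable_funD => //; exact: measurable_funM.
apply: (@le_trans _ _ (\int[lam]_(t in `[(- M)%R, M]) (1 + psi (1 * t + s / k)%R))%E).
  apply: ge0_le_integral => //.
  - by move=> t _; exact: sing_ge0.
  - exact: measurable_funTS.
  - by apply: emeasurable_funD => //; exact: measurable_funTS.
  - move=> t _; rewrite mul1r [t + _]addrC; move: (s / k + t) => x.
    have [x1|x1] := leP `|x| 1.
      rewrite /psi indicE mem_set /=; last by rewrite in_itv /= -ler_norml.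
      by rewrite mule1 leeDr.
    rewrite (le_trans (@le_sing 1 x _))//; first by rewrite normr1 ltW.
    by rewrite /sing oner_eq0 normr1 powR1 leeDl.
rewrite ge0_integralD//; last exact: measurable_funTS.
rewrite EFinD; apply: leeD.
  rewrite integral_cst// mul1e /= lebesgue_measure_itv /=; case: ifP => _.
    by rewrite -EFinB lee_fin; lra.
  by rewrite lee_fin; lra.
apply: le_trans ipsi; rewrite (ge0_integral_affine1 (f := psi) (s / k) ltr01)// mul1e.
exact: ge0_subset_integral.
Qed.

End singular.

Section singular_products.
Context (R : realType).
Local Notation lam := (@lebesgue_measure R).
Local Notation leb n := (@lebesgue_mx R n 1).
Variable q : R.
Hypothesis q01 : 0 < q < 1.
Local Notation sing := (sing q).
Local Notation Csing := (Csing q).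

Lemma emeasurable_prod d (T : measurableType d) (I : finType) (J : {set I})
    (f : I -> T -> \bar R) : (forall i, measurable_fun setT (f i)) ->
  measurable_fun setT (fun t => \prod_(i in J) f i t)%E.
Proof.
move=> mf.
have h (s : seq I) : measurable_fun setT (fun t => \prod_(i <- s) f i t)%E.
  elim: s => [|i s IH].
    rewrite (_ : (fun _ => _) = cst 1%E); first exact: measurable_cst.
    by apply/funext => t; rewrite big_nil.
  rewrite (_ : (fun _ => _) = (fun t => f i t * \prod_(i <- s) f i t)%E).
    exact: emeasurable_funM.
  by apply/funext => t; rewrite big_cons.
rewrite (_ : (fun _ => _) = (fun t => \prod_(i <- enum J) f i t)%E) //.
by apply/funext => t; rewrite big_enum.
Qed.

Lemma indic_ibox_ccons n M s (z : 'cV[R]_n) :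
  \1_(ibox M) (ccons s z) = \1_(`[(- M)%R, M]%classic) s * \1_(ibox M) z :> R.
Proof.
rewrite !indicE.
have -> : (ccons s z \in ibox M) = (s \in `[- M, M]%classic) && (z \in ibox M).
  apply/idP/andP => [/set_mem h|[/set_mem hs /set_mem hz]].
    split; apply/mem_set; first by have := h ord0; rewrite ccons0.
    by move=> i; have := h (lift ord0 i); rewrite cconsS.
  apply/mem_set => i; case: (unliftP ord0 i) => [j ->|->]; first by rewrite cconsS.
  by rewrite ccons0.
by case: (s \in _); rewrite ?mul1r ?mul0r.
Qed.

Definition lform n m (a : 'I_m -> 'I_n -> R) (s : 'I_m -> R) (t : 'cV[R]_n) (j : 'I_m) : R :=
  s j + \sum_p a j p * t p 0.

Lemma measurable_lform n m (a : 'I_m -> 'I_n -> R) (s : 'I_m -> R) j :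
  measurable_fun setT (fun t => lform a s t j).
Proof.
apply: measurable_funD => //; apply: measurable_sum => p.
by apply: measurable_funM => //; exact: measurable_mx_entry.
Qed.

Lemma measurable_sing_lform n m (a : 'I_m -> 'I_n -> R) (s : 'I_m -> R) j :
  measurable_fun setT (fun t => sing (lform a s t j)).
Proof.
exact: (measurableT_comp (measurable_sing q) (measurable_lform a s j)).
Qed.

Lemma lform_ccons n m (a : 'I_m -> 'I_n.+1 -> R) (s : 'I_m -> R) r (z : 'cV[R]_n) j :
  lform a s (ccons r z) j =
  lform (fun j p => a j (lift ord0 p)) (fun j => s j + a j ord0 * r) z j.
Proof.
rewrite /lform big_ord_recl ccons0 addrA; congr (_ + _).
by apply: eq_bigr => p _; rewrite cconsS.
Qed.

Lemma prod_sing_ge0 n m (J : {set 'I_m}) (a : 'I_m -> 'I_n -> R) (s : 'I_m -> R) t :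
  (0 <= \prod_(j in J) sing (lform a s t j))%E.
Proof. by apply: prode_ge0 => j _; exact: sing_ge0. Qed.

(** Each form j in J has a pivot variable with coefficient at least K that
    occurs in no other form of J. The variables are integrated one at a time:
    a pivot variable costs the factor K^-q * Csing M of its form, any other
    variable at most 2 M + 1, whatever the values of the remaining variables. *)
Lemma integral_sing_prod n m (J : {set 'I_m}) (a : 'I_m -> 'I_n -> R) (s : 'I_m -> R) (M K : R) :
  0 <= M -> 0 < K ->
  (forall j, j \in J -> exists2 p, K <= `|a j p| &
     forall j', j' \in J -> j' != j -> a j' p = 0) ->
  (\int[leb n]_t (\prod_(j in J) sing (lform a s t j) * (\1_(ibox M) t)%:E) <=
   ((K `^ (- q) * Csing M) ^+ #|J| * (2 * M + 1) ^+ n)%:E)%E.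
Proof.
move=> M0 K0.
set c := K `^ (- q) * Csing M.
have c0 : 0 <= c by rewrite mulr_ge0 ?powR_ge0// Csing_ge0.
have M1 : 0 <= 2 * M + 1 by lra.
have mF N m' (J' : {set 'I_m'}) (a' : 'I_m' -> 'I_N -> R) s' :
    measurable_fun setT (fun t => \prod_(j in J') sing (lform a' s' t j) * (\1_(ibox M) t)%:E)%E.
  apply: emeasurable_funM.
    by apply: emeasurable_prod => j; exact: measurable_sing_lform.
  by apply/measurable_EFinP; apply: measurable_indic; exact: measurable_ibox.
have F0 N m' (J' : {set 'I_m'}) (a' : 'I_m' -> 'I_N -> R) s' t :
    (0 <= \prod_(j in J') sing (lform a' s' t j) * (\1_(ibox M) t)%:E)%E.
  by rewrite mule_ge0 ?prod_sing_ge0// lee_fin.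
elim: n J a s => [|n IH] J a s piv.
  have -> : J = finset.set0.
    by apply/setP => j; rewrite inE; apply/negP => /piv[[]].
  rewrite ge0_integral_col0// big_set0 mul1e cards0 !expr0 mulr1 indicE lee_fin.
  by case: (_ \in _).
pose a' j p := a j (lift ord0 p).
have [/existsP[j0 /and3P[j0J Kj0 /forallP hj0]]|] := boolP [exists j0, [&& j0 \in J, K <= `|a j0 ord0| &
    [forall j, (j \in J) && (j != j0) ==> (a j ord0 == 0)]]].
  have aj j : j \in J -> j != j0 -> a j ord0 = 0.
    by move=> jJ jj0; have := hj0 j; rewrite jJ jj0 => /eqP.
  rewrite ge0_integral_colS2//.
  apply: (@le_trans _ _ (\int[leb n]_z (c%:E *
     (\prod_(j in J :\ j0) sing (lform a' s z j) * (\1_(ibox M) z)%:E)))%E).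
    apply: ge0_le_integral => //.
    - by move=> z _; apply: integral_ge0 => r _; exact: F0.
    - apply: (measurable_fun_fubini_tonelli_G (fun p : measurableTypeR R * 'cV[R]_n =>
        (\prod_(j in J) sing (lform a s (ccons p.1 p.2) j) * (\1_(ibox M) (ccons p.1 p.2))%:E)%E)).
        exact: (measurableT_comp (mF _ _ J a s) (@measurable_ccons R n)).
      by move=> p; exact: F0.
    - by apply: emeasurable_funM; [|exact: mF].
    - move=> z _.
      have z0 : (0 <= \prod_(j in J :\ j0) sing (lform a' s z j) * (\1_(ibox M) z)%:E)%E by exact: F0.
      have -> : (\int[lam]_r (\prod_(j in J) sing (lform a s (ccons r z) j) * (\1_(ibox M) (ccons r z))%:E) =
        \int[lam]_r ((\prod_(j in J :\ j0) sing (lform a' s z j) * (\1_(ibox M) z)%:E) *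
           (sing ((s j0 + \sum_p a' j0 p * z p 0) + a j0 ord0 * r)%R * (\1_(`[(- M)%R, M]%classic) r)%:E)))%E.
        apply: eq_integral => r _; rewrite (big_setD1 j0)//= indic_ibox_ccons EFinM.
        have -> : (\prod_(j in J :\ j0) sing (lform a s (ccons r z) j) =
            \prod_(j in J :\ j0) sing (lform a' s z j))%E.
          apply: eq_bigr => j; rewrite in_setD1 => /andP[jj0 jJ].
          by rewrite lform_ccons /lform aj// mul0r addr0.
        have -> : lform a s (ccons r z) j0 = (s j0 + \sum_p a' j0 p * z p 0) + a j0 ord0 * r.
          by rewrite lform_ccons /lform addrAC.
        by rewrite muleACA muleC.
      rewrite ge0_integralZl//; last 2 first.
        apply: emeasurable_funM.
          apply: (measurableT_comp (measurable_sing q)).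
          by apply: measurable_funD => //; exact: measurable_funM.
        by apply/measurable_EFinP; exact: measurable_indic.
        by move=> r _; rewrite mule_ge0 ?sing_ge0// lee_fin.
      rewrite muleC; apply: lee_wpmul2r => //.
      rewrite (_ : integral _ _ _ = \int[lam]_(r in `[(- M)%R, M]) sing (s j0 + \sum_p a' j0 p * z p 0 + a j0 ord0 * r)%R)%E.
        exact: integral_sing_affine.
      rewrite [RHS]integral_mkcond; apply: eq_integral => r _; rewrite patchE indicE.
      by case: ifP => _; rewrite ?mule1 ?mule0.
  rewrite ge0_integralZl ?lee_fin//; last exact: mF.
  have -> : c ^+ #|J| * (2 * M + 1) ^+ n.+1 = c * (c ^+ #|J :\ j0| * (2 * M + 1) ^+ n.+1).
    by rewrite (cardsD1 j0) j0J add1n exprS mulrA.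
  rewrite [leRHS]EFinM; apply: lee_wpmul2l; first by rewrite lee_fin.
  apply: (le_trans (IH (J :\ j0) a' s _)).
    move=> j; rewrite in_setD1 => /andP[jj0 jJ]; have [p Kp hp] := piv _ jJ.
    case: (unliftP ord0 p) Kp hp => [p' ->|->] Kp hp.
      by exists p' => // j'; rewrite in_setD1 => /andP[_ j'J]; exact: hp.
    by move: Kp; rewrite aj// normr0 leNgt K0.
  rewrite lee_fin exprS; apply: ler_wpM2l; first exact: exprn_ge0.
  by rewrite ler_peMl ?exprn_ge0//; lra.
rewrite negb_exists => /forallP nopiv.
rewrite ge0_integral_colS1//.
apply: (@le_trans _ _ (\int[lam]_r ((c ^+ #|J| * (2 * M + 1) ^+ n)%:E * (\1_(`[(- M)%R, M]%classic) r)%:E))%E).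
  apply: ge0_le_integral => //.
  - by move=> r _; apply: integral_ge0 => z _; exact: F0.
  - apply: (measurable_fun_fubini_tonelli_F (fun p : measurableTypeR R * 'cV[R]_n =>
        (\prod_(j in J) sing (lform a s (ccons p.1 p.2) j) * (\1_(ibox M) (ccons p.1 p.2))%:E)%E)).
      exact: (measurableT_comp (mF _ _ J a s) (@measurable_ccons R n)).
    by move=> p; exact: F0.
  - by apply: emeasurable_funM => //; apply/measurable_EFinP; exact: measurable_indic.
  - move=> r _.
    have -> : (\int[leb n]_z (\prod_(j in J) sing (lform a s (ccons r z) j) * (\1_(ibox M) (ccons r z))%:E) =
      \int[leb n]_z ((\1_(`[(- M)%R, M]%classic) r)%:E *
        (\prod_(j in J) sing (lform a' (fun j => s j + a j ord0 * r)%R z j) * (\1_(ibox M) z)%:E)))%E.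
      apply: eq_integral => z _; rewrite indic_ibox_ccons EFinM muleCA; congr (_ * (_ * _))%E.
      by apply: eq_bigr => j _; rewrite lform_ccons.
    rewrite ge0_integralZl ?lee_fin//; last exact: mF.
    rewrite muleC; apply: lee_wpmul2r; first by rewrite lee_fin.
    apply: IH => j jJ; have [p Kp hp] := piv _ jJ.
    case: (unliftP ord0 p) Kp hp => [p' ->|->] Kp hp; first by exists p'.
    have := nopiv j; rewrite jJ Kp /= negb_forall => /existsP[j'].
    by rewrite negb_imply => /andP[/andP[j'J j'j]]; rewrite hp// eqxx.
rewrite ge0_integralZl ?lee_fin ?mulr_ge0 ?exprn_ge0//; last first.
  by apply/measurable_EFinP; exact: measurable_indic.
rewrite integral_indic// setIT.
have lM : (lam `[(- M)%R, M]%classic <= (2 * M + 1)%:E)%E.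
  rewrite lebesgue_measure_itv /=; case: ifP => _; last by rewrite lee_fin.
  by rewrite -EFinB lee_fin; lra.
apply: (le_trans (lee_wpmul2l _ lM)).
  by rewrite lee_fin mulr_ge0 ?exprn_ge0.
by rewrite -EFinM lee_fin exprSr mulrA.
Qed.


End singular_products.

(** * Haar measure on bounded sets of matrices *)

Section product_sigma_finite.
Context d1 d2 (T1 : measurableType d1) (T2 : measurableType d2) (R : realType).
Variables (mu : {sigma_finite_measure set T1 -> \bar R})
  (nu : {sigma_finite_measure set T2 -> \bar R}).

Let prod : {measure set (T1 * T2)%type -> \bar R} := (mu \x nu)%E.

(** A name for the product measure that carries a sigma-finite structure, so
    that products can be iterated. *)
Definition sfprod : set (T1 * T2)%type -> \bar R := (mu \x nu)%E.

HB.instance Definition _ := Measure.copy sfprod prod.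

HB.instance Definition _ := Measure_isSigmaFinite.Build _ _ _
  sfprod (sigma_finite_product_measure mu nu).

End product_sigma_finite.

Section integral_prod3.
Local Open Scope ereal_scope.
Context d1 d2 d3 (T1 : measurableType d1) (T2 : measurableType d2)
  (T3 : measurableType d3) (R : realType).
Variables (m1 : {sigma_finite_measure set T1 -> \bar R})
  (m2 : {sigma_finite_measure set T2 -> \bar R})
  (m3 : {sigma_finite_measure set T3 -> \bar R}).
Variables (A : T1 -> \bar R) (B : T2 -> \bar R) (C : T3 -> \bar R).
Hypotheses (mA : measurable_fun setT A) (mB : measurable_fun setT B)
  (mC : measurable_fun setT C).
Hypotheses (A0 : forall x, 0 <= A x) (B0 : forall x, 0 <= B x) (C0 : forall x, 0 <= C x).

Lemma ge0_integral_prod3 :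
  \int[sfprod m1 m2 \x m3]_w (A w.1.1 * B w.1.2 * C w.2) =
  \int[m1]_x A x * \int[m2]_y B y * \int[m3]_z C z.
Proof.
have mAB : measurable_fun setT (fun p : T1 * T2 => A p.1 * B p.2).
  apply: emeasurable_funM.
    exact: (measurableT_comp mA measurable_fst).
  exact: (measurableT_comp mB measurable_snd).
pose m12 : {sigma_finite_measure set (T1 * T2)%type -> \bar R} := sfprod m1 m2.
have step : \int[m12 \x m3]_w (A w.1.1 * B w.1.2 * C w.2) =
    \int[m12]_p ((A p.1 * B p.2) * \int[m3]_z C z).
  rewrite (fubini_tonelli1 (fun w : T1 * T2 * T3 => A w.1.1 * B w.1.2 * C w.2)).
  - apply: eq_integral => p _; rewrite /fubini_F /= ge0_integralZl//.
    by rewrite mule_ge0.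
  - apply: emeasurable_funM.
      exact: (measurableT_comp mAB measurable_fst).
    exact: (measurableT_comp mC measurable_snd).
  - by move=> w; rewrite !mule_ge0.
rewrite step ge0_integralZr//; last 2 first.
- by move=> p _; rewrite mule_ge0.
- exact: integral_ge0.
congr (_ * _); rewrite (fubini_tonelli1 (fun p : T1 * T2 => A p.1 * B p.2))//; last first.
  by move=> p; rewrite mule_ge0.
rewrite -ge0_integralZr//; last exact: integral_ge0.
by apply: eq_integral => x _; rewrite /fubini_F /= ge0_integralZl.
Qed.
End integral_prod3.

Section haar.
Context (R : realType).
Local Notation lam := (@lebesgue_measure R).
Local Notation leb n := (@lebesgue_mx R n 1).

Definition mx_of_col m n (c : 'cV[R]_(m * n)) : 'M[R]_(m, n) :=
  \matrix_(i, j) c (mxvec_index i j) 0.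

Lemma measurable_mx_of_col m n : measurable_fun setT (@mx_of_col m n).
Proof.
by apply: measurable_fun_mx => i j; under eq_fun do rewrite mxE; exact: measurable_mx_entry.
Qed.

Lemma lebesgue_mx_colE m n (A : set 'M[R]_(m, n)) :
  lebesgue_mx A = leb (m * n) (@mx_of_col m n @^-1` A).
Proof.
rewrite lebesgue_colE /lebesgue_mx /pushforward; congr (lebesgue_tuple R _ _).
by apply/funext => t /=; congr (A _); apply/matrixP => i j; rewrite !mxE.
Qed.

Lemma ge0_integral_mx_col m n (f : 'M[R]_(m, n) -> \bar R) :
  measurable_fun setT f -> (forall y, 0 <= f y)%E ->
  (\int[@lebesgue_mx R m n]_y f y = \int[leb (m * n)]_c f (mx_of_col c))%E.
Proof.
move=> mf f0.
rewrite (eq_measure_integral (pushforward (leb (m * n)) (@mx_of_col m n))).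
- exact: measurable_mx_of_col.
- by move=> mc; rewrite ge0_integral_pushforward.
- by move=> ? A mA _; exact: lebesgue_mx_colE.
Qed.

Definition mbox m n (M : R) : set 'M[R]_(m, n) :=
  [set N | forall i j, N i j \in `[- M, M]].

Lemma mboxE m n M : @mx_of_col m n @^-1` (@mbox m n M) = ibox M.
Proof.
apply/seteqP; split => c /= h.
  by move=> p; case/mxvec_indexP: p => i j; have := h i j; rewrite mxE.
by move=> i j; rewrite mxE; exact: h.
Qed.

Lemma measurable_mbox m n M : measurable (@mbox m n M).
Proof.
rewrite (_ : @mbox m n M = \bigcap_(i in [set: 'I_m]) \bigcap_(j in [set: 'I_n])
   ((fun N : 'M[R]_(m, n) => N i j) @^-1` [set` `[- M, M]])).
  apply: fin_bigcap_measurable => // i _; apply: fin_bigcap_measurable => // j _.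
  by rewrite -[X in measurable X]setTI; exact: measurable_mx_entry.
by apply/seteqP; split => y /= h i => [_ j _|j]; [exact: h|exact: (h i I j I)].
Qed.

Lemma lebesgue_mbox_lty m n M : (@lebesgue_mx R m n (@mbox m n M) < +oo)%E.
Proof. by rewrite lebesgue_mx_colE mboxE lebesgue_ibox_lty. Qed.

Variable d : nat.
Local Notation cone := [set M : 'M[R]_d | 0 < \det M <= 1].

Lemma SL_proj_scale (N : 'M[R]_d) : cone N ->
  exists2 c : R, 1 <= c & SL_proj N = c *: N.
Proof.
move=> /andP[d0 d1]; exists (\det N `^ (- d%:R^-1)) => //.
rewrite powRN -[leLHS]invr1 lef_pV2 ?posrE ?powR_gt0//.
rewrite -[leRHS](powRr0 (\det N)); apply: ger_powR; first by rewrite d0.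
by rewrite invr_ge0.
Qed.

Lemma mbox_SL_proj M (N : 'M[R]_d) : cone N -> mbox M (SL_proj N) -> mbox M N.
Proof.
move=> /SL_proj_scale[c c1 ->] h i j; have := h i j.
rewrite mxE !in_itv /= -!ler_norml normrM; apply: le_trans.
by rewrite ler_peMl// (le_trans c1)// ler_norm.
Qed.

(** Haar measure is Lebesgue measure on the cone pulled down by the radial
    projection, so a bound of f by g along the radial projection transfers
    integrals. It is used with f antitone in the size of U: the projection
    scales matrices up. *)
Lemma ge0_le_integral_haar (f g : 'M[R]_d -> \bar R) :
  measurable_fun setT f -> measurable_fun setT g ->
  (forall U, 0 <= f U)%E -> (forall U, 0 <= g U)%E ->
  (forall N, cone N -> f (SL_proj N) <= g N)%E ->
  (\int[@haar_SL R d]_U f U <= \int[@lebesgue_mx R d d]_N g N)%E.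
Proof.
move=> mf mg f0 g0 fg.
pose restr : {measure set 'M[R]_d -> \bar R} :=
  mrestr (@lebesgue_mx R d d) (@measurable_cone_det R d).
have mfp : measurable_fun setT (f \o @SL_proj R d).
  exact: (measurableT_comp mf (@measurable_SL_proj R d)).
have mc := @measurable_cone_det R d.
have -> : (\int[@haar_SL R d]_U f U = \int[restr]_N f (SL_proj N))%E.
  rewrite (eq_measure_integral (pushforward restr (@SL_proj R d))).
  - exact: measurable_SL_proj.
  - by move=> mp; rewrite ge0_integral_pushforward.
  - by [].
have r0 : restr (~` cone) = 0%E by rewrite /restr /= /mrestr setICl measure0.
rewrite (ge0_negligible_integral (measurableC mc) measurableT mfp)//; last by move=> N _; exact: f0.
rewrite setTD setCK.
apply: (@le_trans _ _ (\int[restr]_(N in cone) g N)%E).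
  apply: ge0_le_integral => //.
  - by move=> x _; exact: f0.
  - exact: measurable_funTS mfp.
  - exact: measurable_funTS.
apply: (@le_trans _ _ (\int[@lebesgue_mx R d d]_(N in cone) g N)%E).
  apply: ge0_le_measure_integral => //.
  - by move=> A mA; rewrite /restr /= /mrestr; apply: le_measure; rewrite ?inE//; exact: measurableI.
exact: ge0_subset_integral.
Qed.

(** Scaling a matrix of the cone up to determinant 1 increases its entries,
    so the part of the cone above a bounded set is bounded. *)
Lemma haar_mbox_lty M : (@haar_SL R d (mbox M) < +oo)%E.
Proof.
have mM := @measurable_mbox d d M.
have hE (mu : {measure set 'M[R]_d -> \bar R}) :
    (mu (mbox M) = \int[mu]_U (\1_(mbox M) U)%:E)%E.
  by rewrite integral_indic// setIT.
rewrite hE; apply: le_lt_trans (lebesgue_mbox_lty d d M); rewrite [leRHS]hE.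
have m1 : measurable_fun setT (fun U : 'M[R]_d => (\1_(mbox M) U : R)%:E).
  by apply/measurable_EFinP; exact: measurable_indic.
apply: ge0_le_integral_haar => //.
move=> N cN; rewrite lee_fin !indicE; case: (boolP (_ \in _)) => [/set_mem h|//].
by rewrite mem_set//; exact: mbox_SL_proj.
Qed.

Lemma sigma_finite_haar : sigma_finite setT (@haar_SL R d).
Proof.
exists (fun n => mbox n%:R); last by move=> n; split; [exact: measurable_mbox|exact: haar_mbox_lty].
apply/seteqP; split => // U _.
pose M := \sum_i \sum_j `|U i j|.
exists (Num.truncn M).+1 => // i j; rewrite in_itv /= -ler_norml.
have : `|U i j| <= M.
  rewrite /M (bigD1 i)//= (bigD1 j)//= -addrA lerDl addr_ge0 ?sumr_ge0// => k _.
  by rewrite sumr_ge0.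
by move=> h; apply: le_trans h (ltW (truncnS_gt M)).
Qed.

HB.instance Definition _ := Measure_isSigmaFinite.Build _ _ _
  (@haar_SL R d) sigma_finite_haar.

End haar.

(** * Almost everywhere bounded sums of powers of small denominators *)

Lemma le_prode (R : realType) (I : finType) (f g : I -> \bar R) :
  (forall i, 0 <= f i)%E -> (forall i, f i <= g i)%E ->
  (\prod_i f i <= \prod_i g i)%E.
Proof.
move=> f0 fg.
have : (0 <= \prod_i f i <= \prod_i g i)%E; last by case/andP.
elim/big_rec2 : _ => [|i x y _ /andP[x0 xy]]; first by rewrite lexx lee01.
by rewrite mule_ge0//= lee_pmul.
Qed.

Section summability.
Context (R : realType) (d : nat).
Local Notation lam := (@lebesgue_measure R).
Local Notation leb n := (@lebesgue_mx R n 1).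
Local Notation cube d := (@unit_cube R d).
Variable q : R.
Hypothesis q01 : 0 < q < 1.
Local Notation sing := (sing q).
Local Notation Csing := (Csing q).

Definition prodsing (k : d.-tuple int) (U : 'M[R]_d) : \bar R :=
  (\prod_j sing (zrow k U j))%E.

Lemma prodsing_ge0 k U : (0 <= prodsing k U)%E.
Proof. by apply: prode_ge0 => j _; exact: sing_ge0. Qed.

Lemma measurable_zrow (k : d.-tuple int) j : measurable_fun setT (fun U : 'M[R]_d => zrow k U j).
Proof.
apply: measurable_sum => i; apply: measurable_funM => //; exact: measurable_mx_entry.
Qed.

Lemma prod_setT (f : 'I_d -> \bar R) :
  (\prod_j f j = \prod_(j in finset.setTfor 'I_d) f j)%E.
Proof. by apply: eq_bigl => j; rewrite finset.in_setT. Qed.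

Lemma measurable_prodsing k : measurable_fun setT (prodsing k).
Proof.
rewrite /prodsing; under eq_fun do rewrite prod_setT.
apply: emeasurable_prod => j.
exact: (measurableT_comp (measurable_sing q) (measurable_zrow k j)).
Qed.

(** Truncation to bounded matrices, on which the integral is finite. *)
Definition psM k M (U : 'M[R]_d) : \bar R := (prodsing k U * (\1_(mbox M) U)%:E)%E.

Lemma psM_ge0 k M U : (0 <= psM k M U)%E.
Proof. by rewrite mule_ge0 ?prodsing_ge0// lee_fin. Qed.

Lemma measurable_psM k M : measurable_fun setT (psM k M).
Proof.
apply: emeasurable_funM; first exact: measurable_prodsing.
by apply/measurable_EFinP; apply: measurable_indic; exact: measurable_mbox.
Qed.

Lemma mxvec_index_inj m n (i i' : 'I_m) (j j' : 'I_n) :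
  mxvec_index i j = mxvec_index i' j' -> i = i' /\ j = j'.
Proof. by rewrite /mxvec_index => /cast_ord_inj/enum_rank_inj[]. Qed.

(** The d forms (N^T k)_j involve disjoint sets of entries of N, and the
    entry in row i0 and column j serves as pivot of the j-th one, with
    coefficient k_i0. All d factors therefore gain K^-q. *)
Lemma integral_psM (k : d.-tuple int) (M K : R) (i0 : 'I_d) : 0 <= M -> 0 < K ->
  K <= `|(tnth k i0)%:~R : R| ->
  (\int[@lebesgue_mx R d d]_N psM k M N <=
   ((K `^ (- q) * Csing M) ^+ d * (2 * M + 1) ^+ (d * d))%:E)%E.
Proof.
move=> M0 K0 Kk.
rewrite ge0_integral_mx_col; [|exact: measurable_psM|exact: psM_ge0].
pose a (j : 'I_d) (p : 'I_(d * d)) : R :=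
  \sum_i (tnth k i)%:~R * (p == mxvec_index i j)%:R.
have aE i j j' : a j (mxvec_index i j') = if j' == j then (tnth k i)%:~R else 0.
  rewrite /a (bigD1 i)//= big1 ?addr0; last first.
    move=> i' i'i; rewrite (_ : _ == _ = false) ?mulr0//.
    by apply/negbTE/eqP => /mxvec_index_inj[h _]; rewrite h eqxx in i'i.
  case: (eqVneq j' j) => [->|jj]; first by rewrite eqxx mulr1.
  rewrite (_ : _ == _ = false) ?mulr0//.
  by apply/negbTE/eqP => /mxvec_index_inj[_ h]; rewrite h eqxx in jj.
have := @integral_sing_prod R q q01 (d * d) d (finset.setTfor 'I_d) a (fun=> 0) M K M0 K0.
rewrite cardsT card_ord => h.
apply: le_trans (h _).
  rewrite le_eqVlt; apply/orP; left; apply/eqP; apply: eq_integral => c _.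
  rewrite /psM; congr (_ * _)%E.
    rewrite /prodsing prod_setT; apply: eq_bigr => j _; congr sing.
    rewrite /lform add0r /zrow /a.
    under [RHS]eq_bigr do rewrite mulr_suml.
    rewrite exchange_big /=; apply: eq_bigr => i _.
    rewrite (bigD1 (mxvec_index i j))//= eqxx mulr1 big1 ?addr0 ?mxE// => p pij.
    by rewrite (negbTE pij) mulr0 mul0r.
  rewrite !indicE; congr (_%:R%:E); congr nat_of_bool.
  by rewrite -(@mboxE R d d M); apply/idP/idP => /set_mem h'; apply/mem_set.
move=> j _; exists (mxvec_index i0 j); first by rewrite aE eqxx.
by move=> j' _ jj'; rewrite aE eq_sym (negbTE jj').
Qed.

Lemma haar_psM (k : d.-tuple int) (M K : R) (i0 : 'I_d) : 0 <= M -> 0 < K ->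
  K <= `|(tnth k i0)%:~R : R| ->
  (\int[@haar_SL R d]_U psM k M U <=
   ((K `^ (- q) * Csing M) ^+ d * (2 * M + 1) ^+ (d * d))%:E)%E.
Proof.
move=> M0 K0 Kk; apply: le_trans (integral_psM M0 K0 Kk).
apply: ge0_le_integral_haar.
- exact: measurable_psM.
- exact: measurable_psM.
- exact: psM_ge0.
- exact: psM_ge0.
move=> N cN; rewrite /psM; apply: lee_pmul; rewrite ?lee_fin ?prodsing_ge0//.
  apply: le_prode => j; first exact: sing_ge0.
  apply: le_sing => //; have [c c1 ->] := SL_proj_scale cN.
  have -> : zrow k (c *: N) j = c * zrow k N j.
    by rewrite /zrow mulr_sumr; apply: eq_bigr => i _; rewrite mxE mulrCA.
  by rewrite normrM ler_peMl// (le_trans c1)// ler_norm.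
rewrite !indicE; case: (boolP (_ \in _)) => [/set_mem h|_]; last by rewrite ler0n.
by rewrite mem_set//; exact: mbox_SL_proj.
Qed.

Definition svM (k : d.-tuple int) M (v : 'cV[R]_d) : \bar R :=
  (sing (zdot k v) * (\1_(ibox M) v)%:E)%E.

Lemma svM_ge0 k M U : (0 <= svM k M U)%E.
Proof. by rewrite mule_ge0 ?sing_ge0// lee_fin. Qed.

Lemma measurable_svM k M : measurable_fun setT (svM k M).
Proof.
apply: emeasurable_funM.
  exact: (measurableT_comp (measurable_sing q) (measurable_zdot k)).
by apply/measurable_EFinP; apply: measurable_indic; exact: measurable_ibox.
Qed.

Lemma integral_svM (k : d.-tuple int) (M K : R) (i0 : 'I_d) : 0 <= M -> 0 < K ->
  K <= `|(tnth k i0)%:~R : R| ->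
  (\int[leb d]_v svM k M v <= (K `^ (- q) * Csing M * (2 * M + 1) ^+ d)%:E)%E.
Proof.
move=> M0 K0 Kk.
pose a (j : 'I_1) (p : 'I_d) : R := (tnth k p)%:~R.
have := @integral_sing_prod R q q01 d 1 (finset.setTfor 'I_1) a (fun=> 0) M K M0 K0.
rewrite cardsT card_ord expr1 => h.
apply: le_trans (h _).
  rewrite le_eqVlt; apply/orP; left; apply/eqP; apply: eq_integral => v _.
  rewrite /svM; congr (_ * _)%E.
  rewrite (eq_bigl xpredT); last by move=> j; rewrite finset.in_setT.
  by rewrite big_ord1; congr sing; rewrite /lform add0r.
by move=> j _; exists i0 => // j' _; rewrite !ord1 eqxx.
Qed.

Local Notation mu2 := (sfprod (@haar_SL R d) (leb d)).
Local Notation mu := (sfprod mu2 (leb d)).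

Definition sum_term k M (w : sample_space R d) : \bar R :=
  (psM k M w.1.1 * (\1_(cube d) w.1.2)%:E * svM k M w.2)%E.

Lemma sum_term_ge0 k M w : (0 <= sum_term k M w)%E.
Proof.
apply: mule_ge0; last exact: svM_ge0.
by apply: mule_ge0; [exact: psM_ge0|rewrite lee_fin].
Qed.

Lemma measurable_sum_term k M : measurable_fun setT (sum_term k M).
Proof.
apply: emeasurable_funM; first apply: emeasurable_funM.
- exact: (measurableT_comp (measurable_psM k M) (measurableT_comp measurable_fst measurable_fst)).
- apply/measurable_EFinP.
  have m1 : measurable_fun setT (\1_(cube d) : 'cV[R]_d -> R).
    by apply: measurable_indic; exact: measurable_cube.
  exact: (measurableT_comp m1 (measurableT_comp measurable_snd measurable_fst)).
- exact: (measurableT_comp (measurable_svM k M) measurable_snd).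
Qed.

Lemma integral_sum_term (k : d.-tuple int) (M K : R) (i0 : 'I_d) : 0 <= M -> 0 < K ->
  K <= `|(tnth k i0)%:~R : R| ->
  (\int[mu]_w sum_term k M w <=
   ((K `^ (- q) * Csing M) ^+ d.+1 * (2 * M + 1) ^+ (d * d + d))%:E)%E.
Proof.
move=> M0 K0 Kk.
have m1 : measurable_fun setT (fun x => (\1_(cube d) x : R)%:E : \bar R).
  by apply/measurable_EFinP; apply: measurable_indic; exact: measurable_cube.
rewrite (_ : (\int[mu]_w sum_term k M w =
    \int[@haar_SL R d]_U psM k M U * \int[leb d]_x (\1_(cube d) x : R)%:E *
    \int[leb d]_v svM k M v)%E); last first.
  apply: ge0_integral_prod3 => //.
  - exact: measurable_psM.
  - exact: measurable_svM.
  - exact: psM_ge0.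
  - exact: svM_ge0.
rewrite integral_indic//; last exact: measurable_cube.
rewrite setIT /= lebesgue_cube mule1.
rewrite exprSr exprD mulrACA EFinM; apply: lee_pmul => //.
- by apply: integral_ge0 => U _; exact: psM_ge0.
- by apply: integral_ge0 => v _; exact: svM_ge0.
- exact: haar_psM M0 K0 Kk.
- exact: integral_svM M0 K0 Kk.
Qed.

End summability.

Definition nz d (k : d.-tuple int) : bool := [exists i, tnth k i != 0].

Section Zbox_sums.
Context (V : nmodType) (d : nat).

Lemma Zbox_sub L L' (k : d.-tuple int) : (L <= L')%N -> k \in Zbox d L -> k \in Zbox d L'.
Proof.
move=> LL /mem_Zbox h; apply/mem_Zbox => i; have := h i; rewrite !mem_irange; lia.
Qed.

Lemma big_Zbox_split L L' (P : pred (d.-tuple int)) (F : d.-tuple int -> V) : (L <= L')%N ->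
  \sum_(k <- Zbox d L' | P k) F k =
  \sum_(k <- Zbox d L | P k) F k + \sum_(k <- Zbox d L' | P k && (k \notin Zbox d L)) F k.
Proof.
move=> LL; rewrite (bigID (mem (Zbox d L))) /=; congr (_ + _).
rewrite -[LHS]big_filter -[RHS]big_filter; apply: perm_big; apply: uniq_perm.
- by rewrite filter_uniq// Zbox_uniq.
- by rewrite filter_uniq// Zbox_uniq.
move=> k; rewrite !mem_filter -andbA; case: (P k) => //=.
by case: (boolP (k \in Zbox d L)) => //= kL; rewrite (Zbox_sub LL kL).
Qed.

Lemma notin_Zbox L (k : d.-tuple int) : k \notin Zbox d L ->
  exists i, (L%:Z <= `|tnth k i|).
Proof.
move=> kL; have [/existsP[i hi]|] := boolP [exists i, tnth k i \notin irange L].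
  by exists i; move: hi; rewrite mem_irange; lia.
rewrite negb_exists => /forallP h; case/negP: kL; apply/mem_Zbox => i.
by have := h i; rewrite negbK.
Qed.

Lemma nz_Zbox1 (k : d.-tuple int) : nz k -> exists i, (1 <= `|tnth k i|).
Proof. by move=> /existsP[i hi]; exists i; lia. Qed.

End Zbox_sums.

Section ae_summable.
Context (R : realType) (d : nat).
Local Notation leb n := (@lebesgue_mx R n 1).
Local Notation cube d := (@unit_cube R d).

(** Any q with d / (d + 1) < q < 1 works: below 1 the singularities are
    integrable, and above d / (d + 1) the gain 2^(-n q (d + 1)) of a term
    with |k| ~ 2^n beats the number 2^(n d) of such k. This choice gives q (d
    + 1) = d + 1/2. *)
Definition qexp : R := (d%:R + 2^-1) / d.+1%:R.

Lemma qexp01 : (0 < qexp < 1).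
Proof.
apply/andP; split; first by rewrite divr_gt0// ltr_wpDl.
rewrite ltr_pdivrMr// mul1r -[d.+1%:R]natr1 ltrD2l; lra.
Qed.

Local Notation q := qexp.
Local Notation mu2 := (sfprod (@haar_SL R d) (leb d)).
Local Notation mu := (sfprod mu2 (leb d)).
Local Notation rr := ((2 : R) `^ (- 2^-1)).

Lemma rr01 : 0 < rr < 1.
Proof.
rewrite powR_gt0//= powRN invf_lt1 ?powR_gt0//.
by rewrite powR12_sqrt// -[ltLHS]sqrtr1 ltr_sqrt// ltr1n.
Qed.

Lemma dyadic_count N : (2 ^+ N) ^+ d * ((2 ^+ N) `^ (- q)) ^+ d.+1 = rr ^+ N :> R.
Proof.
have p0 : 0 <= 2 ^+ N :> R by rewrite exprn_ge0.
have pn0 : 2 ^+ N != 0 :> R by rewrite expf_neq0.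
rewrite -(powR_mulrn d.+1) ?powR_ge0// -powRrM -(powR_mulrn d)// -powRD; last by rewrite pn0 implybT.
rewrite -(powR_mulrn N (ler0n R 2)) -powRrM mulrC powRrM powR_mulrn ?powR_ge0//.
by congr ((_ `^ _) ^+ _); rewrite /q mulNr divfK ?pnatr_eq0//; ring.
Qed.

(** Cubes with dyadic sides, so that consecutive differences are the dyadic
    shells. *)
Definition partial_sum M N (w : sample_space R d) : \bar R :=
  (\sum_(k <- Zbox d (2 ^ N) | nz k) sum_term q k M w)%E.

Lemma measurable_partial_sum M N : measurable_fun setT (partial_sum M N).
Proof.
rewrite (_ : partial_sum M N =
    fun w => \sum_(k <- seq.filter (@nz d) (Zbox d (2 ^ N))) sum_term q k M w)%E.
  by apply: emeasurable_sum => k; exact: measurable_sum_term.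
by apply/funext => w; rewrite big_filter.
Qed.

Lemma partial_sum_nd M w : nondecreasing_seq (partial_sum M ^~ w).
Proof.
apply/nondecreasing_seqP => N; rewrite /partial_sum.
rewrite [leRHS](@big_Zbox_split _ d (2 ^ N) (2 ^ N.+1)) ?leq_exp2l//.
rewrite leeDl//; apply: sume_ge0 => k _; exact: sum_term_ge0.
Qed.

Definition sum_bound (M : R) : R :=
  Csing q M ^+ d.+1 * (2 * M + 1) ^+ (d * d + d) * 4 ^+ d.

Lemma sum_bound_ge0 M : 0 <= M -> 0 <= sum_bound M.
Proof.
move=> M0; have C0 : 0 <= Csing q M by rewrite Csing_ge0// qexp01.
by rewrite !mulr_ge0// exprn_ge0// addr_ge0// mulr_ge0.
Qed.

Lemma integral_partial_sum (M : R) N : 0 <= M ->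
  (\int[mu]_w partial_sum M N w <= (sum_bound M * (1 + \sum_(i < N) rr ^+ i))%:E)%E.
Proof.
move=> M0; have C0 : 0 <= Csing q M by rewrite Csing_ge0// qexp01.
have B0 := sum_bound_ge0 M0.
have int_sum (P : pred (d.-tuple int)) s :
   (\int[mu]_w (\sum_(k <- s | P k) sum_term q k M w) = \sum_(k <- s | P k) \int[mu]_w sum_term q k M w)%E.
  rewrite -[RHS]big_filter -ge0_integral_sum//.
  - by apply: eq_integral => w _; rewrite big_filter.
  - by move=> k; exact: measurable_sum_term.
  - by move=> k w _; exact: sum_term_ge0.
(* The shell at scale 2^L has at most (4 * 2^L)^d points, each with a
   coordinate of size at least 2^L. *)
have shell L (s : seq (d.-tuple int)) (P : pred (d.-tuple int)) :
    (size s <= (4 * 2 ^ L) ^ d)%N ->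
    (forall k, k \in s -> P k -> exists i, ((2 ^ L)%N%:Z <= `|tnth k i|)) ->
    (\sum_(k <- s | P k) \int[mu]_w sum_term q k M w <= (sum_bound M * rr ^+ L)%:E)%E.
  move=> sz far.
  pose t := ((2 ^+ L) `^ (- q) * Csing q M) ^+ d.+1 * (2 * M + 1) ^+ (d * d + d).
  have t0 : 0 <= t.
    by rewrite mulr_ge0// exprn_ge0// ?mulr_ge0 ?powR_ge0// addr_ge0// mulr_ge0.
  apply: (@le_trans _ _ (\sum_(k <- s | P k) t%:E)%E).
    rewrite big_seq_cond [leRHS]big_seq_cond; apply: lee_sum => k /andP[ks Pk].
    have [i hi] := far k ks Pk.
    apply: (@integral_sum_term _ _ _ qexp01 k M (2 ^+ L) i) => //.
    have -> : 2 ^+ L = (2 ^ L)%N%:Z%:~R :> R by rewrite -pmulrn natrX.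
    by rewrite -intr_norm ler_int.
  rewrite sumEFin lee_fin.
  apply: (@le_trans _ _ (\sum_(k <- s) t)).
    by rewrite big_mkcond; apply: ler_sum => k _; case: ifP.
  rewrite big_const_seq count_predT iter_addr_0 -[leLHS]mulr_natl.
  apply: (@le_trans _ _ ((4 * 2 ^+ L) ^+ d * t)).
    apply: ler_wpM2r => //; apply: le_trans (_ : ((4 * 2 ^ L) ^ d)%N%:R <= _).
      by rewrite ler_nat.
    by rewrite natrX natrM natrX.
  rewrite le_eqVlt; apply/orP; left; apply/eqP.
  rewrite /t /sum_bound -dyadic_count !exprMn; ring.
rewrite /partial_sum int_sum//; elim: N => [|N IH].
  rewrite big_ord0 addr0 mulr1 -[X in X%:E]mulr1 -(expr0 rr); apply: shell.
    have le_exp (e a b : nat) : (a <= b)%N -> (a ^ e <= b ^ e)%N.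
      by move=> ab; elim: e => // e IH; rewrite !expnS leq_mul.
    by rewrite size_Zbox expn0; exact: le_exp.
  by move=> k _; exact: nz_Zbox1.
rewrite (@big_Zbox_split _ d (2 ^ N) (2 ^ N.+1)) ?leq_exp2l//.
rewrite big_ord_recr /= addrA mulrDr EFinD; apply: leeD; first exact: IH.
apply: shell.
  by rewrite size_Zbox addnn -mul2n expnS mulnA.
by move=> k _ /andP[_]; exact: notin_Zbox.
Qed.

(** The integrals of the partial sums are bounded by a geometric series, so
    by monotone convergence the supremum of the partial sums is integrable,
    hence finite almost everywhere. *)
Lemma ae_partial_sum (M : R) : 0 <= M ->
  {ae mu, forall w, exists B : R, forall N, (partial_sum M N w <= B%:E)%E}.
Proof.
move=> M0.
pose S w := ereal_sup (range (partial_sum M ^~ w)).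
have cvS w : partial_sum M ^~ w @ \oo --> S w.
  by apply: ereal_nondecreasing_cvgn; exact: partial_sum_nd.
have p0 N w : (0 <= partial_sum M N w)%E by apply: sume_ge0 => k _; exact: sum_term_ge0.
have S0 w : (0 <= S w)%E.
  by apply: le_trans (p0 0%N w) _; apply: ereal_sup_ubound; exists 0%N.
have mS : measurable_fun setT S.
  apply: (emeasurable_fun_cvg (fun N => partial_sum M N)) => [N|w _]; last exact: cvS.
  exact: measurable_partial_sum.
have iS : (\int[mu]_w S w < +oo)%E.
  apply: (@le_lt_trans _ _ (sum_bound M * (1 + (1 - rr)^-1))%:E); last exact: ltry.
  rewrite (eq_integral (fun w => limn (partial_sum M ^~ w))); last first.
    by move=> w _; apply/esym/cvg_lim => //; exact: cvS.
  rewrite monotone_convergence//; last 2 first.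
  - by move=> N; exact: measurable_partial_sum.
  - by move=> w _; exact: partial_sum_nd.
  apply: lime_le.
    apply: ereal_nondecreasing_is_cvgn => m n mn; apply: ge0_le_integral => //.
    - exact: measurable_partial_sum.
    - exact: measurable_partial_sum.
    - by move=> w _; exact: partial_sum_nd.
  apply: nearW => N; apply: le_trans (integral_partial_sum N M0) _.
  have /andP[r0 r1] := rr01.
  rewrite lee_fin; apply: ler_wpM2l; first exact: sum_bound_ge0.
  rewrite lerD2l -(big_mkord xpredT (fun i => rr ^+ i)).
  have -> : \sum_(0 <= i < N) rr ^+ i = series (geometric 1 rr) N.
    by rewrite /series /=; apply: eq_bigr => i _; rewrite mul1r.
  have := @cvg_geometric_series R 1 rr.
  rewrite (gtr0_norm r0) => /(_ r1) cg.
  rewrite -[leRHS]mul1r -(cvg_lim _ cg)//.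
  apply: nondecreasing_cvgn_le; last by apply/cvg_ex; eexists; exact: cg.
  apply/nondecreasing_seqP => n; rewrite seriesSr lerDl /= mul1r exprn_ge0// ltW.
have : mu.-integrable setT S.
  apply/integrableP; split => //; rewrite (eq_integral S)// => w _.
  by rewrite gee0_abs.
move=> /(integrable_ae measurableT); apply: filterS => w /(_ I) Sw.
exists (fine (S w)) => N; rewrite fineK//.
by apply: ereal_sup_ubound; exists N.
Qed.

End ae_summable.

(** * Fejer-weighted sums of dominated coefficients *)

Section tannery.
Context (R : realType) (d : nat).
Variable b : d.-tuple int -> R.
Variable B : R.
Hypothesis bB : forall N, \sum_(k <- Zbox d N | nz k) b k <= B.

Lemma fw_01 N (j : int) : j \in irange N -> 0 <= fw R N j <= 1.
Proof.
rewrite mem_irange => hj.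
have N0 : (0 < N)%N by lia.
have jN : `|j|%:~R <= N%:R :> R by rewrite -[N%:R]/(N%:Z%:~R) ler_int; lia.
rewrite /fw divr_ge0 ?subr_ge0//= ler_pdivrMr ?ltr0n// mul1r lerBlDr lerDl.
by rewrite ler0z.
Qed.

Lemma fwt_01 N (k : d.-tuple int) : k \in Zbox d N -> 0 <= fwt R N k <= 1.
Proof.
move=> /mem_Zbox h; rewrite prodr_ge0/=; last by move=> i _; have /andP[] := fw_01 (h i).
by rewrite -[leRHS](big1 (op := *%R) (index_enum 'I_d) xpredT (fun=> 1))//; apply: ler_prod => i _; exact: fw_01.
Qed.

Lemma cvg_fw (j : int) : fw R N j @[N --> \oo] --> (1 : R).
Proof.
have cinv : (N%:R^-1 : R) @[N --> \oo] --> (0 : R).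
  by rewrite -(cvg_shiftS (fun N => N%:R^-1 : R)); exact: cvg_harmonic.
have h : (1 - `|j|%:~R * N%:R^-1) @[N --> \oo] --> (1 - `|j|%:~R * 0 : R).
  by apply: cvgB; [exact: cvg_cst|apply: cvgM; [exact: cvg_cst|exact: cinv]].
rewrite mulr0 subr0 in h; apply: cvg_trans h; apply: near_eq_cvg; near=> N.
have N0 : (0 < N)%N by near: N; exact: nbhs_infty_gt.
by rewrite /fw mulrBl divff// pnatr_eq0 -lt0n.
Unshelve. all: by end_near. Qed.

Lemma cvg_fwt (k : d.-tuple int) : fwt R N k @[N --> \oo] --> (1 : R).
Proof.
have h : \prod_i fw R N (tnth k i) @[N --> \oo] --> \prod_(i < d) (1 : R).
  by apply: cvg_big => [|i _]; [exact: mul_continuous|exact: cvg_fw].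
by rewrite big1_eq in h.
Qed.

(** The partial sums over cubes are bounded, so one of them is within e of
    their supremum. *)
Lemma tail_small (e : R) : 0 < e ->
  exists L, forall N, (L <= N)%N ->
    \sum_(k <- Zbox d N | nz k && (k \notin Zbox d L)) b k <= e.
Proof.
move=> e0; pose S N := \sum_(k <- Zbox d N | nz k) b k.
have ubS : has_ubound (range S) by exists B => _ [N _ <-]; exact: bB.
have supS : has_sup (range S) by split => //; exists (S 0%N); exists 0%N.
have [_ [L _ <-] hL] := sup_adherent e0 supS.
exists L => N LN.
have : S N <= sup (range S) by apply: ub_le_sup => //; exists N.
by rewrite /S (big_Zbox_split _ _ LN) -/(S L); lra.
Qed.

(** The form in which Fejer means of the corrector appear. *)
Definition fsum (beta : d.-tuple int -> R) N : R :=
  \sum_(k <- Zbox d N | nz k) fwt R N k * beta k.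

(** Tannery: beyond a fixed cube the terms are small by domination, and
    inside it the weights tend to 1. The rank does not depend on beta. *)
Lemma fsum_cauchy (e : R) : 0 < e -> exists N0, forall N M, (N0 <= N)%N -> (N0 <= M)%N ->
  forall beta, (forall k, nz k -> `|beta k| <= b k) ->
  `|fsum beta N - fsum beta M| <= e.
Proof.
move=> e0; have e4 : 0 < e / 4 by rewrite divr_gt0.
have [L hL] := tail_small e4.
pose err (N : nat) : R := \sum_(k <- Zbox d L | nz k) `|fwt R N k - 1| * b k.
have cerr : err N @[N --> \oo] --> (0 : R).
  have h : err N @[N --> \oo] --> \sum_(k <- Zbox d L | nz k) `|1 - 1 : R| * b k.
    apply: cvg_big => [|k _]; first exact: add_continuous.
    apply: cvgM; last exact: cvg_cst.
    apply: cvg_norm; apply: cvgB; [exact: cvg_fwt|exact: cvg_cst].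
  by rewrite subrr normr0 big1 in h => [|k _]; rewrite ?mul0r.
have [N1 _ hN1] : \forall N \near \oo, `|err N| <= e / 4.
  by move/cvgr0_norm_le : cerr => /(_ _ e4).
exists (maxn N1 L) => N M; rewrite !geq_max => /andP[N1N LN] /andP[N1M LM] beta hb.
have step K : (N1 <= K)%N -> (L <= K)%N ->
    `|fsum beta K - \sum_(k <- Zbox d L | nz k) beta k| <= e / 4 + e / 4.
  move=> N1K LK; rewrite /fsum (big_Zbox_split _ _ LK) addrAC -sumrB.
  apply: le_trans (ler_normD _ _) _; apply: lerD.
    apply: le_trans (hN1 K N1K); apply: le_trans (ler_norm _).
    apply: le_trans (ler_norm_sum _ _ _) _; apply: ler_sum => k nk.
    rewrite -{2}[beta k]mul1r -mulrBl normrM ler_wpM2l//; exact: hb.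
  apply: le_trans (hL K LK); apply: le_trans (ler_norm_sum _ _ _) _.
  rewrite big_seq_cond [leRHS]big_seq_cond; apply: ler_sum => k /and3P[kK nk _].
  have /andP[f0 f1] := fwt_01 kK.
  rewrite normrM ger0_norm//; apply: le_trans (hb _ nk).
  by rewrite ler_piMl.
have h1 := step _ N1N LN; have h2 := step _ N1M LM.
set V := \sum_(k <- _ | _) _ in h1 h2.
have -> : fsum beta N - fsum beta M = (fsum beta N - V) - (fsum beta M - V) by ring.
apply: le_trans (ler_normB _ _) _; lra.
Qed.

Lemma fsum_cvg beta : (forall k, nz k -> `|beta k| <= b k) -> cvgn (fsum beta).
Proof.
move=> hb; apply/cauchy_cvgP/cauchy_exP => e e0.
have e2 : 0 < e / 2 by rewrite divr_gt0.
have [N0 h] := fsum_cauchy e2.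
exists (fsum beta N0); exists N0 => // n /= hn.
rewrite -ball_normE /ball_ /=; apply: le_lt_trans (h _ _ (leqnn _) hn beta hb) _; lra.
Qed.

End tannery.

(** * Absolute summability of the small denominators *)

Section summability_real.
Context (R : realType) (d : nat).
Local Notation cube d := (@unit_cube R d).
Local Notation q := (qexp R d).

(** Up to a factor depending on d, the size of the k-th Fourier coefficient
    of the box divided by the small denominator k . v. *)
Definition bcoef (U : 'M[R]_d) (v : 'cV[R]_d) (k : d.-tuple int) : R :=
  \prod_j `|zrow k U j|^-1 * `|zdot k v|^-1.

Lemma bcoef_ge0 U v k : 0 <= bcoef U v k.
Proof. by rewrite mulr_ge0// ?invr_ge0// prodr_ge0// => j _; rewrite invr_ge0. Qed.

Lemma prodsing_gt0 (k : d.-tuple int) (U : 'M[R]_d) : (0 < prodsing q k U)%E.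
Proof.
rewrite /prodsing; elim/big_rec : _ => [|j x _ x0]; first exact: lte01.
by rewrite mule_gt0// sing_gt0.
Qed.

Lemma prodsing_pinfty (k : d.-tuple int) (U : 'M[R]_d) j : zrow k U j = 0 -> prodsing q k U = +oo%E.
Proof.
move=> kj; rewrite /prodsing (bigD1 j)//= {1}/sing kj eqxx gt0_mulye//.
elim/big_rec : _ => [|i x _ x0]; first exact: lte01.
by rewrite mule_gt0// sing_gt0.
Qed.

Lemma sing_real s : s != 0 -> sing q s = (`|s|^-1 `^ q)%:E.
Proof.
move=> s0; rewrite /sing (negbTE s0) -powR_inv1// -powRrM.
by rewrite mulN1r.
Qed.

Lemma prodsing_real (k : d.-tuple int) (U : 'M[R]_d) : (forall j, zrow k U j != 0) ->
  prodsing q k U = ((\prod_j `|zrow k U j|^-1) `^ q)%:E.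
Proof.
move=> k0; rewrite /prodsing.
have : (\prod_j sing q (zrow k U j) = ((\prod_j `|zrow k U j|^-1) `^ q)%:E)%E /\
  0 <= \prod_j `|zrow k U j|^-1; last by case.
elim/big_rec2 : _ => [|j x y _ [-> x0]]; first by rewrite powR1.
by rewrite sing_real// -EFinM powRM ?invr_ge0// mulr_ge0 ?invr_ge0.
Qed.

Lemma Zbox_exists (k : d.-tuple int) : exists N, k \in Zbox d (2 ^ N).
Proof.
exists (\max_i `|tnth k i|%N).+1; apply/mem_Zbox => i; rewrite mem_irange.
have h1 : (`|tnth k i| <= \max_i `|tnth k i|)%N by exact: (leq_bigmax i).
have h2 : ((\max_i `|tnth k i|%N).+1 < 2 ^ (\max_i `|tnth k i|%N).+1)%N by exact: ltn_expl.
have := leq_ltn_trans (leqW h1) h2.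
by move: (2 ^ _)%N => c; lia.
Qed.

(** Finiteness of the extended sums rules out vanishing denominators, and
    bounded sums of q-th powers give summability: if b^q <= B for every term,
    then b = b^q * (b^q)^(1/q - 1) <= B^(1/q - 1) * b^q. *)
Lemma partial_sum_bcoef (M : R) (w : sample_space R d) (B : R) :
  mbox M w.1.1 -> cube d w.1.2 -> ibox M w.2 ->
  (forall N, (partial_sum M N w <= B%:E)%E) ->
  (forall k, nz k -> (forall j, zrow k w.1.1 j != 0) /\ zdot k w.2 != 0) /\
  exists B', forall N, \sum_(k <- Zbox d N | nz k) bcoef w.1.1 w.2 k <= B'.
Proof.
case: w => [[U x] v] /= hU hx hv hB.
have termE k : sum_term q k M (U, x, v) = (prodsing q k U * sing q (zdot k v))%E.
  rewrite /sum_term /psM /svM /= !indicE !mem_set//.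
  by rewrite !mule1.
have term_ge0 k : (0 <= sum_term q k M (U, x, v))%E by exact: sum_term_ge0.
have term_le k : nz k -> (prodsing q k U * sing q (zdot k v) <= B%:E)%E.
  move=> nk; have [N kN] := Zbox_exists k; apply: le_trans (hB N).
  rewrite /partial_sum big_mkcond (bigD1_seq k) ?Zbox_uniq//= nk termE.
  by rewrite leeDl// sume_ge0// => k' _; case: ifP.
have good k : nz k -> (forall j, zrow k U j != 0) /\ zdot k v != 0.
  move=> nk; split=> [j|]; apply/eqP => e0; have := term_le _ nk.
    by rewrite (prodsing_pinfty e0) gt0_mulye// ?sing_gt0.
  by rewrite {1}/sing e0 eqxx gt0_muley// prodsing_gt0.
split => //.
have termR k : nz k -> sum_term q k M (U, x, v) = (bcoef U v k `^ q)%:E.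
  move=> nk; have [g1 g2] := good _ nk.
  rewrite termE prodsing_real// sing_real// -EFinM -powRM ?invr_ge0//.
  by rewrite prodr_ge0// => j _; rewrite invr_ge0.
have /andP[q0 q1] := qexp01 R d.
have le_k k : nz k -> bcoef U v k `^ q <= B.
  by move=> nk; rewrite -lee_fin -termR// termE; exact: term_le.
have B0 : 0 <= B.
  by rewrite -lee_fin; apply: le_trans (hB 0%N); rewrite /partial_sum sume_ge0.
pose p := (1 - q) / q.
have b_le k : nz k -> bcoef U v k <= B `^ p * bcoef U v k `^ q.
  move=> nk; have b0 := bcoef_ge0 U v k.
  (* The exponent 1 - q of b is rewritten as q p with p >= 0. *)
  have e : 1 = q * p + q by rewrite /p mulrCA divff ?gt_eqF// mulr1 subrK.
  rewrite -[leLHS]powRr1// {1}e powRD -?e ?oner_eq0// (powRrM _ q p).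
  rewrite ler_wpM2r ?powR_ge0// ge0_ler_powR ?nnegrE ?powR_ge0 ?le_k//.
  by rewrite divr_ge0 ?subr_ge0 ?ltW.
exists (B `^ p * B) => N.
have NN : (N <= 2 ^ N)%N by exact/ltnW/ltn_expl.
apply: (@le_trans _ _ (\sum_(k <- Zbox d (2 ^ N) | nz k) bcoef U v k)).
  by rewrite (big_Zbox_split _ _ NN) lerDl sumr_ge0// => k _; exact: bcoef_ge0.
apply: le_trans (ler_sum _ (fun k nk => b_le k nk)) _.
rewrite -mulr_sumr ler_wpM2l ?powR_ge0//.
rewrite -lee_fin -sumEFin; apply: le_trans (hB N).
by rewrite /partial_sum; apply: lee_sum => k nk; rewrite termR.
Qed.

End summability_real.

(** * Continuity of the periodized box off its faces *)

Section torus_distance.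
Context (R : realType).

Lemma sin2E (s : R) : sin2 s = (1 - cos (2 * pi * s)) / 2.
Proof.
rewrite /sin2 sin2cos2 (_ : 2 * pi * s = pi * s + pi * s); last by ring.
rewrite cosD -!expr2 sin2cos2; lra.
Qed.

(** On [-1/2, 1/2] the function sin2 is increasing in the distance to 0, and
    it has period 1. *)
Lemma sin2_near (eps : R) : 0 < eps -> exists2 del : R, 0 < del &
  forall s : R, sin2 s < del -> exists n : int, `|s - n%:~R| < eps.
Proof.
move=> eps0; pose r : R := Num.min eps (2^-1).
have r0 : 0 < r by rewrite lt_min eps0/= invr_gt0.
have r2 : r <= 2^-1 by rewrite ge_min lexx orbT.
have pi0 := pi_gt0 R.
have inI (t : R) : 0 <= t <= 2^-1 -> 2 * pi * t \in `[0, pi].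
  move=> /andP[t0 t2]; rewrite in_itv/= mulr_ge0 ?mulr_ge0 ?(ltW pi0)//=.
  by rewrite mulrAC ger_pMl//; lra.
exists (sin2 r).
  rewrite sin2E divr_gt0// subr_gt0 -[ltRHS]cos0 -(mulr0 (2 * pi)).
  rewrite ltr_cos ?inI ?(ltW r0) ?lexx ?invr_ge0 ?ler0n//.
  by rewrite ltr_pM2l ?mulr_gt0.
move=> s hs; exists (Num.floor (s + 2^-1)).
have /andP[f1 f2] := floor_itv (s + 2^-1); move: f2; rewrite intrD => f2.
apply: (@lt_le_trans _ _ r); last by rewrite ge_min lexx.
rewrite ltNge; apply/negP => hr; move: hs; rewrite ltNge => /negP; apply.
set n := Num.floor _ in f1 f2 hr.
have -> : sin2 s = sin2 `|s - n%:~R|.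
  rewrite !sin2E.
  have -> : cos (2 * pi * s) = cos (2 * pi * (s - n%:~R)).
    by rewrite -[RHS](cos2pi_int n) mulrBr subrK.
  have [h|h] := leP 0 (s - n%:~R); first by rewrite ger0_norm.
  by rewrite ltr0_norm// mulrN cosN.
have h2 : `|s - n%:~R| <= 2^-1 by rewrite ler_norml; apply/andP; split; lra.
rewrite !sin2E ler_pM2r ?invr_gt0// lerD2l lerN2 leNgt ltr_cos ?inI ?r2 ?(ltW r0)//.
  by rewrite ltr_pM2l ?mulr_gt0// -leNgt.
by rewrite normr_ge0.
Qed.

End torus_distance.

Section tbox_continuity.
Context (R : realType) (d : nat).
Local Notation lam := (@lebesgue_measure R).
Local Notation leb n := (@lebesgue_mx R n 1).
Local Notation cube d := (@unit_cube R d).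
Variable u : 'I_d -> R.
Variables (U : 'M[R]_d) (e : R).
Hypothesis u01 : forall j, 0 < u j < 1.
Hypothesis dU : \det U = 1.
Hypothesis nU : near1 U e.
Hypothesis ue : forall j, u j + d%:R * e <= 1.

Lemma tbox_zvec (z : 'cV[R]_d) (m : d.-tuple int) : tbox u U (z + zvec R m) <-> tbox u U z.
Proof.
split=> -[m' hm'].
  exists [tuple tnth m i + tnth m' i | i < d].
  rewrite (_ : zvec R _ = zvec R m + zvec R m') ?addrA//.
  by apply/colP => i; rewrite !mxE tnth_mktuple intrD.
exists [tuple tnth m' i - tnth m i | i < d].
rewrite -addrA (_ : _ + zvec R _ = zvec R m')//.
by apply/colP => i; rewrite !mxE tnth_mktuple intrD intrN addrC subrK.
Qed.

Lemma continuous_adj_coord (m : d.-tuple int) j (y : 'cV[R]_d) :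
  (\adj U *m (z + zvec R m)) j 0 @[z --> y] --> (\adj U *m (y + zvec R m)) j 0.
Proof.
have h (x : 'cV[R]_d) : (\adj U *m (x + zvec R m)) j 0 =
    \sum_i (\adj U) j i * (x i 0 + (tnth m i)%:~R).
  by rewrite mxE; apply: eq_bigr => i _; rewrite !mxE.
rewrite h; under eq_fun do rewrite h.
apply: (cvg_big _ (nbhs_filter y)) => [|i _]; first exact: add_continuous.
apply: cvgM; first exact: cvg_cst.
apply: cvgD; last exact: cvg_cst.
exact: coord_continuous.
Qed.

Lemma near_seq (T : Type) (F : set_system T) {FF : Filter F} (I : eqType) (s : seq I)
    (P : I -> T -> Prop) : (forall i, i \in s -> \forall x \near F, P i x) ->
  \forall x \near F, forall i, i \in s -> P i x.
Proof.
elim: s => [_|i s IH h]; first by apply: filterS filterT => x _ i; rewrite in_nil.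
have h1 := h i (mem_head _ _).
have h2 : \forall x \near F, forall i, i \in s -> P i x.
  by apply: IH => j js; apply: h; rewrite in_cons js orbT.
by apply: filterS2 h1 h2 => x p1 p2 j; rewrite in_cons => /predU1P[->|/p2].
Qed.

(** Inside the open box this is openness. Outside, near y only finitely many
    translations can bring a point into the bounded set U(box), and for each
    of these some coordinate of the point lies strictly outside the closed
    box. *)
Lemma near_tbox (y : 'cV[R]_d) :
  (forall (m : d.-tuple int) j, (\adj U *m (y + zvec R m)) j 0 != 0 /\
     (\adj U *m (y + zvec R m)) j 0 != u j) ->
  \forall z \near y, (tbox u U z <-> tbox u U y).
Proof.
move=> gen; have [[m ym]|yn] := pselect (tbox u U y).
  have : \forall z \near y, forall j, j \in enum 'I_d ->
      0 < (\adj U *m (z + zvec R m)) j 0 < u j.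
    apply: (near_seq (FF := nbhs_filter y)) => j _; have /andP[h1 h2] := ym j.
    near=> z; apply/andP; split.
      near: z; exact: (cvgr_gt _ (@continuous_adj_coord m j y)).
    near: z; exact: (cvgr_lt _ (@continuous_adj_coord m j y)).
  apply: filterS => z hz; split=> _; last first.
    by exists m => j; apply: hz; rewrite mem_enum.
  by exists m.
pose K := Num.bound (\sum_i `|y i 0| + 2).
have hK : \sum_i `|y i 0| + 2 < K%:R.
  by apply: archi_boundP; rewrite addr_ge0// sumr_ge0.
(* A translation by m outside the cube of side K moves a neighbourhood of y
   outside (-1, 1)^d, which contains U(box). *)
have far : \forall z \near y, forall m : d.-tuple int, m \notin Zbox d K ->
    ~ box u (\adj U *m (z + zvec R m)).
  have : \forall z \near y, forall i, i \in enum 'I_d -> `|(z : 'cV[R]_d) i 0 - y i 0| < 1.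
    apply: (near_seq (FF := nbhs_filter y)) => i _.
    have := @coord_continuous R d 1 i 0 y.
    move=> /cvgr_dist_lt /(_ 1 ltr01); apply: filterS => z; by rewrite distrC.
  apply: filterS => z hz m /notin_Zbox[i hi] /(mx_boxE u _ dU).
  move=> /(mx_box_bound u01 nU ue)/(_ i).
  rewrite !mxE => h.
  have h1 := hz i (mem_enum _ _).
  have h2 : `|y i 0| <= \sum_i `|y i 0|.
    by rewrite (bigD1 i)//= lerDl sumr_ge0.
  have h3 : K%:R <= `|(tnth m i)%:~R| :> R.
    by rewrite -intr_norm -[K%:R]/(K%:Z%:~R) ler_int.
  have h4 : `|z i 0 + (tnth m i)%:~R| < 1 by rewrite ltr_norml.
  have : `|(tnth m i)%:~R : R| <= `|z i 0 + (tnth m i)%:~R| + `|z i 0 - y i 0| + `|y i 0|.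
    rewrite [X in `|X|](_ : _ = (z i 0 + (tnth m i)%:~R) - (z i 0 - y i 0) - y i 0); last by ring.
    by rewrite (le_trans (ler_normB _ _))// lerD2r ler_normB.
  lra.
have near0 : \forall z \near y, forall m, m \in Zbox d K ->
    ~ box u (\adj U *m (z + zvec R m)).
  apply: (near_seq (FF := nbhs_filter y)) => m _.
  have /existsNP[j hj] : ~ box u (\adj U *m (y + zvec R m)).
    by move=> h; apply: yn; exists m.
  have [g1 g2] := gen m j.
  have [h|h] := ltP ((\adj U *m (y + zvec R m)) j 0) 0.
    have : \forall z \near y, (\adj U *m (z + zvec R m)) j 0 < 0.
      exact: (cvgr_lt _ (@continuous_adj_coord m j y)).
    by apply: filterS => z hz /(_ j) /andP[h1 _]; have := lt_trans h1 hz; rewrite ltxx.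
  have {h} h1 : 0 < (\adj U *m (y + zvec R m)) j 0 by rewrite lt_def g1.
  have h : u j < (\adj U *m (y + zvec R m)) j 0.
    by rewrite lt_def g2/= leNgt; apply/negP => h2; apply: hj; rewrite h1.
  have : \forall z \near y, u j < (\adj U *m (z + zvec R m)) j 0.
    exact: (cvgr_gt _ (@continuous_adj_coord m j y)).
  by apply: filterS => z hz /(_ j) /andP[_ h2]; have := lt_trans h2 hz; rewrite ltxx.
apply: filterS2 far near0 => z h1 h2; split => //.
move=> [m hm]; exfalso; have [mK|mK] := boolP (m \in Zbox d K).
  exact: (h2 m).
exact: (h1 m).
Unshelve. all: by end_near. Qed.

Lemma tbox_torus_near (y : 'cV[R]_d) :
  (forall (m : d.-tuple int) j, (\adj U *m (y + zvec R m)) j 0 != 0 /\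
     (\adj U *m (y + zvec R m)) j 0 != u j) ->
  exists2 del : R, 0 < del & forall z : 'cV[R]_d, \sum_i sin2 (y i 0 - z i 0) < del ->
     \1_(tbox u U) z = \1_(tbox u U) y :> R.
Proof.
move=> /near_tbox /nbhs_ballP[eps /= eps0 heps].
have [del del0 hdel] := sin2_near eps0.
exists del => // z hz.
have hi i : exists n : int, `|y i 0 - z i 0 - n%:~R| < eps.
  apply: hdel; apply: le_lt_trans hz; rewrite (bigD1 i)//= lerDl sumr_ge0// => k _.
  exact: sin2_ge0.
have [n hn] := choice hi.
pose m := [tuple n i | i < d].
have : tbox u U (z + zvec R m) <-> tbox u U y.
  apply: heps; split => // i j; rewrite (ord1 j) -ball_normE /= !mxE tnth_mktuple.
  by rewrite opprD addrA.
rewrite tbox_zvec => zy; rewrite !indicE; congr (_%:R); congr nat_of_bool.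
by apply/idP/idP => /set_mem h; apply/mem_set; apply/zy.
Qed.

End tbox_continuity.

(** * The discrepancy as a coboundary *)

Section bounded_convergence.
Context d (T : measurableType d) (R : realType) (mu : {measure set T -> \bar R}).

(** Dominated convergence for bounded functions on a set of finite measure,
    stated for real-valued integrals. *)
Lemma bounded_cvg (D : set T) (f_ : nat -> T -> R) (f : T -> R) (M : R) :
  measurable D -> (mu D < +oo)%E ->
  (forall n, measurable_fun setT (f_ n)) -> measurable_fun setT f ->
  (forall n t, `|f_ n t| <= M) ->
  {ae mu, forall t, D t -> f_ n t @[n --> \oo] --> f t} ->
  \int[mu]_(t in D) f_ n t @[n --> \oo] --> \int[mu]_(t in D) f t.
Proof.
move=> mD Doo mf_ mf fM cf.
have iM : mu.-integrable D (EFin \o (fun=> M)).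
  by apply: (bounded_integrable (M := `|M|)) => //; exact: measurable_cst.
have [|||||i1 _ h] := @dominated_convergence _ T R mu D mD (fun n => EFin \o f_ n)
    (EFin \o f) (EFin \o (fun=> M)).
- by move=> n; apply/measurable_EFinP; exact: measurable_funTS.
- by apply/measurable_EFinP; exact: measurable_funTS.
- by apply: filterS cf => t + Dt => /(_ Dt) ct; apply: cvg_EFin => //; exact: nearW.
- exact: iM.
- by apply: aeW => t n _ /=; rewrite lee_fin.
by apply: fine_cvg; rewrite fineK ?integrable_fin_num.
Qed.

Lemma ae_forall_countable (I : countType) (P : I -> T -> Prop) :
  (forall i, {ae mu, forall t, P i t}) -> {ae mu, forall t, forall i, P i t}.
Proof.
move=> h.
have : {ae mu, forall t, forall n : nat, if unpickle n is Some i then P i t else True}.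
  by apply: ae_foralln => n; case: (unpickle n) => [i|]; [exact: h|exact: aeW].
by apply: filterS => t ht i; have := ht (pickle i); rewrite pickleK.
Qed.

Lemma ae_sub (P Q : T -> Prop) : (forall t, P t -> Q t) ->
  {ae mu, forall t, P t} -> {ae mu, forall t, Q t}.
Proof. by move=> PQ; apply: filterS. Qed.

Lemma ae_sub2 (P Q S : T -> Prop) : (forall t, P t -> Q t -> S t) ->
  {ae mu, forall t, P t} -> {ae mu, forall t, Q t} -> {ae mu, forall t, S t}.
Proof. by move=> PQ; apply: filterS2. Qed.

End bounded_convergence.

Section measurable_tbox.
Context (R : realType) (d : nat).
Variable u : 'I_d -> R.

Lemma measurable_adj_entry (i j : 'I_d) : measurable_fun setT (fun U : 'M[R]_d => (\adj U) i j).
Proof.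
under eq_fun do rewrite mxE /cofactor.
apply: measurable_funM => //.
apply: measurable_sum => s; apply: measurable_funM => //.
apply: measurable_prod => k _; under eq_fun do rewrite !mxE.
exact: measurable_mx_entry.
Qed.

Lemma measurable_adj_coord (m : d.-tuple int) j : measurable_fun setT
  (fun w : 'M[R]_d * 'cV[R]_d => (\adj w.1 *m (w.2 + zvec R m)) j 0).
Proof.
under eq_fun do rewrite mxE.
apply: measurable_sum => i; apply: measurable_funM.
  exact: (measurableT_comp (measurable_adj_entry j i)).
under eq_fun do rewrite mxE.
apply: measurable_funD; last exact: measurable_cst.
exact: (measurableT_comp (measurable_mx_entry i 0)).
Qed.

Lemma measurable_tbox_pair :
  measurable [set w : 'M[R]_d * 'cV[R]_d | tbox u w.1 w.2].
Proof.
rewrite (_ : mkset _ = \bigcup_n (if @unpickle (d.-tuple int) n is Some m then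
   \bigcap_(j in [set: 'I_d]) ((fun w : 'M[R]_d * 'cV[R]_d => (\adj w.1 *m (w.2 + zvec R m)) j 0)
     @^-1` `]0, u j[) else classical_sets.set0)); last first.
  apply/seteqP; split => w /=.
    move=> [m hm]; exists (pickle m) => //; rewrite pickleK => j _ /=.
    by rewrite in_itv/=; exact: hm.
  by move=> [n _]; case: unpickle => // m hm; exists m => j; have := hm j I; rewrite /= in_itv.
apply: bigcup_measurable => n _; case: unpickle => // m.
apply: fin_bigcap_measurable => // j _.
by rewrite -[X in measurable X]setTI; exact: measurable_adj_coord.
Qed.

Lemma measurable_tbox U : measurable (tbox u U).
Proof.
rewrite (_ : tbox u U = (fun z => (U, z)) @^-1` [set w : 'M[R]_d * 'cV[R]_d | tbox u w.1 w.2])//.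
by rewrite -[X in measurable X]setTI; apply: measurable_pair1 => //; exact: measurable_tbox_pair.
Qed.

End measurable_tbox.

Section zero_frequency.
Context (R : realType) (d : nat).

Lemma nzE (k : d.-tuple int) : nz k = (k != [tuple 0 | _ < d]).
Proof.
apply/idP/idP => [/existsP[i ki]|]; first by apply: contraNneq ki => ->; rewrite tnth_mktuple.
apply: contraNT; rewrite negb_exists => /forallP h; apply/eqP/eq_from_tnth => i.
by rewrite tnth_mktuple; apply/eqP; have := h i; rewrite negbK.
Qed.

Lemma zdot0 (y : 'cV[R]_d) : zdot [tuple 0 | _ < d] y = 0.
Proof. by rewrite /zdot big1// => i _; rewrite tnth_mktuple mul0r. Qed.

Lemma fwt0 N : fwt R N.+1 [tuple 0 | _ < d] = 1.
Proof.
by rewrite /fwt big1// => i _; rewrite tnth_mktuple /fw normr0 subr0 divff// pnatr_eq0.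
Qed.

Lemma Zbox0 N : [tuple 0 | _ < d] \in Zbox d N.+1.
Proof. by apply/mem_Zbox => i; rewrite tnth_mktuple mem_irange; lia. Qed.

End zero_frequency.

Section line.
Context (R : realType) (d : nat).
Local Notation lam := (@lebesgue_measure R).

Lemma line_cos (a0 xi T : R) : 0 <= T -> xi != 0 ->
  \int[lam]_(t in `[0, T]) cos (a0 + xi * t) = (sin (a0 + xi * T) - sin a0) / xi.
Proof. by move=> T0 xi0; rewrite /Rintegral integral_cos_affine//= mulr0 addr0. Qed.

Lemma line_integrable (f : R -> R) (M T : R) : measurable_fun setT f ->
  (forall t, `|f t| <= M) -> lam.-integrable `[0, T] (EFin \o f).
Proof.
move=> mf fM; apply: (@bounded_integrable _ _ R lam _ f M) => //.
by rewrite /= lebesgue_measure_itv /=; case: ifP => // _; rewrite -EFinB ltry.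
Qed.

Lemma measurable_line (x w : 'cV[R]_d) : measurable_fun setT (fun t : R => x + t *: w).
Proof.
apply: measurable_fun_mx => i j; under eq_fun do rewrite !mxE.
by apply: measurable_funD => //; exact: measurable_funM.
Qed.

End line.

Section corrector.
Context (R : realType) (d : nat).
Local Notation lam := (@lebesgue_measure R).
Local Notation leb n := (@lebesgue_mx R n 1).
Local Notation cube d := (@unit_cube R d).
Variable u : 'I_d -> R.

(** The k-th term of the formal primitive along v of the Fourier series of
    the box. *)
Definition acoef (U : 'M[R]_d) (v y : 'cV[R]_d) (k : d.-tuple int) : R :=
  (fcos k \1_(tbox u U) * sin (2 * pi * zdot k y) -
   fsin k \1_(tbox u U) * cos (2 * pi * zdot k y)) / (2 * pi * zdot k v).

(** The sum of the series of the acoef, with an upper limit in place of a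
    limit: this makes it measurable in (U, v, y), including where the series
    diverges. *)
Definition corr (U : 'M[R]_d) (v y : 'cV[R]_d) : R :=
  fine (limn_esup (fun N => (fsum (acoef U v y) N)%:E)).

Variables (U : 'M[R]_d) (e : R).
Hypothesis u01 : forall j, 0 < u j < 1.
Hypothesis dU : \det U = 1.
Hypothesis nU : near1 U e.
Hypothesis e0 : 0 <= e.
Hypothesis e2 : e <= 2^-1 ^+ d / 2.
Hypothesis ue : forall j, u j + d%:R * e <= 1.
Variable v : 'cV[R]_d.
Hypothesis good : forall k, nz k -> (forall j, zrow k U j != 0) /\ zdot k v != 0.

Lemma acoef_le y k : nz k -> `|acoef U v y k| <= 2 ^+ d * bcoef U v k.
Proof.
move=> nk; have [g1 g2] := good nk.
have [h1 h2] := fourier_tbox_le u01 dU nU e0 e2 ue g1.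
have P0 : 0 <= \prod_j `|zrow k U j|^-1 by rewrite prodr_ge0// => j _; rewrite invr_ge0.
rewrite /acoef /bcoef normrM normfV normrM.
have pi2 : `|2 * pi| = 2 * pi :> R by rewrite ger0_norm// mulr_ge0// pi_ge0.
rewrite pi2 invfM mulrA [leRHS]mulrA ler_wpM2r ?invr_ge0//.
rewrite ler_pdivrMr ?mulr_gt0 ?pi_gt0//.
set Q := 2 ^+ d * _ in h1 h2 *.
have Q0 : 0 <= Q by rewrite mulr_ge0// exprn_ge0.
apply: (@le_trans _ _ (Q + Q)).
  apply: le_trans (ler_normB _ _) _; rewrite !normrM lerD//.
    by rewrite -[leRHS]mulr1 ler_pM// sin_max.
  by rewrite -[leRHS]mulr1 ler_pM// cos_max.
rewrite (_ : Q + Q = Q * 2); last by ring.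
by rewrite ler_wpM2l// ler_peMr// (le_trans _ (pi_ge2 R))// ler1n.
Qed.

Variable B : R.
Hypothesis sumB : forall N, \sum_(k <- Zbox d N | nz k) bcoef U v k <= B.

Let bB N : \sum_(k <- Zbox d N | nz k) 2 ^+ d * bcoef U v k <= 2 ^+ d * B.
Proof. by rewrite -mulr_sumr ler_wpM2l ?exprn_ge0. Qed.

Lemma corr_cvg y : fsum (acoef U v y) N @[N --> \oo] --> corr U v y.
Proof.
have cv := fsum_cvg bB (acoef_le y).
have cvE : (fsum (acoef U v y) N)%:E @[N --> \oo] --> (limn (fsum (acoef U v y)))%:E.
  by apply: cvg_EFin => //; exact: nearW.
rewrite /corr is_cvg_limn_esupE; last by apply: cvgP cvE.
by rewrite (cvg_lim _ cvE).
Qed.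

(** Each face is met by the line at most once, because the line is
    transversal to it, and there are countably many faces. *)
Lemma ae_generic (x : 'cV[R]_d) : (forall j, (\adj U *m v) j 0 != 0) ->
  {ae lam, forall t, forall (m : d.-tuple int) j,
     (\adj U *m (x + t *: v + zvec R m)) j 0 != 0 /\
     (\adj U *m (x + t *: v + zvec R m)) j 0 != u j}.
Proof.
move=> hv.
have single (m : d.-tuple int) j (c : R) : {ae lam, forall t,
    (\adj U *m (x + t *: v + zvec R m)) j 0 != c}.
  pose a := (\adj U *m (x + zvec R m)) j 0; pose b := (\adj U *m v) j 0.
  exists [set (c - a) / b]; split => //; first exact: lebesgue_measure_set1.
  move=> t /= /negP; rewrite negbK => /eqP ht.
  have : a + t * b = c.
    rewrite -ht (_ : x + t *: v + zvec R m = (x + zvec R m) + t *: v); last first.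
      by rewrite addrAC.
    rewrite mulmxDr -scalemxAr /a /b.
    by move: (\adj U *m (x + _)) (\adj U *m v) => V1 V2; rewrite !mxE.
  by move=> <-; rewrite addrAC subrr add0r mulfK//; exact: hv.
have : {ae lam, forall t, forall mj : d.-tuple int * 'I_d,
     (\adj U *m (x + t *: v + zvec R mj.1)) mj.2 0 != 0 /\
     (\adj U *m (x + t *: v + zvec R mj.1)) mj.2 0 != u mj.2}.
  apply: ae_forall_countable => -[m j].
  by apply: (ae_sub2 _ (single m j 0) (single m j (u j))) => t h1 h2.
by apply: ae_sub => t h m j; exact: (h (m, j)).
Qed.

(** The frequency 0 contributes the constant term, every other frequency is
    integrated explicitly. *)
Lemma integral_fejer_line (x : 'cV[R]_d) T N : 0 <= T ->
  \int[lam]_(t in `[0, T]) fejer N.+1 \1_(tbox u U) (x + t *: v) =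
  T * fcos [tuple 0 | _ < d] \1_(tbox u U) +
  (fsum (acoef U v (x + T *: v)) N.+1 - fsum (acoef U v x) N.+1).
Proof.
move=> T0; set g := \1_(tbox u U).
have mline := measurable_line x v.
have mI : measurable (`[0, T]%classic : set R) by exact: measurable_itv.
have ic1 k : lam.-integrable `[0, T] (EFin \o (fun t : R => cos (2 * pi * zdot k (x + t *: v)))).
  apply: (line_integrable (M := 1)).
    exact: (measurableT_comp (measurable_cos_zdot k) mline).
  by move=> t; exact: cos_max.
have is1 k : lam.-integrable `[0, T] (EFin \o (fun t : R => sin (2 * pi * zdot k (x + t *: v)))).
  apply: (line_integrable (M := 1)).
    exact: (measurableT_comp (measurable_sin_zdot k) mline).
  by move=> t; exact: sin_max.
have ic k c : lam.-integrable `[0, T] (EFin \o (fun t : R => c * cos (2 * pi * zdot k (x + t *: v)))).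
  by exact: integrable_scale.
have is_ k c : lam.-integrable `[0, T] (EFin \o (fun t : R => c * sin (2 * pi * zdot k (x + t *: v)))).
  by exact: integrable_scale.
pose F k (t : R) := fcos k g * cos (2 * pi * zdot k (x + t *: v)) +
  fsin k g * sin (2 * pi * zdot k (x + t *: v)).
have iF k : lam.-integrable `[0, T] (EFin \o F k) by exact: integrable_add.
have -> : \int[lam]_(t in `[0, T]) fejer N.+1 g (x + t *: v) =
    \int[lam]_(t in `[0, T]) \sum_(k <- Zbox d N.+1) fwt R N.+1 k * F k t.
  apply: eq_Rintegral => t _; apply: eq_bigr => k _; rewrite /F.
  by congr (_ * (_ + _)); rewrite mulrC.
rewrite Rintegral_sum_seq//; last by move=> k; exact: integrable_scale.
rewrite (bigD1_seq [tuple 0 | _ < d]) ?Zbox_uniq ?Zbox0//=; congr (_ + _).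
  rewrite fwt0; under eq_Rintegral do rewrite mul1r /F zdot0 mulr0 cos0 sin0 mulr0 addr0 mulr1.
  rewrite Rintegral_cst//= lebesgue_measure_itv/= lte_fin.
  case: ltP => [_|h]; first by rewrite sube0 /= mulrC.
  by rewrite (_ : T = 0) ?mulr0 ?mul0r//; apply/eqP; rewrite eq_le T0 h.
rewrite /fsum -sumrB; under eq_bigl do rewrite -nzE.
apply: eq_bigr => k nk; rewrite -mulrBr RintegralZl//; congr (_ * _).
rewrite /F RintegralD// !RintegralZl//.
have xi0 : 2 * pi * zdot k v != 0.
  by rewrite mulf_neq0 ?(good nk).2// mulf_neq0// gt_eqF// pi_gt0.
have zE t : 2 * pi * zdot k (x + t *: v) = 2 * pi * zdot k x + 2 * pi * zdot k v * t.
  by rewrite zdotD zdotZ; ring.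
under eq_Rintegral do rewrite zE.
rewrite line_cos// -zE.
have -> : \int[lam]_(t in `[0, T]) sin (2 * pi * zdot k (x + t *: v)) =
    \int[lam]_(t in `[0, T]) cos ((2 * pi * zdot k x - pi / 2) + 2 * pi * zdot k v * t).
  apply: eq_Rintegral => t _; rewrite zE addrAC cosB cos_pihalf sin_pihalf mulr0 add0r.
  by rewrite mulr1.
rewrite line_cos// addrAC -zE /acoef -/g.
have sE (a : R) : sin (a - pi / 2) = - cos a.
  by rewrite sinB cos_pihalf sin_pihalf mulr0 mulr1 sub0r.
rewrite !sE; ring.
Qed.

Lemma fcos0_tbox : fcos [tuple 0 | _ < d] \1_(tbox u U) = torus_vol (mx_box u U).
Proof.
rewrite /fcos /torus_vol (tboxE u dU) -(integral_indic (@lebesgue_mx R d 1) (@measurable_cube R d) (measurable_tbox u U)).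
rewrite /Rintegral; congr fine; apply: eq_integral => z _.
by rewrite zdot0 mulr0 cos0 mul1r.
Qed.

(** Pass to the limit in integral_fejer_line: the Fejer means stay bounded
    and converge to the indicator at every time at which the orbit avoids the
    faces, while the right-hand side converges by absolute summability. *)
Lemma discrepancy_corr (x : 'cV[R]_d) T : 0 <= T -> (forall j, (\adj U *m v) j 0 != 0) ->
  discrepancy v x (mx_box u U) T = corr U v (x + T *: v) - corr U v x.
Proof.
move=> T0 hv; rewrite /discrepancy -fcos0_tbox (tboxE u dU).
have mt := measurable_tbox u U.
have Too : (lam `[0%R, T]%classic < +oo)%E.
  by rewrite /= lebesgue_measure_itv /=; case: ifP => // _; rewrite -EFinB ltry.
pose g : 'cV[R]_d -> R := \1_(tbox u U).
have mg : measurable_fun setT g by exact: measurable_indic.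
have g1 z : `|g z| <= 1 by rewrite /g indicE; case: (_ \in _); rewrite ?normr1 ?normr0.
pose C : R := 1 + (2 + 2 * 1 * d%:R / 1).
have fC n y : `|fejer n.+1 g y| <= C.
  have := @fejer_approx R d n g 1 y 2 1 mg g1 (ler0n _ _) ltr01.
  have h (z : 'cV[R]_d) : \sum_i sin2 (y i 0 - z i 0) < 1 -> `|g z - g y| <= 2.
    by move=> _; rewrite (le_trans (ler_normB _ _))// -[2]/(1+1) lerD.
  move=> /(_ h) h1; rewrite -[fejer _ _ _](subrK (g y)) addrC (le_trans (ler_normD _ _))// /C.
  apply: lerD => //; apply: le_trans h1 _; rewrite lerD2l ler_wpM2l ?mulr_ge0//.
  by rewrite lef_pV2 ?posrE ?mul1r ?ltr0n// ler1n.
have mline := measurable_line x v.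
have cv : \int[lam]_(t in `[0, T]) fejer n.+1 g (x + t *: v) @[n --> \oo] -->
    \int[lam]_(t in `[0, T]) g (x + t *: v).
  apply: (bounded_cvg (M := C)) => //.
  - move=> n; rewrite /fejer; apply: measurable_sum => k; apply: measurable_funM => //.
    apply: measurable_funD; apply: measurable_funM => //.
      exact: (measurableT_comp (measurable_cos_zdot k) mline).
    exact: (measurableT_comp (measurable_sin_zdot k) mline).
  - exact: (measurableT_comp mg mline).
  - apply: (ae_sub _ (ae_generic x hv)) => t ht _.
    have [del del0 hdel] := tbox_torus_near u01 dU nU ue ht.
    have h n : `|fejer n.+1 g (x + t *: v) - g (x + t *: v)| <= 2 * 1 * d%:R / (del * n.+1%:R).
      rewrite -[leRHS]add0r; apply: fejer_approx => // z hz.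
      by rewrite /g hdel// subrr normr0.
    apply/cvgrPdist_le => eps eps0.
    have cinv : 2 * 1 * d%:R / del * n.+1%:R^-1 @[n --> \oo] --> (2 * 1 * d%:R / del * 0 : R).
      by apply: cvgM; [exact: cvg_cst|exact: cvg_harmonic].
    rewrite mulr0 in cinv; move/cvgr0_norm_le : cinv => /(_ _ eps0).
    apply: filterS => n hn; rewrite distrC (le_trans (h n))//.
    by rewrite invfM mulrA (le_trans (ler_norm _)).
have cv2 : T * fcos [tuple 0 | _ < d] g +
    (fsum (acoef U v (x + T *: v)) n.+1 - fsum (acoef U v x) n.+1) @[n --> \oo] -->
    T * fcos [tuple 0 | _ < d] g + (corr U v (x + T *: v) - corr U v x).
  apply: cvgD; first exact: cvg_cst.
  apply: cvgB.
    by rewrite (cvg_shiftS (fsum _)); exact: corr_cvg.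
  by rewrite (cvg_shiftS (fsum _)); exact: corr_cvg.
have cvE : (fun n => \int[lam]_(t in `[0, T]) fejer n.+1 g (x + t *: v)) =
  (fun n => T * fcos [tuple 0 | _ < d] g +
    (fsum (acoef U v (x + T *: v)) n.+1 - fsum (acoef U v x) n.+1)).
  by apply/funext => n; rewrite integral_fejer_line.
rewrite cvE in cv.
have -> := cvg_unique _ cv cv2; first by rewrite addrAC subrr add0r.
exact: norm_hausdorff.
Qed.

End corrector.

(** * The Riemann-Lebesgue lemma *)

Section hilbert.
Context d (T : measurableType d) (R : realType) (mu : {measure set T -> \bar R}).

Section bounded_case.
Variables (D : set T) (c : nat -> T -> R).
Hypothesis mD : measurable D.
Hypothesis Doo : (mu D < +oo)%E.
Hypothesis mc : forall n, measurable_fun setT (c n).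
Hypothesis c1 : forall n t, `|c n t| <= 1.
Hypothesis gram : forall n, \int[mu]_(t in D) (c n t * c p t) @[p --> \oo] --> (0 : R).

Let W : R := fine (mu D) + 1.

Let W0 : 0 < W. Proof. by rewrite ltr_wpDl// fine_ge0. Qed.

Let bi (f : T -> R) M : measurable_fun setT f -> (forall t, `|f t| <= M) ->
  mu.-integrable D (EFin \o f).
Proof. exact: bounded_integrable. Qed.

Let bad (eps : R) (a : T -> R) := forall e', e' < eps -> forall N, exists2 p,
  (N <= p)%N & e' <= `|\int[mu]_(t in D) (a t * c p t)|.

Let energy (eps : R) k : 0 < eps -> forall (a : T -> R) M, measurable_fun setT a ->
  (forall t, `|a t| <= M) -> bad eps a ->
  k%:R * (eps ^+ 2 / (4 * W)) <= \int[mu]_(t in D) (a t ^+ 2).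
Proof.
move=> eps0; elim: k => [|k IH] a M ma aM ba.
  by rewrite mul0r; apply: Rintegral_ge0 => t _; exact: sqr_ge0.
have [p _ hp] := ba (eps / 2) ltac:(lra) 0%N.
set x := \int[mu]_(t in D) _ in hp.
(* The coefficient x / W of the subtracted c_p lowers the energy by at least
   x ^+ 2 / W, because the square of c_p has integral at most W. *)
pose s := x / W; pose a' t := a t - s * c p t.
have ma' : measurable_fun setT a' by apply: measurable_funB => //; exact: measurable_funM.
have a'M t : `|a' t| <= M + `|s|.
  apply: le_trans (ler_normB _ _) _; rewrite lerD// normrM -[leRHS]mulr1.
  by rewrite ler_wpM2l.
have iac q : mu.-integrable D (EFin \o (fun t => a t * c q t)).
  apply: (@bi _ (M * 1)); first exact: measurable_funM.
  by move=> t; rewrite normrM ler_pM.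
have icc q : mu.-integrable D (EFin \o (fun t => c p t * c q t)).
  apply: (@bi _ (1 * 1)); first exact: measurable_funM.
  by move=> t; rewrite normrM ler_pM.
have iaa : mu.-integrable D (EFin \o (fun t => a t ^+ 2)).
  apply: (@bi _ (M * M)); first exact: measurable_funX.
  by move=> t; rewrite expr2 normrM ler_pM.
have E q : \int[mu]_(t in D) (a' t * c q t) =
    \int[mu]_(t in D) (a t * c q t) - s * \int[mu]_(t in D) (c p t * c q t).
  rewrite -RintegralZl// -RintegralB//; last exact: integrable_scale.
  by apply: eq_Rintegral => t _; rewrite /a' mulrBl mulrA.
have ba' : bad eps a'.
  move=> e' e'eps N; have de : 0 < (eps - e') / 2 by lra.
  have h : - s * \int[mu]_(t in D) (c p t * c q t) @[q --> \oo] --> (- s * 0 : R).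
    by apply: cvgM; [exact: cvg_cst|exact: gram].
  rewrite mulr0 in h; move/cvgr0_norm_le : h => /(_ _ de) [N1 _ hN1].
  have [q] := ba ((e' + eps) / 2) ltac:(lra) (maxn N N1).
  rewrite geq_max => /andP[Nq N1q] hq; exists q => //.
  have := hN1 q N1q; rewrite /= E => h1.
  set X := \int[mu]_(t in D) (a t * c q t) in hq *.
  set Y := _ * \int[mu]_(t in D) (c p t * c q t) in h1.
  rewrite (_ : X - _ = X + Y); last by rewrite /Y mulNr.
  have h2 := ler_normB (X + Y) Y; rewrite addrK in h2.
  lra.
have := IH a' _ ma' a'M ba'.
have -> : \int[mu]_(t in D) (a' t ^+ 2) = \int[mu]_(t in D) (a t ^+ 2) - (2 * s) * x
   + s ^+ 2 * \int[mu]_(t in D) (c p t * c p t).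
  rewrite -!RintegralZl// -RintegralB//; last exact: integrable_scale.
  rewrite -RintegralD//; last 2 first.
  - rewrite (_ : _ \o _ = EFin \o (fun t => a t ^+ 2 + (- (2 * s)) * (a t * c p t))).
      by apply: integrable_add => //; exact: integrable_scale.
    by apply/funext => t /=; rewrite mulNr.
  - exact: integrable_scale.
  by apply: eq_Rintegral => t _; rewrite /a'; ring.
have cW : \int[mu]_(t in D) (c p t * c p t) <= W.
  apply: (@le_trans _ _ (\int[mu]_(t in D) (cst 1 t))).
    apply: le_Rintegral => //; first by apply: (@bi _ 1) => // t; rewrite normr1.
    by move=> t _; rewrite /= (le_trans (ler_norm _))// normrM -[leRHS]mulr1 ler_pM.
  by rewrite Rintegral_cst// mul1r lerDl.
have s2 : s ^+ 2 * \int[mu]_(t in D) (c p t * c p t) <= s * x.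
  apply: (@le_trans _ _ (s ^+ 2 * W)); first by rewrite ler_wpM2l// sqr_ge0.
  by rewrite expr2 -mulrA {2}/s divfK// gt_eqF.
have x2 : eps ^+ 2 / (4 * W) <= s * x.
  have -> : s * x = `|x| ^+ 2 / W by rewrite real_normK ?num_real// /s; ring.
  rewrite invfM mulrA ler_wpM2r ?invr_ge0 ?(ltW W0)//.
  have : (eps / 2) ^+ 2 <= `|x| ^+ 2 by rewrite lerXn2r// nnegrE; lra.
  by rewrite expr_div_n; lra.
move: s2 x2; set Q := eps ^+ 2 / (4 * W).
have -> : k.+1%:R * Q = k%:R * Q + Q by rewrite -[LHS]/(k.+1%:R * Q) -[k.+1]addn1 natrD mulrDl mul1r.
set S := s ^+ 2 * _.
rewrite (_ : 2 * s * x = 2 * (s * x)); last by rewrite mulrA.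
set Z := s * x; set k' := k%:R * Q; lra.
Qed.

(** Asymptotically orthogonal bounded functions tend weakly to 0. If the
    integrals against a do not tend to 0, subtracting from a a suitable
    multiple of some c_p lowers the energy of a by a fixed amount, and by
    asymptotic orthogonality it does not change the limsup of the integrals.
    Iterating makes the energy negative. *)
Lemma hilbert_cvg (a : T -> R) M : measurable_fun setT a -> (forall t, `|a t| <= M) ->
  \int[mu]_(t in D) (a t * c p t) @[p --> \oo] --> (0 : R).
Proof.
move=> ma aM; apply/cvgrPdist_le => eps eps0.
have [[N hN]|h] := pselect (exists N, forall p, (N <= p)%N ->
    `|\int[mu]_(t in D) (a t * c p t)| <= eps).
  by exists N => // p Np; rewrite sub0r normrN; exact: hN.
exfalso; have ba : bad eps a.
  move=> e' e'eps N; apply: contrapT => h1; apply: h; exists N => p Np.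
  rewrite leNgt; apply/negP => h2; apply: h1; exists p => //.
  by rewrite ltW// (lt_trans e'eps).
pose Q := eps ^+ 2 / (4 * W).
have Q0 : 0 < Q by rewrite divr_gt0 ?exprn_gt0 ?mulr_gt0.
have := energy (Num.bound ((\int[mu]_(t in D) (a t ^+ 2)) / Q)) eps0 ma aM ba.
rewrite leNgt => /negP; apply; rewrite -ltr_pdivrMr//; apply: archi_boundP.
by rewrite divr_ge0 ?(ltW Q0)//; apply: Rintegral_ge0 => t _; exact: sqr_ge0.
Qed.

End bounded_case.

(** Extension to integrable functions by truncating both the values and the
    domain. *)
Lemma hilbert_integrable (D : nat -> set T) (c : nat -> T -> R) (a : T -> R) :
  (forall M, measurable (D M)) -> (forall M, mu (D M) < +oo)%E ->
  (forall t, exists M0, forall M, (M0 <= M)%N -> D M t) ->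
  (forall n, measurable_fun setT (c n)) -> (forall n t, `|c n t| <= 1) ->
  (forall M n, \int[mu]_(t in D M) (c n t * c p t) @[p --> \oo] --> (0 : R)) ->
  measurable_fun setT a -> mu.-integrable setT (EFin \o a) ->
  \int[mu]_t (a t * c p t) @[p --> \oo] --> (0 : R).
Proof.
move=> mD Doo cover mc c1 gram ma ia.
pose E M := [set t | `|a t| <= M%:R].
have mE M : measurable (E M).
  rewrite (_ : E M = (fun t => `|a t|) @^-1` `]-oo, M%:R]).
    rewrite -[X in measurable X]setTI.
    by apply: (measurableT_comp (@normr_measurable R setT) ma).
  by apply/seteqP; split => t; rewrite /E /= in_itv.
pose b M t : R := a t * \1_(E M) t.
have mb M : measurable_fun setT (b M) by apply: measurable_funM => //; exact: measurable_indic.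
have bM M t : `|b M t| <= M%:R.
  rewrite /b indicE; case: (boolP (t \in E M)) => [/set_mem h|_]; first by rewrite mulr1.
  by rewrite mulr0 normr0.
pose r M t : R := a t - b M t * \1_(D M) t.
have mr M : measurable_fun setT (r M).
  by apply: measurable_funB => //; apply: measurable_funM => //; exact: measurable_indic.
have ra M t : `|r M t| <= `|a t|.
  by rewrite /r /b !indicE; case: (_ \in _); case: (_ \in _);
    rewrite /= ?mulr1 ?mulr0 ?mul0r ?subr0 ?subrr ?normr0.
have ir M : mu.-integrable setT (EFin \o r M).
  apply: (le_integrable _ _ _ ia) => //; first exact/measurable_EFinP.
  by move=> t _ /=; rewrite lee_fin.
have cr : \int[mu]_t `|r M t| @[M --> \oo] --> (0 : R).
  have [|||||_ _ h] := @dominated_convergence _ T R mu setT measurableT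
      (fun M t => (`|r M t|)%:E) (fun=> 0%E) (fun t => `|(a t)%:E|)%E.
  - by move=> M; apply/measurable_EFinP; exact: measurableT_comp.
  - exact: measurable_cst.
  - apply: aeW => t _; have [M0 hM0] := cover t.
    apply: (cvg_near_cst); near=> M.
    rewrite (_ : r M t = 0) ?normr0// /r /b !indicE !mem_set ?mulr1 ?subrr//.
      by apply: hM0; near: M; exact: nbhs_infty_ge.
    rewrite /E /= (le_trans (ltW (archi_boundP (normr_ge0 (a t)))))// ler_nat.
    by near: M; exact: nbhs_infty_ge.
  - exact: integrable_abse ia.
  - by apply: aeW => t M _ /=; rewrite lee_fin normr_id.
  by apply: fine_cvg; rewrite integral0 in h.
apply/cvgrPdist_le => eps eps0.
have e2 : 0 < eps / 2 by lra.
move/cvgr0_norm_le : cr => /(_ _ e2) [M _ hM].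
have {hM} hM : \int[mu]_t `|r M t| <= eps / 2.
  by apply: le_trans (ler_norm _) _; exact: (hM M (leqnn M)).
have := hilbert_cvg (mD M) (Doo M) mc c1 (gram M) (mb M) (bM M).
move/cvgr0_norm_le => /(_ _ e2); apply: filterS => p hp.
have irc : mu.-integrable setT (EFin \o (fun t => r M t * c p t)).
  apply: (le_integrable _ _ _ ia) => //.
    by apply/measurable_EFinP; exact: measurable_funM.
  by move=> t _ /=; rewrite lee_fin normrM -[leRHS]mulr1 ler_pM.
have ib : mu.-integrable (D M) (EFin \o (fun t => b M t * c p t)).
  apply: (@bounded_integrable _ _ _ _ _ _ (M%:R * 1)) => //; first exact: measurable_funM.
  by move=> t; rewrite normrM ler_pM.
have -> : \int[mu]_t (a t * c p t) =
    \int[mu]_t (r M t * c p t) + \int[mu]_(t in D M) (b M t * c p t).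
  rewrite [X in _ + X]Rintegral_mkcond -RintegralD//.
    apply: eq_Rintegral => t _; rewrite patchE /r indicE.
    have pt0 : (point : R) = 0 by [].
    by case: (t \in D M); rewrite /= ?pt0; ring.
  by rewrite -restrict_EFin; apply/integrable_restrict => //; rewrite setTI.
rewrite sub0r normrN; apply: le_trans (ler_normD _ _) _.
rewrite (_ : eps = eps / 2 + eps / 2); last by lra.
apply: lerD => //; apply: le_trans hM.
apply: le_trans (le_normr_Rintegral measurableT irc) _.
apply: le_Rintegral => //.
- by have := integrable_norm irc.
- by have := integrable_norm (ir M).
by move=> t _; rewrite normrM -[leRHS]mulr1 ler_pM.
Unshelve. all: by end_near. Qed.

End hilbert.

Section oscillation.
Context (R : realType).
Local Notation lam := (@lebesgue_measure R).
Local Notation leb n := (@lebesgue_mx R n 1).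

Lemma ibox_ccons n (M s : R) (y : 'cV[R]_n) :
  (ccons s y \in @ibox R n.+1 M) = (s \in `[- M, M]) && (y \in @ibox R n M).
Proof.
apply/idP/andP => [/set_mem h|[h1 /set_mem h2]].
  split; first by have := h ord0; rewrite ccons0.
  by apply/mem_set => i; have := h (lift ord0 i); rewrite cconsS.
apply/mem_set => i; case: (unliftP ord0 i) => [j ->|->].
  by rewrite cconsS; exact: h2.
by rewrite ccons0.
Qed.

Lemma measurable_cos_sum n (k : 'I_n -> R) th s :
  measurable_fun setT (fun z : 'cV[R]_n => cos (th + s * \sum_i k i * z i 0)).
Proof.
apply: (measurableT_comp (continuous_measurable_fun (@continuous_cos R))).
apply: measurable_funD => //; apply: measurable_funM => //.
apply: measurable_sum => i; apply: measurable_funM => //; exact: measurable_mx_entry.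
Qed.

(** Integrate the variable with nonzero frequency; the variables before it
    only contribute their interval lengths. *)
Lemma cos_ibox_le n (M : R) (k : 'I_n -> R) : 0 <= M -> (exists i, k i != 0) ->
  exists2 C : R, 0 <= C & forall th s, s != 0 ->
  (`| \int[leb n]_(z in ibox M) (cos (th + s * \sum_i k i * z i 0))%:E | <= (C / `|s|)%:E)%E.
Proof.
move=> M0; have NM : - M <= M by lra.
elim: n k => [|n IH] k [i ki]; first by case: i ki => [[]].
have mI m := @measurable_ibox R m M.
have bI m := @lebesgue_ibox_lty R m M.
have ic th s : (leb n.+1).-integrable setT
    ((fun z : 'cV[R]_n.+1 => (cos (th + s * \sum_i k i * z i 0))%:E) \_ (ibox M)).
  apply/integrable_restrict; [exact: mI|exact: measurableT|rewrite setTI].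
  apply: (bounded_integrable (mI _) (bI _) (measurable_cos_sum _ _ _)) => z.
  exact: cos_max.
pose k' i := k (lift ord0 i).
have sumE s t (y : 'cV[R]_n) : s * \sum_i k i * ccons t y i 0 =
    s * k ord0 * t + s * \sum_i k' i * y i 0.
  rewrite big_ord_recl ccons0 mulrDr mulrA; congr (_ + s * _).
  by apply: eq_bigr => j _; rewrite cconsS.
have [k0|k0] := eqVneq (k ord0) 0.
  have [|C C0 hC] := IH k'.
    case: (unliftP ord0 i) ki => [j ->|->]; first by exists j.
    by rewrite k0 eqxx.
  exists (C * (M - - M)); first by rewrite mulr_ge0//; lra.
  move=> th s s0; rewrite integral_mkcond integral_colS1//.
  set I := (\int[leb n]_(z in ibox M) (cos (th + s * \sum_i k' i * z i 0))%:E)%E.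
  have -> : (\int[lam]_t \int[leb n]_y (((fun z : 'cV[R]_n.+1 =>
      (cos (th + s * \sum_i k i * z i 0))%:E) \_ (ibox M)) (ccons t y)) =
      \int[lam]_(t in [set` `[(- M)%R, M]]) I)%E.
    rewrite [RHS]integral_mkcond; apply: eq_integral => t _; rewrite patchE.
    have -> : (t \in [set` `[- M, M]]) = (t \in `[- M, M]) by rewrite mem_setE.
    case: ifPn => ht.
      rewrite /I [RHS]integral_mkcond; apply: eq_integral => y _.
      by rewrite !patchE ibox_ccons ht/= sumE k0 mulr0 mul0r add0r.
    by apply: integral0_eq => y _; rewrite patchE ibox_ccons (negbTE ht).
  have If : I \is a fin_num.
    apply: integrable_fin_num; first exact: mI.
    apply: (bounded_integrable (mI _) (bI _) (measurable_cos_sum _ _ _)) => z.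
    exact: cos_max.
  have := hC th s s0; rewrite -/I -(fineK If) => hI.
  rewrite integral_cst//= lebesgue_measure_itv/=.
  have -> : (if (- M)%:E < M%:E then M%:E - (- M)%:E else 0)%E = (M - - M)%:E :> \bar R.
    rewrite lte_fin; case: ltP => // h; congr EFin; lra.
  rewrite -EFinM /= lee_fin in hI *.
  have MM : 0 <= M - - M by lra.
  rewrite lee_fin normrM (ger0_norm MM) (mulrAC C); exact: ler_wpM2r.
exists (2 / `|k ord0| * fine (leb n (ibox M))).
  by rewrite mulr_ge0 ?divr_ge0 ?fine_ge0.
move=> th s s0; rewrite integral_mkcond integral_colS2//.
pose J (y : 'cV[R]_n) : R := (sin ((th + s * \sum_i k' i * y i 0) + s * k ord0 * M) -
   sin ((th + s * \sum_i k' i * y i 0) + s * k ord0 * (- M))) / (s * k ord0).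
have sk0 : s * k ord0 != 0 by rewrite mulf_neq0.
have -> : (\int[leb n]_y \int[lam]_t (((fun z : 'cV[R]_n.+1 =>
      (cos (th + s * \sum_i k i * z i 0))%:E) \_ (ibox M)) (ccons t y)) =
      \int[leb n]_(y in ibox M) (J y)%:E)%E.
  rewrite [RHS]integral_mkcond; apply: eq_integral => y _; rewrite patchE.
  case: ifPn => hy.
    rewrite /J -integral_cos_affine// [RHS]integral_mkcond; apply: eq_integral => t _.
    rewrite !patchE ibox_ccons hy andbT mem_setE; case: ifP => // _.
    by rewrite sumE addrCA addrC.
  by apply: integral0_eq => t _; rewrite patchE ibox_ccons (negbTE hy) andbF.
have mJ : measurable_fun setT J.
  apply: measurable_funM => //.
  apply: measurable_funB; (apply: (measurableT_comp (continuous_measurable_fun (@continuous_sin R)));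
    apply: measurable_funD => //; apply: measurable_funD => //; apply: measurable_funM => //;
    apply: measurable_sum => j; apply: measurable_funM => //; exact: measurable_mx_entry).
have JB y : `|J y| <= 2 / `|s * k ord0|.
  rewrite normrM normfV ler_wpM2r ?invr_ge0// (le_trans (ler_normB _ _))//.
  by rewrite -[2]/(1 + 1) lerD ?sin_max.
have mJE : measurable_fun (ibox M) (EFin \o J) by apply/measurable_EFinP; exact: measurable_funTS.
apply: le_trans (le_abse_integral _ (mI n) mJE) _.
apply: le_trans (integral_le_bound (2 / `|s * k ord0|)%:E (mI n) mJE _ _) _.
- by rewrite lee_fin divr_ge0.
- by apply: aeW => y _ /=; rewrite lee_fin.
apply: (@le_trans _ _ ((2 / `|s * k ord0|)%:E * (fine (leb n (ibox M)))%:E)%E).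
  by rewrite fineK// ge0_fin_numE.
rewrite -EFinM lee_fin normrM invfM.
by rewrite le_eqVlt; apply/orP; left; apply/eqP; ring.
Qed.

End oscillation.

Section riemann_lebesgue.
Context (R : realType).
Local Notation leb n := (@lebesgue_mx R n 1).

Section oscillation_prod.
Context d1 (T1 : measurableType d1) (m1 : {sigma_finite_measure set T1 -> \bar R}).
Variables (E : set T1) (n : nat) (M : R) (k : 'I_n -> R).
Hypotheses (mE : measurable E) (Eoo : (m1 E < +oo)%E) (M0 : 0 <= M)
  (k0 : exists i, k i != 0).
Local Notation mu := (sfprod m1 (leb n)).
Local Notation box := (E `*` @ibox R n M).

Lemma measurable_box_prod : measurable box.
Proof. by apply: measurableX => //; exact: measurable_ibox. Qed.

Lemma lebesgue_box_prod_lty : (mu box < +oo)%E.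
Proof.
rewrite /sfprod /= product_measure1E//; last exact: measurable_ibox.
by rewrite lte_mul_pinfty ?ge0_fin_numE ?lebesgue_ibox_lty.
Qed.

Lemma osc_prod : exists2 C : R, 0 <= C & forall (phi : T1 -> R) s,
  measurable_fun setT phi -> s != 0 ->
  `|\int[mu]_(w in box) cos (phi w.1 + s * \sum_i k i * w.2 i 0)| <= C / `|s|.
Proof.
have [C C0 hC] := cos_ibox_le M0 k0.
exists (C * fine (m1 E)); first by rewrite mulr_ge0// fine_ge0.
move=> phi s mphi s0.
have mb := measurable_box_prod.
pose f (w : T1 * 'cV[R]_n) : R := cos (phi w.1 + s * \sum_i k i * w.2 i 0).
have mf : measurable_fun setT f.
  apply: (measurableT_comp (continuous_measurable_fun (@continuous_cos R))).
  apply: measurable_funD; first exact: (measurableT_comp mphi).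
  apply: measurable_funM => //; apply: measurable_sum => i; apply: measurable_funM => //.
  exact: (measurableT_comp (measurable_mx_entry i 0)).
have f1 w : `|f w| <= 1 by exact: cos_max.
have if_ : mu.-integrable box (EFin \o f).
  exact: (bounded_integrable mb lebesgue_box_prod_lty mf f1).
have if' : (m1 \x leb n)%E.-integrable setT ((EFin \o f) \_ box).
  by apply/integrable_restrict => //; rewrite setTI.
have step : (\int[mu]_(w in box) (EFin \o f) w =
    \int[m1]_p \int[leb n]_y ((EFin \o f) \_ box) (p, y))%E.
  by rewrite integral_mkcond -(integral12_prod_meas1 if').
have inner p : (`|\int[leb n]_y ((EFin \o f) \_ box) (p, y)| <= ((C / `|s|)%:E * (\1_E p)%:E))%E.
  rewrite indicE; have [pE|pE] := boolP (p \in E); last first.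
    rewrite mule0 (_ : (\int[leb n]_y _ = 0)%E) ?abse0//.
    apply: integral0_eq => y _; rewrite patchE; case: ifPn => // /set_mem[/= h _].
    by case/negP : pE; exact/mem_set.
  rewrite mule1; apply: le_trans (hC (phi p) s s0).
  rewrite [in leRHS]integral_mkcond le_eqVlt; apply/orP; left; apply/eqP; congr (`|_|)%E.
  apply: eq_integral => y _; rewrite !patchE; congr (if _ then _ else _).
  apply/idP/idP => /set_mem h; apply/mem_set; first by case: h.
  by split => //=; exact: set_mem.
rewrite -lee_fin /Rintegral.
have fin := integrable_fin_num mb if_.
rewrite -[X in (X <= _)%E]/(`|(fine (\int[mu]_(w in box) (EFin \o f) w))%:E|)%E fineK// step.
have mF : measurable_fun setT (fun p => \int[leb n]_y ((EFin \o f) \_ box) (p, y))%E.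
  exact: measurable_fubini_F if'.
apply: le_trans (le_abse_integral _ measurableT mF) _.
apply: (@le_trans _ _ (\int[m1]_p ((C / `|s|)%:E * (\1_E p)%:E))%E).
  apply: ge0_le_integral => //.
  - exact: measurableT_comp.
  - by apply: emeasurable_funM => //; apply/measurable_EFinP; exact: measurable_indic.
rewrite ge0_integralZl//; last 2 first.
- by apply/measurable_EFinP; exact: measurable_indic.
- by rewrite lee_fin divr_ge0.
rewrite integral_indic// setIT mulrAC [leRHS]EFinM fineK// ge0_fin_numE//.
Qed.

Lemma osc_prod_cvg (phi : T1 -> R) (s : nat -> R) : measurable_fun setT phi ->
  (forall K, \forall p \near \oo, K <= `|s p|) ->
  \int[mu]_(w in box) cos (phi w.1 + s p * \sum_i k i * w.2 i 0) @[p --> \oo] --> (0 : R).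
Proof.
move=> mphi hs; have [C C0 hC] := osc_prod.
apply/cvgrPdist_le => eps eps0; have := hs (C / eps + 1).
apply: filterS => p hp; rewrite sub0r normrN.
have K0 : 0 < C / eps + 1 by rewrite ltr_wpDl// divr_ge0// ltW.
have s0 : s p != 0 by rewrite -normr_gt0 (lt_le_trans K0).
apply: le_trans (hC _ _ mphi s0) _; rewrite ler_pdivrMr ?normr_gt0//.
apply: (@le_trans _ _ (eps * (C / eps + 1))); last by rewrite ler_wpM2l// ltW.
by rewrite mulrDr mulrCA divff ?gt_eqF// mulr1 lerDl mulr1 ltW.
Qed.

End oscillation_prod.

Variable d : nat.
Local Notation mu2 := (sfprod (@haar_SL R d) (leb d)).
Local Notation mu := (sfprod mu2 (leb d)).

Lemma measurable_phase (k : d.-tuple int) (th t : R) :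
  measurable_fun setT (fun w : sample_space R d => cos (th + 2 * pi * zdot k (w.1.2 + t *: w.2))).
Proof.
apply: (measurableT_comp (continuous_measurable_fun (@continuous_cos R))).
apply: measurable_funD => //; apply: measurable_funM => //.
apply: (measurableT_comp (measurable_zdot k)).
apply: measurable_fun_mx => i j; under eq_fun do rewrite !mxE.
apply: measurable_funD.
  exact: (measurableT_comp (measurable_mx_entry i j) (measurableT_comp measurable_snd measurable_fst)).
apply: measurable_funM => //; exact: (measurableT_comp (measurable_mx_entry i j) measurable_snd).
Qed.

(** The functions cos (th + 2 pi k . (x + t_p v)) are asymptotically
    orthogonal: by the product formula their products oscillate in v with
    frequencies t_n - t_p and t_n + t_p. *)
Lemma riemann_lebesgue (k : d.-tuple int) (th : R) (t : nat -> R) (a : sample_space R d -> R) :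
  nz k -> t p @[p --> \oo] --> +oo -> measurable_fun setT a ->
  mu.-integrable setT (EFin \o a) ->
  \int[mu]_w (a w * cos (th + 2 * pi * zdot k (w.1.2 + t p *: w.2))) @[p --> \oo] --> (0 : R).
Proof.
move=> nk toy ma ia.
pose E (M : nat) : set ('M[R]_d * 'cV[R]_d) := mbox M%:R `*` ibox M%:R.
pose D (M : nat) : set (sample_space R d) := E M `*` ibox M%:R.
have mE M : measurable (E M).
  by apply: measurableX; [exact: measurable_mbox|exact: measurable_ibox].
have Eoo M : (mu2 (E M) < +oo)%E.
  rewrite /sfprod /= product_measure1E//; [|exact: measurable_mbox|exact: measurable_ibox].
  rewrite lte_mul_pinfty ?ge0_fin_numE ?lebesgue_ibox_lty//.
  exact: haar_mbox_lty.
have k0 : exists i, (tnth k i)%:~R != 0 :> R.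
  by have /existsP[i ki] := nk; exists i; rewrite intr_eq0.
have M0 (M : nat) : 0 <= M%:R :> R by [].
apply: (hilbert_integrable (D := D)) => //.
- by move=> M; exact: measurable_box_prod.
- by move=> M; apply: lebesgue_box_prod_lty => //; exact: Eoo.
- move=> [[U x] v].
  pose S := \sum_i \sum_j `|U i j| + \sum_i `|x i 0| + \sum_i `|v i 0|.
  have S1 : 0 <= \sum_i \sum_j `|U i j| by rewrite sumr_ge0// => i _; rewrite sumr_ge0.
  have S2 : 0 <= \sum_i `|x i 0| by rewrite sumr_ge0.
  have S3 : 0 <= \sum_i `|v i 0| by rewrite sumr_ge0.
  exists (Num.bound S) => M hM.
  have SM : S <= M%:R.
    by rewrite (le_trans (ltW (archi_boundP _)))// ?ler_nat// !addr_ge0.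
  split=> /=; first split=> /=.
  + move=> i j; rewrite in_itv/= -ler_norml (le_trans _ SM)// /S -addrA ler_wpDr ?addr_ge0//.
    rewrite (bigD1 i)//= (bigD1 j)//= -!addrA lerDl !addr_ge0 ?sumr_ge0// => i' _.
    by rewrite sumr_ge0.
  + move=> i; rewrite in_itv/= -ler_norml (le_trans _ SM)// /S -addrA ler_wpDl//.
    by rewrite (bigD1 i)//= -addrA lerDl addr_ge0// sumr_ge0.
  + move=> i; rewrite in_itv/= -ler_norml (le_trans _ SM)// /S ler_wpDl ?addr_ge0//.
    by rewrite (bigD1 i)//= lerDl sumr_ge0.
- by move=> p; exact: measurable_phase.
- by move=> p w; exact: cos_max.
move=> M n.
have large (c : R) (sg : bool) K : \forall p \near \oo, K <= `|2 * pi * (c + (-1) ^+ sg * t p)|.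
  move/cvgryPge : toy => /(_ (`|K| + `|c|)); apply: filterS => p hp.
  have pi2 : 1 <= 2 * pi :> R by have := pi_ge2 R; lra.
  have tp0 : `|t p| = t p by rewrite ger0_norm// (le_trans _ hp)// addr_ge0.
  rewrite normrM (ger0_norm (le_trans ler01 pi2)).
  apply: (@le_trans _ _ `|c + (-1) ^+ sg * t p|); last by rewrite ler_peMl.
  have := ler_normB (c + (-1) ^+ sg * t p) c.
  rewrite [X in `|X| <= _](_ : _ = (-1) ^+ sg * t p); last by ring.
  rewrite normrMsign tp0; have := ler_norm K; lra.
pose ph1 (p : 'M[R]_d * 'cV[R]_d) : R := 2 * th + 4 * pi * zdot k p.2.
have mph1 : measurable_fun setT ph1.
  apply: measurable_funD => //; apply: measurable_funM => //.
  exact: (measurableT_comp (measurable_zdot k)).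
have h0 := osc_prod_cvg (mE M) (Eoo M) (M0 M) k0 (phi := fun=> 0)
   (measurable_cst _) (large (t n) true).
have h1 := osc_prod_cvg (mE M) (Eoo M) (M0 M) k0 mph1 (large (t n) false).
have h2 : (\int[mu]_(w in D M) cos (0 + 2 * pi * (t n + (-1) ^+ true * t p) *
      \sum_i (tnth k i)%:~R * w.2 i 0) +
   \int[mu]_(w in D M) cos (ph1 w.1 + 2 * pi * (t n + (-1) ^+ false * t p) *
      \sum_i (tnth k i)%:~R * w.2 i 0)) / 2 @[p --> \oo] --> ((0 + 0) / 2 : R).
  by apply: cvgM; [exact: cvgD|exact: cvg_cst].
rewrite addr0 mul0r in h2; apply: cvg_trans h2; apply: near_eq_cvg; near=> p.
have mD : measurable (D M) by exact: measurable_box_prod.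
have Doo : (mu (D M) < +oo)%E by apply: lebesgue_box_prod_lty => //; exact: Eoo.
have ic (phi : 'M[R]_d * 'cV[R]_d -> R) s : measurable_fun setT phi ->
  mu.-integrable (D M) (EFin \o (fun w : sample_space R d =>
    cos (phi w.1 + s * \sum_i (tnth k i)%:~R * w.2 i 0))).
  move=> mphi; apply: (bounded_integrable (M := 1) mD Doo); last by move=> w; exact: cos_max.
  apply: (measurableT_comp (continuous_measurable_fun (@continuous_cos R))).
  apply: measurable_funD; first exact: (measurableT_comp mphi).
  apply: measurable_funM => //.
  exact: (measurableT_comp (measurable_zdot k) measurable_snd).
rewrite -RintegralD//; [|exact: (ic (fun=> 0))|exact: ic].
rewrite -RintegralZr//; last first.
  by apply: integrable_add => //; [exact: (ic (fun=> 0))|exact: ic].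
apply: eq_Rintegral => w _.
rewrite -/(zdot k w.2) /ph1 !zdotD !zdotZ.
set X := zdot k w.1.2; set V := zdot k w.2.
rewrite (_ : 0 + 2 * pi * (t n + (-1) ^+ true * t p) * V =
  (th + 2 * pi * (X + t n * V)) - (th + 2 * pi * (X + t p * V))); last by rewrite expr1; ring.
rewrite (_ : 2 * th + 4 * pi * X + 2 * pi * (t n + (-1) ^+ false * t p) * V =
  (th + 2 * pi * (X + t n * V)) + (th + 2 * pi * (X + t p * V))); last by rewrite expr0; ring.
move: (th + _ * (X + t n * V)) (th + _ * (X + t p * V)) => x y.
by rewrite cosB cosD; field.
Unshelve. all: by end_near. Qed.

End riemann_lebesgue.

(** * Equidistribution of the flow for large times *)

Section null_integral.
Import HBNNSimple.
Context d (T : measurableType d) (R : realType) (mu : {measure set T -> \bar R}).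
Local Open Scope ereal_scope.

(** Stated for arbitrary f, measurable or not: the integral is a supremum
    over simple functions below f, each of which vanishes off D. *)
Lemma ge0_integral_null (D : set T) (f : T -> \bar R) : measurable D -> mu D = 0 ->
  (forall x, D x -> 0 <= f x) -> \int[mu]_(x in D) f x = 0.
Proof.
move=> mD D0 f0; apply/eqP; rewrite eq_le integral_ge0// andbT ge0_integralE//.
apply: ge_ereal_sup => _ [h /= hf <-].
rewrite -integralT_nnsfun le_eqVlt; apply/orP; left; apply/eqP.
rewrite (ge0_negligible_integral (N := D))//; last first.
- by move=> x _; rewrite lee_fin; exact: fun_ge0.
- by apply/measurable_EFinP; exact: measurable_funP.
rewrite setTD; apply: integral0_eq => x Dx.
apply/eqP; rewrite eq_le [in X in _ && X]lee_fin; apply/andP; split; last exact: fun_ge0.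
by apply: le_trans (hf x) _; rewrite patchE memNset.
Qed.

End null_integral.

Lemma probability_bounded_integrable d (T : measurableType d) (R : realType)
    (P : probability T R) (f : T -> R) (M : R) : measurable_fun setT f ->
  (forall t, `|f t| <= M) -> P.-integrable setT (EFin \o f).
Proof.
apply: bounded_integrable => //.
exact: le_lt_trans (probability_le1 P measurableT) (ltry 1).
Qed.

Section parameter.
Context d1 d2 (T1 : measurableType d1) (T2 : measurableType d2) (R : realType).

Lemma measurable_parameter (P : probability T1 R)
    (m : {sigma_finite_measure set T2 -> \bar R}) (D : set T2)
    (h : T1 * T2 -> R) (M : R) : measurable D -> (m D < +oo)%E ->
  measurable_fun setT h -> (forall w, `|h w| <= M) ->
  measurable_fun setT (fun w => \int[m]_(z in D) h (w, z)).
Proof.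
move=> mD Doo mh hM.
have ih : (P \x m)%E.-integrable setT ((EFin \o h) \_ (setT `*` D)).
  apply/integrable_restrict; [exact: measurableX|exact: measurableT|rewrite setTI].
  apply: (bounded_integrable (M := M)) => //; first exact: measurableX.
  rewrite /= product_measure1E//.
  by apply: le_lt_trans Doo; rewrite -[leRHS]mul1e lee_wpmul2r// probability_le1.
have mF := measurable_fubini_F ih.
rewrite (_ : (fun w => _) = fine \o (fun w => \int[m]_y ((EFin \o h) \_ (setT `*` D)) (w, y))%E).
  by apply: (measurableT_comp (@fine_measurable _ setT measurableT) mF).
apply/funext => w /=; rewrite /Rintegral; congr fine.
rewrite integral_mkcond; apply: eq_integral => y _; rewrite !patchE.
congr (if _ then _ else _); apply/idP/idP => /set_mem yD; apply/mem_set => //.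
by case: yD.
Qed.

End parameter.

Section cube_integral.
Context (R : realType) (d : nat).

Lemma cube_integral_le (f : 'cV[R]_d -> R) M : measurable_fun setT f -> (forall z, `|f z| <= M) ->
  `|\int[@lebesgue_mx R d 1]_(z in @unit_cube R d) f z| <= M.
Proof.
move=> mf fM; have mC := @measurable_cube R d.
have if_ := cube_integrable mf fM.
apply: le_trans (le_normr_Rintegral mC if_) _.
apply: (@le_trans _ _ (\int[@lebesgue_mx R d 1]_(z in @unit_cube R d) (cst M z))).
  apply: le_Rintegral => //.
  - by have := integrable_norm if_.
  - apply: (cube_integrable (M := `|M|)) => //.
rewrite Rintegral_cst//= (_ : fine _ = 1) ?mulr1//.
by rewrite -[1]/(fine 1%E); congr fine; exact: lebesgue_cube.
Qed.

End cube_integral.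

Section equidistribution.
Context (R : realType) (d : nat).
Local Notation leb n := (@lebesgue_mx R n 1).
Local Notation mu2 := (sfprod (@haar_SL R d) (leb d)).
Local Notation mu := (sfprod mu2 (leb d)).
Local Notation S := (sample_space R d).
Local Notation cube d := (@unit_cube R d).
Variable Q : probability S R.
Hypothesis Qmu : forall A, measurable A -> mu A = 0%E -> Q A = 0%E.

Let Qi (f : S -> R) M : measurable_fun setT f -> (forall t, `|f t| <= M) ->
  Q.-integrable setT (EFin \o f).
Proof. exact: probability_bounded_integrable. Qed.

(** Replace Q by its Radon-Nikodym density with respect to mu. *)
Lemma riemann_lebesgue_dominated (k : d.-tuple int) (th : R) (t : nat -> R) (a : S -> R) (M : R) :
  nz k -> t p @[p --> \oo] --> +oo -> measurable_fun setT a -> (forall w, `|a w| <= M) ->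
  \int[Q]_w (a w * cos (th + 2 * pi * zdot k (w.1.2 + t p *: w.2))) @[p --> \oo] --> (0 : R).
Proof.
move=> nk toy ma aM.
have dom : Q `<< mu by apply/null_content_dominatesP.
pose rn := Radon_Nikodym (charge_of_finite_measure Q) mu.
have irn : mu.-integrable setT rn by exact: Radon_Nikodym_integrable.
have rnf w : rn w \is a fin_num by exact: Radon_Nikodym_fin_num.
have mrn : measurable_fun setT (fine \o rn).
  by apply: (measurableT_comp (@fine_measurable _ setT measurableT)); apply: measurable_int irn.
have M0 : 0 <= M by apply: le_trans (aM (0, 0, 0)).
pose a' w : R := a w * fine (rn w).
have ma' : measurable_fun setT a' by exact: measurable_funM.
have ia' : mu.-integrable setT (EFin \o a').
  have iM : mu.-integrable setT (fun w => M%:E * rn w)%E by exact: integrableZl.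
  apply: (le_integrable _ _ _ iM) => //; first exact/measurable_EFinP.
  move=> w _; rewrite /= /a' -[in leRHS](fineK (rnf w)) -EFinM /= lee_fin !normrM.
  by rewrite ler_wpM2r// (ger0_norm M0).
have := riemann_lebesgue th nk toy ma' ia'.
apply: cvg_trans; apply: near_eq_cvg; apply: nearW => p; rewrite /Rintegral; congr fine.
rewrite -(Radon_Nikodym_change_of_variables dom)//; last first.
  apply: (Qi (M := M * 1)); first by apply: measurable_funM => //; exact: measurable_phase.
  by move=> w; rewrite normrM ler_pM// cos_max.
apply: eq_integral => w _; rewrite -[X in (_ * X)%E](fineK (rnf w)) -EFinM /a'.
by rewrite mulrAC.
Qed.

Variables (H : S * 'cV[R]_d -> R) (K : R).
Hypothesis mH : measurable_fun setT H.
Hypothesis HK : forall w, `|H w| <= K.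
Hypothesis Hunif : forall e : R, 0 < e -> exists G : set S,
  [/\ measurable G, (Q (~` G) <= e%:E)%E &
   exists2 del : R, 0 < del & forall w, G w -> forall y z : 'cV[R]_d,
     \sum_i sin2 (y i 0 - z i 0) < del -> `|H (w, z) - H (w, y)| <= e].

Let K0 : 0 <= K. Proof. by apply: le_trans (HK (0, 0, 0, 0)). Qed.

Let fc k w := fcos k (fun z => H (w, z)).
Let fs k w := fsin k (fun z => H (w, z)).

Let measurable_fc k : measurable_fun setT (fc k).
Proof.
apply: (measurable_parameter Q (h := fun wz => cos (2 * pi * zdot k wz.2) * H wz) (M := 1 * K)).
- exact: measurable_cube.
- by rewrite /= lebesgue_cube ltry.
- apply: measurable_funM => //; exact: (measurableT_comp (measurable_cos_zdot k)).
- by move=> w; rewrite normrM ler_pM// cos_max.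
Qed.

Let measurable_fs k : measurable_fun setT (fs k).
Proof.
apply: (measurable_parameter Q (h := fun wz => sin (2 * pi * zdot k wz.2) * H wz) (M := 1 * K)).
- exact: measurable_cube.
- by rewrite /= lebesgue_cube ltry.
- apply: measurable_funM => //; exact: (measurableT_comp (measurable_sin_zdot k)).
- by move=> w; rewrite normrM ler_pM// sin_max.
Qed.

Let mHw w : measurable_fun setT (fun z : 'cV[R]_d => H (w, z)).
Proof. exact: (measurableT_comp mH (measurable_pair1 w)). Qed.

Let fcK k w : `|fc k w| <= K.
Proof.
apply: cube_integral_le.
  by apply: measurable_funM => //; exact: measurable_cos_zdot.
by move=> z; rewrite normrM -[leRHS]mul1r ler_pM// cos_max.
Qed.

Let fsK k w : `|fs k w| <= K.
Proof.
apply: cube_integral_le.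
  by apply: measurable_funM => //; exact: measurable_sin_zdot.
by move=> z; rewrite normrM -[leRHS]mul1r ler_pM// sin_max.
Qed.

Let sinE (a : R) : sin a = cos (- (pi / 2) + a).
Proof. by rewrite addrC cosB cos_pihalf sin_pihalf mulr0 add0r mulr1. Qed.

Let cosE0 (a : R) : cos a = cos (0 + a). Proof. by rewrite add0r. Qed.

Let flow (t : R) (w : S) : 'cV[R]_d := w.1.2 + t *: w.2.

Let fejer_flow n (t : nat -> R) : t p @[p --> \oo] --> +oo ->
  \int[Q]_w fejer n.+1 (fun z => H (w, z)) (flow (t p) w) @[p --> \oo] -->
  \int[Q]_w \int[leb d]_(z in cube d) H (w, z).
Proof.
move=> toy.
have pc k p : measurable_fun setT (fun w => cos (2 * pi * zdot k (flow (t p) w))).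
  by under eq_fun do rewrite cosE0; exact: measurable_phase.
have ps k p : measurable_fun setT (fun w => sin (2 * pi * zdot k (flow (t p) w))).
  by under eq_fun do rewrite sinE; exact: measurable_phase.
have ic k p : Q.-integrable setT (EFin \o (fun w => fc k w * cos (2 * pi * zdot k (flow (t p) w)))).
  apply: (Qi (M := K * 1)); first exact: measurable_funM.
  by move=> w; rewrite normrM ler_pM// cos_max.
have is_ k p : Q.-integrable setT (EFin \o (fun w => fs k w * sin (2 * pi * zdot k (flow (t p) w)))).
  apply: (Qi (M := K * 1)); first exact: measurable_funM.
  by move=> w; rewrite normrM ler_pM// sin_max.
pose X k p := \int[Q]_w (fc k w * cos (2 * pi * zdot k (flow (t p) w))) +
  \int[Q]_w (fs k w * sin (2 * pi * zdot k (flow (t p) w))).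
have cX k : nz k -> X k p @[p --> \oo] --> (0 : R).
  move=> nk; rewrite -[X in _ --> X](addr0 0); apply: cvgD.
    have := riemann_lebesgue_dominated 0 nk toy (measurable_fc k) (fcK k).
    by under eq_fun do under eq_Rintegral do rewrite -cosE0.
  have := riemann_lebesgue_dominated (- (pi / 2)) nk toy (measurable_fs k) (fsK k).
  by under eq_fun do under eq_Rintegral do rewrite -sinE.
have E p : \int[Q]_w fejer n.+1 (fun z => H (w, z)) (flow (t p) w) =
   \int[Q]_w \int[leb d]_(z in cube d) H (w, z) +
   \sum_(k <- Zbox d n.+1 | nz k) fwt R n.+1 k * X k p.
  transitivity (\int[Q]_w \sum_(k <- Zbox d n.+1) fwt R n.+1 k *
     (fc k w * cos (2 * pi * zdot k (flow (t p) w)) +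
      fs k w * sin (2 * pi * zdot k (flow (t p) w)))).
    apply: eq_Rintegral => w _; apply: eq_bigr => k _.
    by congr (_ * (_ + _)); rewrite mulrC.
  rewrite Rintegral_sum_seq//; last first.
    by move=> k; apply: integrable_scale => //; exact: integrable_add.
  rewrite (bigD1_seq [tuple 0 | _ < d]) ?Zbox_uniq ?Zbox0//=; congr (_ + _).
    rewrite fwt0; apply: eq_Rintegral => w _.
    rewrite mul1r !zdot0 mulr0 cos0 sin0 mulr0 addr0 mulr1.
    by apply: eq_Rintegral => z _; rewrite zdot0 mulr0 cos0 mul1r.
  under eq_bigl do rewrite -nzE.
  apply: eq_bigr => k nk; rewrite RintegralZl//; last exact: integrable_add.
  by congr (_ * _); rewrite RintegralD.
set I0 := \int[Q]_w \int[leb d]_(z in cube d) H (w, z) in E *.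
have h : I0 + \sum_(k <- Zbox d n.+1 | nz k) fwt R n.+1 k * X k p @[p --> \oo] -->
    I0 + \sum_(k <- Zbox d n.+1 | nz k) fwt R n.+1 k * 0.
  apply: cvgD; first exact: cvg_cst.
  apply: cvg_big => [|k nk]; first exact: add_continuous.
  by apply: cvgM; [exact: cvg_cst|exact: cX].
rewrite big1 ?addr0 in h; last by move=> k _; rewrite mulr0.
apply: cvg_trans h; apply: near_eq_cvg; apply: nearW => p.
by rewrite E.
Qed.

(** For large times x + t v is asymptotically uniform and independent of (U,
    x, v). The function H (w, .) is replaced by a Fejer mean with an error
    that is small uniformly on G; in the Fejer mean all frequencies but 0
    disappear by the Riemann-Lebesgue lemma. *)
Lemma equidistribution (t : nat -> R) : t p @[p --> \oo] --> +oo ->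
  \int[Q]_w H (w, w.1.2 + t p *: w.2) @[p --> \oo] -->
  \int[Q]_w \int[leb d]_(z in cube d) H (w, z).
Proof.
move=> toy; apply/cvgrPdist_le => eps eps0.
(* L bounds the error of a Fejer mean of H off G, so that the total error is at
   most e + (2 e + L e) = eps. *)
pose L : R := 2 * K + 2 * K * d%:R.
have L0 : 0 <= L by rewrite addr_ge0// !mulr_ge0.
pose e := eps / (L + 3).
have e0 : 0 < e by rewrite divr_gt0// ltr_wpDl.
have [G [mG Ge [del del0 Gdel]]] := Hunif e0.
pose n := Num.bound (2 * K * d%:R / (del * e)).
have hn : 2 * K * d%:R / (del * n.+1%:R) <= e.
  have de0 : 0 < del * e by rewrite mulr_gt0.
  have /ltW : 2 * K * d%:R / (del * e) < n%:R.
    by apply: archi_boundP; apply: divr_ge0; [rewrite !mulr_ge0|exact: ltW].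
  rewrite ler_pdivrMr// => h; rewrite ler_pdivrMr ?mulr_gt0//.
  apply: le_trans h _; rewrite (_ : e * _ = n.+1%:R * (del * e)); last by ring.
  by apply: ler_wpM2r; [exact: ltW|rewrite ler_nat leqnSn].
pose F w y := fejer n.+1 (fun z => H (w, z)) y.
have FG w y : G w -> `|F w y - H (w, y)| <= e + e.
  move=> Gw; apply: (@le_trans _ _ (e + 2 * K * d%:R / (del * n.+1%:R))); last by rewrite lerD2l.
  by exact: (@fejer_approx R d n (fun z => H (w, z)) K y e del (mHw w) (fun z => HK (w, z)) (ltW e0) del0 (Gdel w Gw y)).
have FL w y : `|F w y - H (w, y)| <= L.
  apply: (@le_trans _ _ (2 * K + 2 * K * d%:R / (1 * n.+1%:R))); last first.
    rewrite lerD2l ler_piMr ?mulr_ge0// invf_le1 ?mul1r ?ltr0n// ler1n.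
    done.
  apply: (@fejer_approx R d n (fun z => H (w, z)) K y (2 * K) 1 (mHw w) (fun z => HK (w, z))) => //.
    by rewrite mulr_ge0.
  by move=> z _; rewrite (le_trans (ler_normB _ _))// mulr_natl mulr2n lerD.
have := fejer_flow n toy; move/cvgrPdist_le => /(_ e e0); apply: filterS => p hp.
set I := \int[Q]_w \int[leb d]_(z in cube d) H (w, z) in hp *.
have mfl : measurable_fun setT (fun w : S => (w, flow (t p) w)).
  apply: measurable_fun_pair => //; apply: measurable_fun_mx => i j.
  under eq_fun do rewrite !mxE.
  apply: measurable_funD.
    exact: (measurableT_comp (measurable_mx_entry i j) (measurableT_comp measurable_snd measurable_fst)).
  apply: measurable_funM => //; exact: (measurableT_comp (measurable_mx_entry i j) measurable_snd).
have mHf : measurable_fun setT (fun w => H (w, flow (t p) w)) by exact: (measurableT_comp mH).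
have iH : Q.-integrable setT (EFin \o (fun w => H (w, flow (t p) w))) by exact: (Qi mHf).
have mF : measurable_fun setT (fun w => F w (flow (t p) w)).
  apply: measurable_sum => k; apply: measurable_funM => //.
  apply: measurable_funD; apply: measurable_funM.
  - by under eq_fun do rewrite cosE0; exact: measurable_phase.
  - exact: measurable_fc.
  - by under eq_fun do rewrite sinE; exact: measurable_phase.
  - exact: measurable_fs.
have FK w y : `|F w y| <= L + K.
  by rewrite -[F w y](subrK (H (w, y))) (le_trans (ler_normD _ _))// lerD.
have iF : Q.-integrable setT (EFin \o (fun w => F w (flow (t p) w))) by exact: (Qi mF).
have hFH : `|\int[Q]_w F w (flow (t p) w) - \int[Q]_w H (w, flow (t p) w)| <= e + e + L * e.
  rewrite -RintegralB//.
  have mFH : measurable_fun setT (fun w => F w (flow (t p) w) - H (w, flow (t p) w)).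
    exact: measurable_funB.
  have iFH : Q.-integrable setT (EFin \o (fun w => F w (flow (t p) w) - H (w, flow (t p) w))).
    exact: (Qi mFH).
  apply: le_trans (le_normr_Rintegral measurableT iFH) _.
  have iG : Q.-integrable setT (EFin \o (fun w => (e + e) + L * \1_(~` G) w)).
    apply: (Qi (M := (e + e) + L)).
      apply: measurable_funD => //; apply: measurable_funM => //.
      by apply: measurable_indic; exact: measurableC.
    move=> w; rewrite ger0_norm; last by rewrite addr_ge0 ?mulr_ge0// ?addr_ge0// ltW.
    by rewrite lerD2l ler_piMr// indicE; case: (_ \in _).
  apply: (@le_trans _ _ (\int[Q]_w ((e + e) + L * \1_(~` G) w))).
    apply: le_Rintegral => //; first by have := integrable_norm iFH.
    move=> w _; rewrite indicE; have [h|h] := boolP (w \in ~` G).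
      by rewrite mulr1 ler_wpDl// addr_ge0// ltW.
    by rewrite mulr0 addr0; apply: FG; apply: contrapT => h1; case/negP : h; exact/mem_set.
  have m1 : measurable_fun setT (\1_(~` G) : S -> R).
    by apply: measurable_indic; exact: measurableC.
  have i1 : Q.-integrable setT (EFin \o (\1_(~` G) : S -> R)).
    by apply: (Qi (M := 1)) => // w; rewrite indicE; case: (_ \in _); rewrite ?normr1 ?normr0.
  have ie : Q.-integrable setT (EFin \o (fun _ : S => e + e)) by apply: (Qi (M := `|e + e|)).
  rewrite RintegralD//; last exact: integrable_scale.
  rewrite RintegralZl// (Rintegral_cst Q measurableT (e + e)).
  rewrite (_ : fine (Q setT) = 1) ?mulr1; last first.
    by rewrite -[RHS]/(fine 1%E); congr fine; exact: probability_setT.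
  rewrite lerD2l ler_wpM2l// /Rintegral integral_indic//; last exact: measurableC.
  by rewrite setIT -lee_fin fineK// fin_num_measure//; exact: measurableC.
have -> : I - \int[Q]_w H (w, w.1.2 + t p *: w.2) =
  (I - \int[Q]_w F w (flow (t p) w)) +
  (\int[Q]_w F w (flow (t p) w) - \int[Q]_w H (w, flow (t p) w)) by rewrite addrA subrK.
apply: le_trans (ler_normD _ _) _.
have -> : eps = e + (e + e + L * e).
  rewrite (_ : _ + _ = e * (L + 3)); last by ring.
  by rewrite /e divfK// gt_eqF// ltr_wpDl.
by apply: lerD.
Qed.

End equidistribution.

(** * Modulus of continuity of the corrector *)

Section heine_cantor.
Context (R : realType).

Lemma heine_cantor (f : R -> R) (r e : R) : continuous f -> 0 < e ->
  exists2 del : R, 0 < del &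
    forall a b, `|a| <= r -> `|a - b| <= del -> `|f a - f b| <= e.
Proof.
move=> cf e0; have e2 : 0 < e / 2 by rewrite divr_gt0.
have /compact_near_coveringP cov := @segment_compact R (- r) r.
have : \forall del \near 0^'+, `[- r, r]%classic `<=`
    (fun a => forall b, `|a - b| <= del -> `|f a - f b| <= e).
  apply: cov => x _.
  have /cvgrPdist_le /(_ _ e2) /nbhs_ballP[s /= s0 hs] := cf x.
  exists (ball x (s / 2), [set del : R | del < s / 2]) => /=.
    split; first by apply: nbhsx_ballx; rewrite divr_gt0.
    by apply: nbhs_right_lt; rewrite divr_gt0.
  move=> [a del] /= [ax dels] b ab.
  rewrite -ball_normE /ball_ /= in ax.
  have ha : `|f x - f a| <= e / 2.
    by apply: hs; rewrite -ball_normE /ball_ /=; lra.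
  have hb : `|f x - f b| <= e / 2.
    apply: hs; rewrite -ball_normE /ball_ /=.
    rewrite (_ : x - b = (x - a) + (a - b)); last by ring.
    by rewrite (le_lt_trans (ler_normD _ _))//; lra.
  rewrite (_ : f a - f b = (f x - f b) - (f x - f a)); last by ring.
  by rewrite (le_trans (ler_normB _ _))//; lra.
move=> h; have h0 : \forall del \near (0 : R)^'+, 0 < del by exact: nbhs_right_gt.
have [del [hdel del0]] := filter_ex (filterI h h0).
exists del => // a b ra ab; apply: hdel => //.
by rewrite /= in_itv/= -ler_norml.
Qed.

End heine_cantor.

Section trig_modulus.
Context (R : realType) (d : nat).

Lemma sin_sum_le (I : Type) (s : seq I) (a : I -> R) :
  `|sin (\sum_(i <- s) a i)| <= \sum_(i <- s) `|sin (a i)|.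
Proof.
elim: s => [|i s IH]; first by rewrite !big_nil sin0 normr0.
rewrite !big_cons sinD (le_trans (ler_normD _ _))// !normrM.
apply: lerD; first by rewrite ler_piMr// cos_max.
by apply: le_trans IH; rewrite ler_piMl// cos_max.
Qed.

Lemma sin_int_le (k : int) (a : R) : `|sin (k%:~R * a)| <= `|k|%:~R * `|sin a|.
Proof.
have nat_case (n : nat) : `|sin (n%:R * a)| <= n%:R * `|sin a|.
  rewrite !mulr_natl -[X in `|sin (_ *+ X)|](card_ord n) -[X in _ <= _ *+ X](card_ord n).
  by rewrite -!sumr_const sin_sum_le.
case: k => n; first by rewrite -pmulrn; exact: nat_case.
by rewrite NegzE intrN mulNr sinN !normrN -pmulrn; exact: nat_case.
Qed.

Lemma trig_modulus N (th : R) : 0 < th -> exists2 del : R, 0 < del &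
  forall k : d.-tuple int, k \in Zbox d N -> forall y z : 'cV[R]_d,
    \sum_i sin2 (y i 0 - z i 0) < del ->
    `|cos (2 * pi * zdot k y) - cos (2 * pi * zdot k z)| <= th /\
    `|sin (2 * pi * zdot k y) - sin (2 * pi * zdot k z)| <= th.
Proof.
move=> th0; pose c : R := 2 * (d%:R * N%:R) + 1.
have c0 : 0 < c by rewrite ltr_wpDl// !mulr_ge0.
exists ((th / c) ^+ 2); first by rewrite exprn_gt0// divr_gt0.
move=> k kN y z yz.
have hs i : `|sin (pi * (y i 0 - z i 0))| <= th / c.
  have : sin2 (y i 0 - z i 0) < (th / c) ^+ 2.
    apply: le_lt_trans yz; rewrite (bigD1 i)//= lerDl sumr_ge0// => j _; exact: sin2_ge0.
  rewrite /sin2 -[X in X < _]real_normK ?num_real// ltr_pXn2r// ?nnegrE ?divr_ge0 ?(ltW th0) ?(ltW c0)//.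
  exact: ltW.
set p := pi * zdot k y; set q := pi * zdot k z.
have hpq : `|sin (p - q)| <= th / 2.
  have -> : p - q = \sum_i (tnth k i)%:~R * (pi * (y i 0 - z i 0)).
    by rewrite /p /q -mulrBr /zdot -sumrB mulr_sumr; apply: eq_bigr => i _; ring.
  apply: le_trans (sin_sum_le _ _) _.
  apply: (@le_trans _ _ (\sum_(i < d) N%:R * (th / c))).
    apply: ler_sum => i _; apply: le_trans (sin_int_le _ _) _.
    apply: ler_pM => //.
    have /mem_Zbox/(_ i) := kN; rewrite mem_irange => h.
    by rewrite -[N%:R]/(N%:Z%:~R) ler_int; lia.
  rewrite sumr_const card_ord -[leLHS]mulr_natl.
  rewrite (_ : d%:R * (N%:R * (th / c)) = th * ((d%:R * N%:R) / c)); last by ring.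
  by rewrite ler_wpM2l ?(ltW th0)// ler_pdivrMr// /c; lra.
have pq2 : th / 2 + th / 2 = th by lra.
have e1 : 2 * pi * zdot k y = (p + q) + (p - q) by rewrite /p /q; ring.
have e2 : 2 * pi * zdot k z = (p + q) - (p - q) by rewrite /p /q; ring.
move: hpq; rewrite e1 e2; move: (p + q) (p - q) => a b hb; split.
  rewrite cosD cosB (_ : _ - _ = - (sin a * sin b + sin a * sin b)); last by ring.
  rewrite normrN (le_trans (ler_normD _ _))// -pq2 !normrM.
  by rewrite lerD// (le_trans _ hb)// ler_piMl// sin_max.
rewrite sinD sinB (_ : _ - _ = cos a * sin b + cos a * sin b); last by ring.
rewrite (le_trans (ler_normD _ _))// -pq2 !normrM.
by rewrite lerD// (le_trans _ hb)// ler_piMl// cos_max.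
Qed.

End trig_modulus.

Section corrector_modulus.
Context (R : realType) (d : nat).
Variable u : 'I_d -> R.
Variables (U : 'M[R]_d) (e : R).
Hypothesis u01 : forall j, 0 < u j < 1.
Hypothesis dU : \det U = 1.
Hypothesis nU : near1 U e.
Hypothesis e0 : 0 <= e.
Hypothesis e2 : e <= 2^-1 ^+ d / 2.
Hypothesis ue : forall j, u j + d%:R * e <= 1.
Variable v : 'cV[R]_d.
Hypothesis good : forall k, nz k -> (forall j, zrow k U j != 0) /\ zdot k v != 0.
Variable B : R.
Hypothesis sumB : forall N, \sum_(k <- Zbox d N | nz k) bcoef U v k <= B.

Lemma corr_le y : `|corr u U v y| <= 2 ^+ d * B.
Proof.
have cv : fsum (acoef u U v y) N @[N --> \oo] --> corr u U v y.
  exact: (corr_cvg u01 dU nU e0 e2 ue good sumB).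
have cn : `|fsum (acoef u U v y) N| @[N --> \oo] --> `|corr u U v y| by exact: cvg_norm.
rewrite -(cvg_lim _ cn)//; apply: limr_le; first by apply: cvgP cn.
apply: nearW => N; apply: (@le_trans _ _ (\sum_(k <- Zbox d N | nz k) 2 ^+ d * bcoef U v k)); last first.
  by rewrite -mulr_sumr ler_wpM2l ?exprn_ge0.
apply: le_trans (ler_norm_sum _ _ _) _.
rewrite big_seq_cond [leRHS]big_seq_cond; apply: ler_sum => k /andP[kN nk].
have /andP[f0 f1] := fwt_01 R kN.
rewrite normrM (ger0_norm f0) (le_trans _ (acoef_le u01 dU nU e0 e2 ue good y nk))//.
by rewrite ler_piMl.
Qed.

(** Low frequencies are controlled by the variation th of the characters,
    high frequencies by the tail eta of the dominating series. *)
Lemma corr_diff_le (N : nat) (th eta : R) (y z : 'cV[R]_d) : 0 <= th ->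
  (forall k : d.-tuple int, k \in Zbox d N ->
    `|cos (2 * pi * zdot k y) - cos (2 * pi * zdot k z)| <= th /\
    `|sin (2 * pi * zdot k y) - sin (2 * pi * zdot k z)| <= th) ->
  (forall M, (N <= M)%N -> \sum_(k <- Zbox d M | nz k) bcoef U v k <=
     \sum_(k <- Zbox d N | nz k) bcoef U v k + eta) ->
  `|corr u U v y - corr u U v z| <= 2 ^+ d * (th * B + 2 * eta).
Proof.
move=> th0 hth heta.
have cy : fsum (acoef u U v y) M @[M --> \oo] --> corr u U v y.
  exact: (corr_cvg u01 dU nU e0 e2 ue good sumB).
have cz : fsum (acoef u U v z) M @[M --> \oo] --> corr u U v z.
  exact: (corr_cvg u01 dU nU e0 e2 ue good sumB).
have cn : `|fsum (acoef u U v y) M - fsum (acoef u U v z) M| @[M --> \oo] -->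
    `|corr u U v y - corr u U v z| by apply: cvg_norm; exact: cvgB.
rewrite -(cvg_lim _ cn)//; apply: limr_le; first by apply: cvgP cn.
near=> M; have NM : (N <= M)%N by near: M; exact: nbhs_infty_ge.
have d0 : 0 <= 2 ^+ d :> R by rewrite exprn_ge0.
have term k : k \in Zbox d M -> nz k ->
    `|fwt R M k * acoef u U v y k - fwt R M k * acoef u U v z k| <=
    `|acoef u U v y k - acoef u U v z k|.
  move=> kM nk; have /andP[f0 f1] := fwt_01 R kM.
  by rewrite -mulrBr normrM (ger0_norm f0) ler_piMl.
have small k : k \in Zbox d N -> nz k ->
    `|acoef u U v y k - acoef u U v z k| <= th * (2 ^+ d * bcoef U v k).
  move=> kN nk; have [g1 g2] := good nk; have [t1 t2] := hth k kN.
  have [h1 h2] := fourier_tbox_le u01 dU nU e0 e2 ue g1.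
  rewrite /acoef -mulrBl normrM normfV.
  have pi2 : `|2 * pi| = 2 * pi :> R by rewrite ger0_norm// mulr_ge0// pi_ge0.
  rewrite normrM pi2 invfM /bcoef !mulrA ler_wpM2r ?invr_ge0//.
  rewrite ler_pdivrMr ?mulr_gt0 ?pi_gt0// -[th * _ * _]mulrA.
  set q := 2 ^+ d * _ in h1 h2 *.
  have q0 : 0 <= q by apply: le_trans h1.
  set a := fcos _ _ in h1 *; set b := fsin _ _ in h2 *.
  rewrite (_ : a * _ - _ - _ =
     a * (sin (2 * pi * zdot k y) - sin (2 * pi * zdot k z)) -
     b * (cos (2 * pi * zdot k y) - cos (2 * pi * zdot k z))); last by ring.
  apply: (@le_trans _ _ (q * th + q * th)).
    by apply: le_trans (ler_normB _ _) _; rewrite !normrM lerD// ler_pM.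
  rewrite (_ : q * th + q * th = th * q * 2); last by ring.
  apply: ler_wpM2l; first exact: mulr_ge0.
  have := pi_ge2 R; lra.
rewrite /fsum -sumrB (big_Zbox_split _ _ NM).
apply: le_trans (ler_normD _ _) _.
rewrite mulrDr; apply: lerD.
  apply: le_trans (ler_norm_sum _ _ _) _.
  apply: (@le_trans _ _ (\sum_(k <- Zbox d N | nz k) th * (2 ^+ d * bcoef U v k))).
    rewrite big_seq_cond [leRHS]big_seq_cond; apply: ler_sum => k /andP[kN nk].
    by apply: le_trans (small k kN nk); apply: term => //; exact: Zbox_sub kN.
  by rewrite -!mulr_sumr mulrCA ler_wpM2l// ler_wpM2l.
apply: le_trans (ler_norm_sum _ _ _) _.
apply: (@le_trans _ _ (\sum_(k <- Zbox d M | nz k && (k \notin Zbox d N)) (2 ^+ d * 2) * bcoef U v k)).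
  rewrite big_seq_cond [leRHS]big_seq_cond; apply: ler_sum => k /and3P[kM nk _].
  apply: le_trans (term k kM nk) _; apply: le_trans (ler_normB _ _) _.
  rewrite (_ : 2 ^+ d * 2 * _ = 2 ^+ d * bcoef U v k + 2 ^+ d * bcoef U v k); last by ring.
  by apply: lerD; apply: acoef_le.
rewrite -mulr_sumr mulrA ler_wpM2l ?mulr_ge0//.
have := heta M NM; rewrite (big_Zbox_split _ _ NM); lra.
Unshelve. all: by end_near. Qed.

End corrector_modulus.

(** * Measurability and null sets *)

Section measurability.
Context (R : realType) (d : nat).
Local Notation S := (sample_space R d).

Lemma measurable_norm_inv : measurable_fun [set: R] (fun s => `|s|^-1).
Proof.
rewrite (_ : (fun s => _) = fun s => `|s| `^ (-1)); last first.
  by apply/funext => s; rewrite powR_inv1.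
by apply: (measurableT_comp (measurable_powR (-1))).
Qed.

Lemma measurable_inv : measurable_fun [set: R] (fun s => s^-1).
Proof.
rewrite (_ : (fun s => _) = fun s => s * (`|s|^-1 * `|s|^-1)); last first.
  apply/funext => s; have [->|s0] := eqVneq s 0; first by rewrite invr0 mul0r.
  by rewrite -invfM -normrM ger0_norm -?expr2 ?sqr_ge0// expr2 invfM mulrA divff// mul1r.
by apply: measurable_funM => //; apply: measurable_funM; exact: measurable_norm_inv.
Qed.

Lemma measurable_near1 (e : R) : measurable [set U : 'M[R]_d | near1 U e].
Proof.
rewrite (_ : mkset _ = \bigcap_(i in [set: 'I_d]) \bigcap_(j in [set: 'I_d])
   ((fun U : 'M[R]_d => `|U i j - (i == j)%:R|) @^-1` `]-oo, e])).
  apply: fin_bigcap_measurable => // i _; apply: fin_bigcap_measurable => // j _.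
  rewrite -[X in measurable X]setTI.
  apply: (measurableT_comp (@normr_measurable R setT)) => //.
  by apply: measurable_funB => //; exact: measurable_mx_entry.
apply/seteqP; split => U /=.
  by move=> h i _ j _ /=; rewrite in_itv/=.
by move=> h i j; have := h i I j I; rewrite /= in_itv.
Qed.

Lemma measurable_bcoef (k : d.-tuple int) :
  measurable_fun setT (fun w : S => bcoef w.1.1 w.2 k).
Proof.
apply: measurable_funM.
  apply: measurable_prod => j _.
  apply: (measurableT_comp measurable_norm_inv).
  apply: (measurableT_comp (measurable_zrow k j)).
  exact: (measurableT_comp measurable_fst measurable_fst).
apply: (measurableT_comp measurable_norm_inv).
exact: (measurableT_comp (measurable_zdot k) measurable_snd).
Qed.

(** The probability Q only serves to apply Fubini's theorem to the Fourier
    coefficients. *)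
Lemma measurable_corr (u : 'I_d -> R) (Q : probability S R) :
  measurable_fun setT (fun wy : S * 'cV[R]_d => corr u wy.1.1.1 wy.1.2 wy.2).
Proof.
have m1 : measurable_fun setT (fun w : S => w.1.1).
  exact: (measurableT_comp measurable_fst measurable_fst).
have mt : measurable [set wz : S * 'cV[R]_d | tbox u wz.1.1.1 wz.2].
  rewrite (_ : mkset _ = (fun wz : S * 'cV[R]_d => (wz.1.1.1, wz.2)) @^-1`
     [set w : 'M[R]_d * 'cV[R]_d | tbox u w.1 w.2])//.
  rewrite -[X in measurable X]setTI; apply: measurable_fun_pair => //.
    exact: (measurableT_comp m1 measurable_fst).
  exact: measurable_tbox_pair.
have indE (w : S) z : \1_[set wz : S * 'cV[R]_d | tbox u wz.1.1.1 wz.2] (w, z) =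
    \1_(tbox u w.1.1) z :> R.
  by rewrite !indicE; congr (_%:R); congr nat_of_bool; apply/idP/idP => /set_mem h; apply/mem_set.
have mf k : measurable_fun setT (fun w : S => fcos k (\1_(tbox u w.1.1) : 'cV[R]_d -> R)).
  pose h (wz : S * 'cV[R]_d) : R := cos (2 * pi * zdot k wz.2) *
    \1_[set wz : S * 'cV[R]_d | tbox u wz.1.1.1 wz.2] wz.
  rewrite (_ : (fun w => _) = fun w => \int[@lebesgue_mx R d 1]_(z in @unit_cube R d) h (w, z)); last first.
    by apply/funext => w; apply: eq_Rintegral => z _; rewrite /h indE.
  apply: (measurable_parameter Q (M := 1 * 1)).
  - exact: measurable_cube.
  - by rewrite /= lebesgue_cube ltry.
  - apply: measurable_funM; first exact: (measurableT_comp (measurable_cos_zdot k)).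
    exact: measurable_indic.
  move=> wz; rewrite normrM ler_pM ?cos_max// indicE.
  by case: (_ \in _); rewrite ?normr1 ?normr0.
have mg k : measurable_fun setT (fun w : S => fsin k (\1_(tbox u w.1.1) : 'cV[R]_d -> R)).
  pose h (wz : S * 'cV[R]_d) : R := sin (2 * pi * zdot k wz.2) *
    \1_[set wz : S * 'cV[R]_d | tbox u wz.1.1.1 wz.2] wz.
  rewrite (_ : (fun w => _) = fun w => \int[@lebesgue_mx R d 1]_(z in @unit_cube R d) h (w, z)); last first.
    by apply/funext => w; apply: eq_Rintegral => z _; rewrite /h indE.
  apply: (measurable_parameter Q (M := 1 * 1)).
  - exact: measurable_cube.
  - by rewrite /= lebesgue_cube ltry.
  - apply: measurable_funM; first exact: (measurableT_comp (measurable_sin_zdot k)).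
    exact: measurable_indic.
  move=> wz; rewrite normrM ler_pM ?sin_max// indicE.
  by case: (_ \in _); rewrite ?normr1 ?normr0.
apply: (measurableT_comp (@fine_measurable R setT measurableT)).
apply: (@measurable_fun_limn_esup _ _ R setT
  (fun N (wy : S * 'cV[R]_d) => (fsum (acoef u wy.1.1.1 wy.1.2 wy.2) N)%:E)) => N.
apply/measurable_EFinP; rewrite /fsum; under eq_fun do rewrite -big_filter.
apply: measurable_sum => k; apply: measurable_funM => //; rewrite /acoef.
apply: measurable_funM.
  apply: measurable_funB; apply: measurable_funM.
  - exact: (measurableT_comp (mf k) measurable_fst).
  - exact: (measurableT_comp (measurable_sin_zdot k) measurable_snd).
  - exact: (measurableT_comp (mg k) measurable_fst).
  - exact: (measurableT_comp (measurable_cos_zdot k) measurable_snd).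
apply: (measurableT_comp measurable_inv); apply: measurable_funM => //.
apply: (measurableT_comp (measurable_zdot k)).
exact: (measurableT_comp measurable_snd measurable_fst).
Qed.

End measurability.

Section null_hyperplane.
Context (R : realType) (d : nat).
Local Notation lam := (@lebesgue_measure R).
Local Notation leb n := (@lebesgue_mx R n 1).
Local Notation mu2 := (sfprod (@haar_SL R d) (leb d)).
Local Notation mu := (sfprod mu2 (leb d)).
Local Notation S := (sample_space R d).

Lemma lebesgue_coord0 (j : 'I_d) : leb d [set z | z j 0 = 0] = 0%E.
Proof.
rewrite (_ : mkset _ = [set z | forall i, z i 0 \in
    (if i == j then `[0, 0] else `]-oo, +oo[ : interval R)]); last first.
  apply/seteqP; split => z /=.
    by move=> zj i; case: eqP => [->|_]; rewrite in_itv/= ?zj ?lexx.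
  by move=> /(_ j); rewrite eqxx in_itv/= => h; apply/eqP; rewrite eq_le andbC.
rewrite lebesgue_prod_itv (bigD1 j)//= eqxx lebesgue_measure_itv/= ltxx.
by rewrite mul0e.
Qed.

Lemma measurable_adj_snd (j : 'I_d) :
  measurable_fun setT (fun w : S => (\adj w.1.1 *m w.2) j 0).
Proof.
under eq_fun do rewrite mxE.
apply: measurable_sum => i; apply: measurable_funM.
  apply: (measurableT_comp (measurable_adj_entry j i)).
  exact: (measurableT_comp measurable_fst measurable_fst).
exact: (measurableT_comp (measurable_mx_entry i 0) measurable_snd).
Qed.

(** Substituting v = U z, the hyperplane becomes the coordinate hyperplane
    z_j = 0. *)
Lemma lebesgue_hyperplane (U : 'M[R]_d) (j : 'I_d) : \det U = 1 ->
  near1 U (2^-1 ^+ d / 2) -> leb d [set v | (\adj U *m v) j 0 = 0] = 0%E.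
Proof.
move=> dU nU; have [c _ cE] := ge0_integral_affine nU.
have mU : measurable_fun setT (fun v : 'cV[R]_d => (\adj U *m v) j 0).
  by apply: (measurableT_comp (measurable_mx_entry j 0)); exact: measurable_mulmx_col.
have mA : measurable [set v : 'cV[R]_d | (\adj U *m v) j 0 = 0].
  rewrite (_ : mkset _ = (fun v : 'cV[R]_d => (\adj U *m v) j 0) @^-1` [set 0])//.
  by rewrite -[X in measurable X]setTI; apply: mU.
rewrite -[LHS]/(leb d _) -[X in leb d X]setIT -(integral_indic (leb d) measurableT mA).
have := cE 0 (fun v => (\1_[set v : 'cV[R]_d | (\adj U *m v) j 0 = 0] v)%:E).
move=> ->; last 2 first.
- by apply/measurable_EFinP; exact: measurable_indic.
- by move=> v; rewrite lee_fin.
have mB : measurable [set z : 'cV[R]_d | z j 0 = 0].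
  rewrite (_ : mkset _ = (fun z : 'cV[R]_d => z j 0) @^-1` [set 0])//.
  by rewrite -[X in measurable X]setTI; apply: measurable_mx_entry.
rewrite (_ : (\int[leb d]_z _)%E = (\int[leb d]_z (\1_[set z : 'cV[R]_d | z j 0 = 0] z)%:E)%E).
  by rewrite integral_indic// setIT -[X in (_ * X)%E]/(leb d _) lebesgue_coord0 mule0.
apply: eq_integral => z _; rewrite !indicE; congr ((_%:R)%:E); congr nat_of_bool.
apply/idP/idP => /set_mem h; apply/mem_set; move: h; rewrite /= addr0 mulmxA mul_adj_mx dU mul1mx//.
Qed.

Lemma ae_adj (e : R) : e <= 2^-1 ^+ d / 2 -> {ae mu, forall w : S, \det w.1.1 = 1 ->
  near1 w.1.1 e -> forall j, (\adj w.1.1 *m w.2) j 0 != 0}.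
Proof.
move=> e2.
suff : {ae mu, forall w : S, forall j : 'I_d, \det w.1.1 = 1 ->
    near1 w.1.1 e -> (\adj w.1.1 *m w.2) j 0 != 0}.
  by apply: ae_sub => w h h1 h2 j; exact: h.
apply: ae_forall_countable => j.
pose A : set S := [set w | [/\ \det w.1.1 = 1, near1 w.1.1 e & (\adj w.1.1 *m w.2) j 0 = 0]].
have m1 : measurable_fun setT (fun w : S => w.1.1).
  exact: (measurableT_comp measurable_fst measurable_fst).
have mA : measurable A.
  rewrite (_ : A = ((fun w : S => \det w.1.1) @^-1` [set 1]) `&`
     ((fun w : S => w.1.1) @^-1` [set U | near1 U e]) `&`
     ((fun w : S => (\adj w.1.1 *m w.2) j 0) @^-1` [set 0])); last first.
    by apply/seteqP; split => w; [case=> ? ? ?; split|case=> -[]; split].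
  apply: measurableI; first apply: measurableI.
  - rewrite -[X in measurable X]setTI; apply: (measurableT_comp (@measurable_det R d) m1) => //.
  - by rewrite -[X in measurable X]setTI; apply: m1 => //; exact: measurable_near1.
  - by rewrite -[X in measurable X]setTI; apply: measurable_adj_snd.
exists A; split => //.
  rewrite -[LHS]/((mu2 \x leb d)%E A) /product_measure1; apply: integral0_eq => -[U x] _ /=.
  have [[dU nU]|h] := pselect (\det U = 1 /\ near1 U e).
    apply/eqP; rewrite eq_le measure_ge0 andbT.
    rewrite -(lebesgue_hyperplane j dU (fun i k => le_trans (nU i k) e2)).
    apply: le_measure; rewrite ?inE.
    - exact: measurable_xsection.
    - rewrite (_ : mkset _ = (fun v : 'cV[R]_d => (\adj U *m v) j 0) @^-1` [set 0])//.
      rewrite -[X in measurable X]setTI.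
      by apply: (measurableT_comp (measurable_mx_entry j 0)) => //; exact: measurable_mulmx_col.
    - by move=> v; rewrite /xsection /= inE => -[].
  rewrite (_ : xsection A (U, x) = classical_sets.set0) ?measure0//.
  by apply/seteqP; split => v //; rewrite /xsection /= inE => -[h1 h2 _]; apply: h.
move=> w /= hw; apply: contrapT => nA; apply: hw => h1 h2; apply/eqP => h3.
exact: nA.
Qed.

End null_hyperplane.

(** * The corrector along a typical orbit *)

Lemma exhaust_small d (T : measurableType d) (R : realType) (P : probability T R)
    (F : nat -> set T) (e : R) : 0 < e -> (forall n, measurable (F n)) ->
  nonincreasing_seq F -> \bigcap_n F n = classical_sets.set0 ->
  exists n, (P (F n) <= e%:E)%E.
Proof.
move=> e0 mF niF F0.
have F0oo : (P (F 0%N) < +oo)%E by exact: le_lt_trans (probability_le1 P (mF 0%N)) (ltry 1).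
have mcap : measurable (\bigcap_n F n) by rewrite F0.
have := nonincreasing_cvg_mu F0oo mF mcap niF; rewrite F0 measure0 => cv.
have : (fine (P (F n))) @[n --> \oo] --> (0 : R) by apply: fine_cvg.
move/cvgr0_norm_le => /(_ _ e0) [n _ /(_ n (leqnn n)) h].
exists n; rewrite -(@fineK _ (P (F n))) ?fin_num_measure// lee_fin.
exact: le_trans (ler_norm _) h.
Qed.

Section good_flows.
Context (R : realType) (d : nat).
Local Notation leb n := (@lebesgue_mx R n 1).
Local Notation mu2 := (sfprod (@haar_SL R d) (leb d)).
Local Notation mu := (sfprod mu2 (leb d)).
Local Notation S := (sample_space R d).
Local Notation cube d := (@unit_cube R d).
Variables (u : 'I_d -> R) (e : R).
Hypothesis u01 : forall j, 0 < u j < 1.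
Hypothesis e0 : 0 <= e.
Hypothesis e2 : e <= 2^-1 ^+ d / 2.
Hypothesis ue : forall j, u j + d%:R * e <= 1.

(** The (U, x, v) for which the discrepancy is the coboundary of a continuous
    function; almost every point near the identity is of this kind. *)
Record good (w : S) : Prop := Good {
  good_det : \det w.1.1 = 1;
  good_near : near1 w.1.1 e;
  good_adj : forall j, (\adj w.1.1 *m w.2) j 0 != 0;
  good_denom : forall k, nz k -> (forall j, zrow k w.1.1 j != 0) /\ zdot k w.2 != 0;
  good_sum : exists B, forall N, \sum_(k <- Zbox d N | nz k) bcoef w.1.1 w.2 k <= B }.

Lemma ae_good_mu : {ae mu, forall w : S, \det w.1.1 = 1 -> cube d w.1.2 ->
  near1 w.1.1 e -> good w}.
Proof.
have h1 : {ae mu, forall w : S, forall M : nat, exists B : R, forall N,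
    (partial_sum M%:R N w <= B%:E)%E}.
  by apply: ae_forall_countable => M; exact: ae_partial_sum.
apply: (ae_sub2 _ h1 (ae_adj e2)) => w hs ha dU xw nU.
pose T := \sum_i \sum_j `|w.1.1 i j| + \sum_i `|w.2 i 0|.
have T1 : 0 <= \sum_i \sum_j `|w.1.1 i j| by rewrite sumr_ge0// => i _; rewrite sumr_ge0.
have T2 : 0 <= \sum_i `|w.2 i 0| by rewrite sumr_ge0.
pose M := Num.bound T; have TM : T <= M%:R by apply/ltW/archi_boundP; rewrite addr_ge0.
have [B hB] := hs M.
have hU : mbox M%:R w.1.1.
  move=> i j; rewrite /= in_itv/= -ler_norml (le_trans _ TM)// /T ler_wpDr//.
  rewrite (bigD1 i)//= (bigD1 j)//= -!addrA lerDl addr_ge0 ?sumr_ge0// => i' _.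
  by rewrite sumr_ge0.
have hv : ibox M%:R w.2.
  move=> i; rewrite /= in_itv/= -ler_norml (le_trans _ TM)// /T ler_wpDl//.
  by rewrite (bigD1 i)//= lerDl sumr_ge0.
have [g1 g2] := partial_sum_bcoef hU xw hv hB.
by split => //; exact: ha.
Qed.

Variable Q : probability S R.
Hypothesis Qgood : {ae Q, forall w, good w}.

Let Ssum N (w : S) : R := \sum_(k <- Zbox d N | nz k) bcoef w.1.1 w.2 k.

Let mS N : measurable_fun setT (Ssum N).
Proof.
rewrite /Ssum; under eq_fun do rewrite -big_filter.
by apply: measurable_sum => k; exact: measurable_bcoef.
Qed.

Let S_nd N M w : (N <= M)%N -> Ssum N w <= Ssum M w.
Proof.
move=> NM; rewrite /Ssum (big_Zbox_split _ _ NM) lerDl sumr_ge0// => k _.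
exact: bcoef_ge0.
Qed.

Let mle (f : S -> R) c : measurable_fun setT f -> measurable [set w | f w <= c].
Proof.
move=> mf; rewrite (_ : mkset _ = f @^-1` `]-oo, c]); last first.
  by apply/seteqP; split => w; rewrite /= in_itv.
by rewrite -[X in measurable X]setTI; apply: mf.
Qed.

(** Off a set of small probability the sums of the bcoef are bounded by a
    fixed L and their tails beyond a fixed N are small. On this set the
    corrector takes values in a fixed interval, where f is uniformly
    continuous, and it has a modulus of continuity depending only on L and N. *)
Lemma uniform_modulus (f : R -> R) (eps : R) : continuous f -> 0 < eps ->
  exists G : set S, [/\ measurable G, (Q (~` G) <= eps%:E)%E &
   exists2 del : R, 0 < del & forall w, G w -> forall y z : 'cV[R]_d,
     \sum_i sin2 (y i 0 - z i 0) < del ->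
     `|f (corr u w.1.1 w.2 z - corr u w.1.1 w.2 w.1.2) -
       f (corr u w.1.1 w.2 y - corr u w.1.1 w.2 w.1.2)| <= eps].
Proof.
move=> cf eps0; have eps2 : 0 < eps / 2 by rewrite divr_gt0.
have [N0 [mN0 QN0 hN0]] := Qgood.
have goodN w : ~ N0 w -> good w.
  by move=> nw; apply: contrapT => h; apply: nw; exact: hN0.
have mCN : measurable (~` N0) by exact: measurableC.
pose A (L : nat) : set S := \bigcap_N [set w | Ssum N w <= L%:R].
have mA L : measurable (A L) by apply: bigcap_measurable => // N _; exact: mle.
have [||| L hL] := @exhaust_small _ _ _ Q (fun L => ~` A L `&` ~` N0) _ eps2.
- by move=> n; apply: measurableI => //; exact: measurableC.
- move=> n m nm; apply/subsetPset => w [h1 h2]; split => //= h; apply: h1 => N _ /=.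
  by rewrite (le_trans (h N I))// ler_nat.
- apply/seteqP; split => // w hw.
  have [_ nw] := hw 0%N I; have [_ _ _ _ [B hB]] := goodN w nw.
  have [h _] := hw (Num.bound B) I; apply: h => N _ /=.
  have B0 : 0 <= B by apply: le_trans (hB 0%N); rewrite sumr_ge0// => k _; exact: bcoef_ge0.
  by rewrite (le_trans (hB N))// ltW// archi_boundP.
have L0 : 0 <= L%:R :> R by [].
pose r : R := 2 * (2 ^+ d * L%:R).
have [del0 del00 hdel0] := heine_cantor r cf eps0.
have d2 : 0 < 2 ^+ d :> R by rewrite exprn_gt0.
(* eta and th below split the tolerance del0 of f evenly in corr_diff_le. *)
pose eta := del0 / (4 * 2 ^+ d).
have eta0 : 0 < eta by rewrite divr_gt0// mulr_gt0.
pose B (N : nat) : set S := \bigcap_M [set w | Ssum (N + M)%N w - Ssum N w <= eta].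
have mB N : measurable (B N).
  by apply: bigcap_measurable => // M _; apply: mle; exact: measurable_funB.
have [||| N hN] := @exhaust_small _ _ _ Q (fun N => ~` B N `&` ~` N0) _ eps2.
- by move=> n; apply: measurableI => //; exact: measurableC.
- move=> n m nm; apply/subsetPset => w [h1 h2]; split => //= h; apply: h1 => M _ /=.
  have := h (m + M - n)%N I; rewrite /= subnKC; last by lia.
  have := S_nd w nm; lra.
- apply/seteqP; split => // w hw.
  have [_ nw] := hw 0%N I; have [_ _ _ _ [C hC]] := goodN w nw.
  have [K hK] := tail_small hC eta0.
  have [h _] := hw K I; apply: h => M _ /=.
  rewrite /Ssum (big_Zbox_split _ _ (leq_addr M K)) addrAC subrr add0r.
  exact: hK (leq_addr _ _).
pose th := del0 / (2 * 2 ^+ d * (L%:R + 1)).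
have L1 : 0 < L%:R + 1 :> R by rewrite ltr_wpDl.
have th0 : 0 < th by rewrite divr_gt0// !mulr_gt0.
have [del del_gt0 hdel] := @trig_modulus R d N th th0.
exists (A L `&` B N `&` ~` N0); split.
- by apply: measurableI => //; exact: measurableI.
- have sub : ~` (A L `&` B N `&` ~` N0) `<=`
      N0 `|` ((~` A L `&` ~` N0) `|` (~` B N `&` ~` N0)).
    move=> w h; have [?|nw] := pselect (N0 w); first by left.
    right; have [aw|naw] := pselect (A L w); last by left.
    by right; split => // bw; apply: h.
  have m1 : measurable (~` A L `&` ~` N0) by apply: measurableI => //; exact: measurableC.
  have m2 : measurable (~` B N `&` ~` N0) by apply: measurableI => //; exact: measurableC.
  have m3 : measurable ((~` A L `&` ~` N0) `|` (~` B N `&` ~` N0)) by exact: measurableU.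
  apply: (@le_trans _ _ (Q (N0 `|` ((~` A L `&` ~` N0) `|` (~` B N `&` ~` N0))))).
    apply: le_measure => //; rewrite inE; last exact: measurableU.
    by apply: measurableC; apply: measurableI => //; exact: measurableI.
  apply: le_trans (measureU2 _ mN0 m3) _.
  rewrite -[leRHS]add0e; apply: leeD.
    by rewrite le_eqVlt; apply/orP; left; apply/eqP; exact: QN0.
  apply: le_trans (measureU2 _ m1 m2) _.
  by rewrite (_ : eps = eps / 2 + eps / 2); [rewrite EFinD leeD|lra].
exists del => // w [[Aw Bw] nw] y z yz.
have [dU nU _ den _] := goodN w nw.
have sumL M : \sum_(k <- Zbox d M | nz k) bcoef w.1.1 w.2 k <= L%:R by exact: Aw.
have tailN M : (N <= M)%N -> \sum_(k <- Zbox d M | nz k) bcoef w.1.1 w.2 k <=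
    \sum_(k <- Zbox d N | nz k) bcoef w.1.1 w.2 k + eta.
  by move=> NM; have := Bw (M - N)%N I; rewrite /= subnKC// /Ssum; lra.
have cle t := @corr_le R d u w.1.1 e u01 dU nU e0 e2 ue w.2 den _ sumL t.
have cd := @corr_diff_le R d u w.1.1 e u01 dU nU e0 e2 ue w.2 den _ sumL N th eta y z
  (ltW th0) (fun k kN => hdel k kN y z yz) tailN.
apply: hdel0.
  by rewrite (le_trans (ler_normB _ _))// /r mulr_natl mulr2n lerD.
set cz := corr u _ _ z in cd *; set cy := corr u _ _ y in cd *; set cx := corr u _ _ _.
rewrite (_ : cz - cx - (cy - cx) = - (cy - cz)); last by ring.
rewrite normrN (le_trans cd)//.
have -> : 2 ^+ d * (th * L%:R + 2 * eta) = del0 * (2^-1 * (L%:R / (L%:R + 1)) + 2^-1).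
  by rewrite /th /eta; field; rewrite ?gt_eqF// ltr_wpDl.
rewrite ler_piMr ?(ltW del00)//.
have : L%:R / (L%:R + 1) <= 1 :> R by rewrite ler_pdivrMr// mul1r lerDl.
lra.
Qed.

Hypothesis Qmu : forall A, measurable A -> mu A = 0%E -> Q A = 0%E.

Lemma corr_equidistribution (f : R -> R) (K : R) (t : nat -> R) : continuous f ->
  (forall a, `|f a| <= K) -> t p @[p --> \oo] --> +oo ->
  \int[Q]_w f (corr u w.1.1 w.2 (w.1.2 + t p *: w.2) - corr u w.1.1 w.2 w.1.2) @[p --> \oo] -->
  \int[Q]_w \int[leb d]_(y in cube d) f (corr u w.1.1 w.2 y - corr u w.1.1 w.2 w.1.2).
Proof.
move=> cf fK toy.
pose H (wy : S * 'cV[R]_d) : R := f (corr u wy.1.1.1 wy.1.2 wy.2 - corr u wy.1.1.1 wy.1.2 wy.1.1.2).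
have mc := measurable_corr u Q.
have mH : measurable_fun setT H.
  apply: (measurableT_comp (continuous_measurable_fun cf)); apply: measurable_funB => //.
  rewrite (_ : (fun _ => _) = (fun wy : S * 'cV[R]_d => corr u wy.1.1.1 wy.1.2 wy.2) \o
    (fun wy : S * 'cV[R]_d => (wy.1, wy.1.1.2)))//.
  apply: (measurableT_comp mc); apply: measurable_fun_pair => //.
  exact: (measurableT_comp measurable_snd (measurableT_comp measurable_fst measurable_fst)).
apply: (equidistribution Qmu mH (K := K)) => //; first by move=> w; exact: fK.
by move=> eps eps0; exact: uniform_modulus.
Qed.

End good_flows.

(** * The limit law *)

Section cube_probability.
Context (R : realType) (d : nat).
Local Notation leb n := (@lebesgue_mx R n 1).
Local Notation cube d := (@unit_cube R d).

Let restr : {measure set 'cV[R]_d -> \bar R} := mrestr (leb d) (@measurable_cube R d).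

(** The uniform law on the torus. *)
Definition cube_prob : set 'cV[R]_d -> \bar R := mrestr (leb d) (@measurable_cube R d).

HB.instance Definition _ := Measure.copy cube_prob restr.

Let cube_prob_setT : cube_prob setT = 1%E.
Proof. by rewrite /cube_prob /mrestr setTI; exact: lebesgue_cube. Qed.

HB.instance Definition _ := Measure_isProbability.Build _ _ _ cube_prob cube_prob_setT.

Lemma integral_cube_prob (f : 'cV[R]_d -> R) (M : R) : measurable_fun setT f ->
  (forall z, `|f z| <= M) ->
  (\int[cube_prob]_z (f z)%:E = (\int[leb d]_(z in cube d) f z)%:E)%E.
Proof.
move=> mf fM; have mC := @measurable_cube R d.
rewrite [RHS]fineK; last by apply: integrable_fin_num => //; exact: cube_integrable mf fM.
have C0 : cube_prob (~` cube d) = 0%E by rewrite /cube_prob /mrestr setICl measure0.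
have if_ := probability_bounded_integrable cube_prob mf fM.
rewrite [LHS](negligible_integral (measurableC mC) measurableT if_ C0).
rewrite setTD setCK; apply: eq_measure_integral => A mA AC.
rewrite -[LHS]/(leb d (A `&` cube d)); congr (leb d _); exact: setIidl.
Qed.

End cube_probability.

Section assembly.
Context (R : realType) (d : nat).
Local Notation lam := (@lebesgue_measure R).
Local Notation leb n := (@lebesgue_mx R n 1).
Local Notation mu2 := (sfprod (@haar_SL R d) (leb d)).
Local Notation mu := (sfprod mu2 (leb d)).
Local Notation S := (sample_space R d).
Local Notation cube d := (@unit_cube R d).

Lemma exists_eta (u : 'I_d -> R) : (0 < d)%N -> (forall j, 0 < u j < 1) ->
  exists eta : R, [/\ 0 < eta, eta <= 2^-1 ^+ d / 2 & forall j, u j + d%:R * eta <= 1].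
Proof.
(* The product of the 1 - u_j is a positive number below all of them. *)
move=> d0 u01; pose p : R := \prod_j (1 - u j).
have up j : 0 < 1 - u j <= 1 by have /andP[a b] := u01 j; apply/andP; split; lra.
have p0 : 0 < p by apply: prodr_gt0 => j _; have /andP[] := up j.
have pj j : p <= 1 - u j.
  rewrite /p (bigD1 j)//= ler_piMr//; first by have /andP[/ltW] := up j.
  rewrite -[leRHS](big1 (op := *%R) (index_enum 'I_d) (fun i => i != j) (fun=> 1))//.
  by apply: ler_prod => i _; have /andP[/ltW-> ->] := up i.
have dR : 0 < d%:R :> R by rewrite ltr0n.
exists (Num.min (2^-1 ^+ d / 2) (p / d%:R)); split.
- by rewrite lt_min !divr_gt0// exprn_gt0// invr_gt0.
- by rewrite ge_min lexx.
move=> j; have : d%:R * Num.min (2^-1 ^+ d / 2) (p / d%:R) <= p.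
  by rewrite mulrC -ler_pdivlMr// ge_min lexx orbT.
have := pj j; lra.
Qed.

Lemma near1_norm (U : 'M[R]_d) (e : R) : `|U - 1%:M| <= e -> near1 U e.
Proof.
move=> h i j; apply: le_trans h.
rewrite /Num.norm/= mx_normrE.
have := le_bigmax (0 : R) (fun ij : 'I_d * 'I_d => `|(U - 1%:M) ij.1 ij.2|) (i, j).
by rewrite /= !mxE.
Qed.

Lemma measurable_SL_T_R : measurable (@SL_T_R R d).
Proof.
rewrite (_ : @SL_T_R R d = ((fun w : S => \det w.1.1) @^-1` [set 1]) `&`
   ((fun w : S => w.1.2) @^-1` cube d))//.
apply: measurableI; rewrite -[X in measurable X]setTI.
  apply: (measurableT_comp (@measurable_det R d)) => //.
  exact: (measurableT_comp measurable_fst measurable_fst).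
have m : measurable_fun setT (fun w : S => w.1.2).
  exact: (measurableT_comp measurable_snd measurable_fst).
by apply: m => //; exact: measurable_cube.
Qed.

Section law.
Context (dO : measure_display) (Omega : measurableType dO) (P : probability Omega R).
Variables (U : Omega -> 'M[R]_d) (x v : Omega -> 'cV[R]_d).
Hypothesis mW : measurable_fun setT (fun w => (U w, x w, v w) : S).
Hypothesis dU : forall w, \det (U w) = 1.
Hypothesis x01 : forall w, cube d (x w).

Let W (w : Omega) : S := (U w, x w, v w).

Let Wm : {mfun Omega >-> S} := mfun_Sub (mem_set mW).

Let Q : probability S R := distribution P Wm.

(** The law is given by a density with respect to mu on a measurable set,
    whose integral over a null set vanishes. *)
Lemma law_dominated (rho : S -> R) : smooth_compact_density rho -> has_density P W rho ->
  forall A, measurable A -> mu A = 0%E -> Q A = 0%E.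
Proof.
move=> [_ _ rho0 _] hW A mA A0.
rewrite -[LHS]/(P (W @^-1` A)) hW//.
have mAS : measurable (A `&` @SL_T_R R d).
  by apply: measurableI => //; exact: measurable_SL_T_R.
apply: ge0_integral_null => //.
  apply/eqP; rewrite eq_le measure_ge0 andbT -A0.
  by apply: (@le_measure _ _ _ mu); rewrite ?inE//; exact: subIsetl.
by move=> [[U' x'] v'] [_ [/= h _]]; rewrite lee_fin; exact: rho0.
Qed.

Lemma ae_law (A : S -> Prop) : measurable [set w | A w] ->
  {ae P, forall w, A (W w)} -> {ae Q, forall w, A w}.
Proof.
move=> mA [N [mN N0 hN]]; exists (~` [set w | A w]); split => //.
  exact: measurableC.
apply/eqP; rewrite eq_le measure_ge0 andbT -N0.
rewrite -[leLHS]/(P (W @^-1` (~` [set w | A w]))).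
apply: le_measure; rewrite ?inE//.
rewrite -[X in measurable X]setTI; apply: mW => //; exact: measurableC.
Qed.

Variables (u : 'I_d -> R) (e : R).
Hypothesis u01 : forall j, 0 < u j < 1.
Hypothesis e0 : 0 <= e.
Hypothesis e2 : e <= 2^-1 ^+ d / 2.
Hypothesis ue : forall j, u j + d%:R * e <= 1.
Hypothesis nU : {ae P, forall w, near1 (U w) e}.
Hypothesis Qmu : forall A, measurable A -> mu A = 0%E -> Q A = 0%E.

Lemma ae_good : {ae Q, forall w, good e w}.
Proof.
have h1 : {ae Q, forall w : S, \det w.1.1 = 1 -> cube d w.1.2 -> near1 w.1.1 e -> good e w}.
  by have [N [mN N0 hN]] := @ae_good_mu R d e e2; exists N; split => //; exact: Qmu.
have h2 : {ae Q, forall w : S, SL_T_R w}.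
  by apply: ae_law; [exact: measurable_SL_T_R|apply: aeW => w; split; [exact: dU|exact: x01]].
have h3 : {ae Q, forall w : S, near1 w.1.1 e}.
  apply: ae_law => //.
  rewrite (_ : mkset _ = (fun w : S => w.1.1) @^-1` [set U | near1 U e])//.
  rewrite -[X in measurable X]setTI.
  have m1 : measurable_fun setT (fun w : S => w.1.1).
    exact: (measurableT_comp measurable_fst measurable_fst).
  by apply: m1 => //; exact: measurable_near1.
have h4 : {ae Q, forall w : S, SL_T_R w /\ near1 w.1.1 e} by exact: (ae_sub2 _ h2 h3).
by apply: (ae_sub2 _ h1 h4) => w h [[a b] c]; exact: h.
Qed.

Let X (T : R) (w : Omega) : R := discrepancy (v w) (x w) (mx_box u (U w)) T.

(** Both terms are integrals, over a time interval and over the unit cube, of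
    an indicator that is jointly measurable in the sample and the integration
    variable. *)
Lemma measurable_discrepancy T : measurable_fun setT (X T).
Proof.
have mU : measurable_fun setT U.
  exact: (measurableT_comp measurable_fst (measurableT_comp measurable_fst mW)).
have mx : measurable_fun setT x.
  exact: (measurableT_comp measurable_snd (measurableT_comp measurable_fst mW)).
have mv : measurable_fun setT v by exact: (measurableT_comp measurable_snd mW).
have XE : X T = fun w =>
    \int[lam]_(t in `[0, T]) (\1_(tbox u (U w)) (x w + t *: v w)) -
    T * \int[leb d]_(z in cube d) \1_(tbox u (U w)) z.
  apply/funext => w; rewrite /X /discrepancy -(fcos0_tbox u (dU w)) (tboxE u (dU w)).
  congr (_ - T * _); apply: eq_Rintegral => z _.
  by rewrite zdot0 mulr0 cos0 mul1r.
rewrite XE; apply: measurable_funB.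
  have mA : measurable [set wt : Omega * measurableTypeR R |
      tbox u (U wt.1) (x wt.1 + wt.2 *: v wt.1)].
    rewrite (_ : mkset _ = (fun wt : Omega * measurableTypeR R =>
      (U wt.1, x wt.1 + (wt.2 : R) *: v wt.1)) @^-1` [set w : 'M[R]_d * 'cV[R]_d | tbox u w.1 w.2])//.
    rewrite -[X in measurable X]setTI; apply: measurable_fun_pair => //; last first.
      exact: measurable_tbox_pair.
      apply: measurable_fun_mx => i j; under eq_fun do rewrite !mxE.
      apply: measurable_funD.
        exact: (measurableT_comp (measurable_mx_entry i j) (measurableT_comp mx measurable_fst)).
      apply: measurable_funM; first exact: measurable_snd.
      exact: (measurableT_comp (measurable_mx_entry i j) (measurableT_comp mv measurable_fst)).
    exact: (measurableT_comp mU measurable_fst).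
  rewrite (_ : (fun w => _) = fun w => \int[lam]_(t in `[0, T])
     \1_[set wt : Omega * measurableTypeR R | tbox u (U wt.1) (x wt.1 + (wt.2 : R) *: v wt.1)] (w, t)); last first.
    apply/funext => w; apply: eq_Rintegral => t _; rewrite !indicE.
    by congr (_%:R); congr nat_of_bool; apply/idP/idP => /set_mem h; apply/mem_set.
  apply: (@measurable_parameter _ _ Omega (measurableTypeR R) R P lam `[0, T]%classic _ 1) => //.
  - by rewrite /= lebesgue_measure_itv /=; case: ifP => // _; rewrite -EFinB ltry.
  - by move=> wt; rewrite indicE; case: (_ \in _); rewrite ?normr1 ?normr0.
apply: measurable_funM => //.
have mA : measurable [set wz : Omega * 'cV[R]_d | tbox u (U wz.1) wz.2].
  rewrite (_ : mkset _ = (fun wz : Omega * 'cV[R]_d =>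
    (U wz.1, wz.2)) @^-1` [set w : 'M[R]_d * 'cV[R]_d | tbox u w.1 w.2])//.
  rewrite -[X in measurable X]setTI; apply: measurable_fun_pair => //; last first.
    exact: measurable_tbox_pair.
  exact: (measurableT_comp mU measurable_fst).
rewrite (_ : (fun w => _) = fun w => \int[leb d]_(z in cube d)
   \1_[set wz : Omega * 'cV[R]_d | tbox u (U wz.1) wz.2] (w, z)); last first.
  apply/funext => w; apply: eq_Rintegral => t _; rewrite !indicE.
  by congr (_%:R); congr nat_of_bool; apply/idP/idP => /set_mem h; apply/mem_set.
apply: (measurable_parameter P (M := 1)) => //.
- exact: measurable_cube.
- by rewrite /= lebesgue_cube ltry.
- by move=> wt; rewrite indicE; case: (_ \in _); rewrite ?normr1 ?normr0.
Qed.

Let Z (wy : S * 'cV[R]_d) : R := corr u wy.1.1.1 wy.1.2 wy.2 - corr u wy.1.1.1 wy.1.2 wy.1.1.2.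

Let mZ : measurable_fun setT Z.
Proof.
have mc := measurable_corr u Q; apply: measurable_funB => //.
rewrite (_ : (fun _ => _) = (fun wy : S * 'cV[R]_d => corr u wy.1.1.1 wy.1.2 wy.2) \o
  (fun wy : S * 'cV[R]_d => (wy.1, wy.1.1.2)))//.
apply: (measurableT_comp mc); apply: measurable_fun_pair => //.
exact: (measurableT_comp measurable_snd (measurableT_comp measurable_fst measurable_fst)).
Qed.

Let Zm : {mfun (S * 'cV[R]_d)%type >-> R} := mfun_Sub (mem_set mZ).

Let nu : probability R R := distribution (Q \x @cube_prob R d)%E Zm.

Let integral_nu (f : R -> R) (K : R) : continuous f -> (forall a, `|f a| <= K) ->
  (\int[nu]_a (f a)%:E = (\int[Q]_w \int[leb d]_(y in cube d) f (Z (w, y)))%:E)%E.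
Proof.
move=> cf fK; have mf := continuous_measurable_fun cf.
have mfZ : measurable_fun setT (f \o Z) by exact: measurableT_comp.
have ifZ : (Q \x @cube_prob R d)%E.-integrable setT (EFin \o (f \o Z)).
  by apply: (probability_bounded_integrable _ (M := K)) => // w; exact: fK.
rewrite integral_distribution//; last exact/measurable_EFinP.
transitivity (\int[Q]_w \int[@cube_prob R d]_y (f (Z (w, y)))%:E)%E.
  exact/esym/(integral12_prod_meas1 ifZ).
have inner w : (\int[@cube_prob R d]_y (f (Z (w, y)))%:E =
    (\int[leb d]_(y in cube d) f (Z (w, y)))%:E)%E.
  apply: (integral_cube_prob (M := K)); last by move=> y; exact: fK.
  exact: (measurableT_comp mfZ (measurable_pair1 w)).
have mI : measurable_fun setT (fun w => \int[leb d]_(y in cube d) f (Z (w, y))).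
  apply: (measurable_parameter Q (h := f \o Z) (M := K)) => //.
  - exact: measurable_cube.
  - by rewrite /= lebesgue_cube ltry.
  - by move=> w; exact: fK.
rewrite (eq_integral (fun w => (\int[leb d]_(y in cube d) f (Z (w, y)))%:E)); last first.
  by move=> w _; exact: inner.
have iI := probability_bounded_integrable Q mI (M := K).
have fin := integrable_fin_num measurableT (iI _); apply/esym/fineK; apply: fin => w.
apply: cube_integral_le; last by move=> y; exact: fK.
exact: (measurableT_comp mfZ (measurable_pair1 w)).
Qed.

Lemma ae_discrepancyE : {ae P, forall w, forall T, 0 <= T ->
  X T w = Z (W w, x w + T *: v w)}.
Proof.
have [N [mN N0 hN]] := ae_good; exists (W @^-1` N); split.
- by rewrite -[X in measurable X]setTI; apply: mW.
- exact: N0.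
move=> w /= hw; apply: hN => /= -[dw nw aw den [B hB]]; apply: hw => T T0.
exact: (discrepancy_corr u01 dw nw e0 e2 ue den hB (x w) T0 aw).
Qed.

(** The limit is the law of corr y - corr x where y is uniform on the torus
    and independent of (U, x, v). *)
Lemma discrepancy_cvg_in_distribution : cvg_in_distribution P X.
Proof.
split; first exact: measurable_discrepancy.
exists nu => f cf [K fK]; rewrite (integral_nu cf fK).
have mf := continuous_measurable_fun cf.
pose g T := \int[Q]_w f (Z (w, w.1.2 + T *: w.2)).
have cg : g T @[T --> +oo] --> \int[Q]_w \int[leb d]_(y in cube d) f (Z (w, y)).
  apply/cvg_pinftyP => t toy.
  exact: (corr_equidistribution u01 e0 e2 ue ae_good Qmu cf fK toy).
have h : (g T)%:E @[T --> +oo] --> (\int[Q]_w \int[leb d]_(y in cube d) f (Z (w, y)))%:E.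
  by apply: cvg_EFin => //; exact: nearW.
apply: cvg_trans h; apply: near_eq_cvg; near=> T.
have T0 : 0 <= T by near: T; exact: nbhs_pinfty_ge.
have mflow : measurable_fun setT (fun w : S => (w, w.1.2 + T *: w.2)).
  apply: measurable_fun_pair => //; apply: measurable_fun_mx => i j.
  under eq_fun do rewrite !mxE.
  apply: measurable_funD.
    exact: (measurableT_comp (measurable_mx_entry i j) (measurableT_comp measurable_snd measurable_fst)).
  apply: measurable_funM => //; exact: (measurableT_comp (measurable_mx_entry i j) measurable_snd).
have mG : measurable_fun setT (fun w : S => f (Z (w, w.1.2 + T *: w.2))).
  by apply: (measurableT_comp mf); exact: (measurableT_comp mZ mflow).
have mfX : measurable_fun setT (f \o X T).
  by apply: (measurableT_comp mf); exact: measurable_discrepancy.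
have ifX : P.-integrable setT (EFin \o (f \o X T)).
  by apply: (probability_bounded_integrable _ (M := K)) => // w; exact: fK.
have mGW : measurable_fun setT (fun w => f (Z (W w, x w + T *: v w))).
  exact: (measurableT_comp mG mW).
have iGW : P.-integrable setT (EFin \o (fun w => f (Z (W w, x w + T *: v w)))).
  by apply: (probability_bounded_integrable _ (M := K)) => // w; exact: fK.
pose XT : {mfun Omega >-> R} := mfun_Sub (mem_set (measurable_discrepancy T)).
transitivity (\int[P]_w (f (X T w))%:E)%E; last first.
  apply/esym; apply: (integral_distribution (P := P) (X := XT) (f := EFin \o f)) => //.
  exact/measurable_EFinP.
transitivity (\int[P]_w (f (Z (W w, x w + T *: v w)))%:E)%E.
  rewrite /g /Rintegral.
  have -> : (\int[Q]_w (f (Z (w, w.1.2 + T *: w.2)))%:E =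
     \int[P]_w (f (Z (W w, x w + T *: v w)))%:E)%E.
    apply: (integral_distribution (P := P) (X := Wm)
      (f := fun w : S => (f (Z (w, w.1.2 + T *: w.2)))%:E)) => //.
    exact/measurable_EFinP.
  by rewrite fineK//; apply: integrable_fin_num.
apply: ae_eq_integral => //.
- exact/measurable_EFinP.
- exact/measurable_EFinP.
by apply: (ae_sub _ ae_discrepancyE) => w hw _; rewrite /= hw.
Unshelve. all: by end_near. Qed.

End law.
End assembly.

Theorem theorem10p1 (R : realType) (d : nat) (u : 'I_d -> R)
    (d_ge2 : (2 <= d)%N) (u01 : forall j, 0 < u j < 1) :
  exists2 eta : R, 0 < eta &
    forall (dO : measure_display) (Omega : measurableType dO)
      (P : probability Omega R) (U : Omega -> 'M[R]_d)
      (x v : Omega -> 'cV[R]_d) (rho : sample_space R d -> R),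
      measurable_fun setT (fun w => (U w, x w, v w) : sample_space R d) ->
      (forall w, \det (U w) = 1) ->
      (forall w, unit_cube (x w)) ->
      smooth_compact_density rho ->
      has_density P (fun w => (U w, x w, v w)) rho ->
      {ae P, forall w, `|U w - 1%:M| <= eta} ->
      cvg_in_distribution P
        (fun T w => discrepancy (v w) (x w) (mx_box u (U w)) T).
Proof.
have [eta [eta0 eta2 ueta]] := exists_eta (ltnW d_ge2) u01.
exists eta => // dO Omega P U x v rho mW dU x01 hrho hW hU.
have nU : {ae P, forall w, near1 (U w) eta}.
  by apply: ae_sub hU => w; exact: near1_norm.
have dom := law_dominated mW hrho hW.
exact: (discrepancy_cvg_in_distribution dU x01 u01 (ltW eta0) eta2 ueta nU dom).
Qed.
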